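(* Let $\Sigma$ be a hypersurface of Euclidean space $\mathbb{R}^{n+1}$ enclosing a compact domain $\Omega$. Suppose that $\Sigma$ is isometric and isospin to a unit sphere $\mathbb{S}^n$ and that its inner mean curvature $H$ satisfies $H\ge 1$. Then $\Omega$ is a round disc $\mathbb{D}^{n+1}$ of radius $1$ and $\Sigma$ is the round sphere $\mathbb{S}^n$ enclosing it.
   Context: $H=\frac1n\operatorname{trace}A$, where $A$ is the shape operator of $\Sigma$ with respect to the inner unit normal (so the unit sphere in $\mathbb{R}^{n+1}$ has $H=1$). ''Isometric and isospin'' means that there is an isometry which identifies the spin structure of $\Sigma$ induced as the boundary of $\Omega$ with the usual Riemannian spin structure of $\mathbb{S}^n$. *)

(* Defs.v *)
From HB Require Import structures.
From mathcomp Require Export all_boot all_order all_algebra.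
From mathcomp Require Export all_classical all_reals all_analysis.

Set Implicit Arguments.
Unset Strict Implicit.
Unset Printing Implicit Defensive.

Export Order.TTheory GRing.Theory Num.Theory.
Export numFieldNormedType.Exports.

Local Open Scope classical_set_scope.
Local Open Scope ring_scope.

Section EuclideanSpace.
Context {R : realType} {n : nat}.
Local Notation V := 'rV[R]_n.+1.
Implicit Types (x c u v : V) (r : R).

(* The norm `|v| of MathComp-Analysis on row vectors is the sup norm: it gives
   the right topology, but not the Euclidean metric. *)
Definition dot u v : R := (u *m v^T) 0 0.

Definition enorm v : R := Num.sqrt (dot v v).

Definition round_sphere c r : set V := [set x | enorm (x - c) = r].

Definition round_disc c r : set V := [set x | enorm (x - c) <= r].

Definition unit_sphere : set V := round_sphere 0 1.

End EuclideanSpace.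

Section Smoothness.
Context {R : realType}.

(* foldr f along vs: the iterated directional derivative of f. *)
Definition iterD {U W : normedModType R} (vs : seq U) (f : U -> W) : U -> W :=
  foldr (fun v g => fun x => 'D_v g x) f vs.

(* C^oo on the open set A: all iterated directional derivatives are
   Frechet differentiable (hence continuous) at every point of A. *)
Definition smooth_on {U W : normedModType R} (A : set U) (f : U -> W) : Prop :=
  forall (vs : seq U) (x : U), A x -> differentiable (iterD vs f) x.

End Smoothness.

Section Hypersurfaces.
Context {R : realType} {n : nat}.
Local Notation V := 'rV[R]_n.+1.
Implicit Types (M : set V) (p v : V).

Definition hypersurface M : Prop :=
  forall p, M p -> exists (U : set V) (phi : V -> R),
    [/\ open U, U p, smooth_on U phi,
        exists v, 'D_v phi p != 0
      & forall q, U q -> (M q <-> phi q = 0)].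

Definition tangent_curve M p v (gamma : R -> V) : Prop :=
  [/\ exists2 I : set R, open I /\ I 0 &
        smooth_on I gamma /\ (forall t, I t -> M (gamma t)),
      gamma 0 = p
    & is_derive (0 : R) (1 : R) gamma v].

Definition tangent M p : set V :=
  [set v | exists gamma, tangent_curve M p v gamma].

Definition smooth_map M {m : nat} (g : V -> 'rV[R]_m.+1) : Prop :=
  forall p, M p -> exists (U : set V) (G : V -> 'rV[R]_m.+1),
    [/\ open U, U p, smooth_on U G & forall q, U q -> M q -> G q = g q].

(* The differential d_p g (v) of g : M -> R^(m+1), for v tangent to M at p;
   g needs to be defined only on M. *)
Definition tdiff M {m : nat} (g : V -> 'rV[R]_m.+1) p v : 'rV[R]_m.+1 :=
  xget 0 [set w | exists2 gamma, tangent_curve M p v gamma &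
                  is_derive (0 : R) (1 : R) (g \o gamma) w].

(* Isometry of hypersurfaces with the induced Riemannian metrics: a
   diffeomorphism whose differential preserves inner products. *)
Definition isometry M (M' : set V) (Phi : V -> V) : Prop :=
  [/\ set_bij M M' Phi,
      smooth_map M Phi,
      exists2 Psi, smooth_map M' Psi & forall x, M x -> Psi (Phi x) = x
    & forall x u v, M x -> tangent M x u -> tangent M x v ->
        dot (tdiff M Phi x u) (tdiff M Phi x v) = dot u v].

Definition encloses M (Omega : set V) : Prop :=
  [/\ compact Omega, connected Omega°, closure Omega° = Omega
    & Omega `\` Omega° = M].

Definition inner_unit_normal M (Omega : set V) (N : V -> V) : Prop :=
  forall p, M p ->
    [/\ enorm (N p) = 1,
        forall v, tangent M p v -> dot (N p) v = 0
      & \forall t \near (0 : R)^'+, Omega° (p + t *: N p)].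

Definition shape_operator M (N : V -> V) p : V -> V :=
  fun v => - tdiff M N p v.

(* The trace of an endomorphism A of T_p M: the trace of its matrix B in a
   basis of T_p M, given by the rows of E. *)
Definition tangent_trace M p (A : V -> V) : R :=
  xget 0 [set t | exists (E : 'M[R]_(n, n.+1)) (B : 'M[R]_n),
    [/\ row_free E,
        forall i, tangent M p (row i E),
        forall i, A (row i E) = row i (B *m E)
      & t = \tr B]].

Definition mean_curvature M (N : V -> V) p : R :=
  n%:R^-1 * tangent_trace M p (shape_operator M N p).

End Hypersurfaces.

Section Clifford.
Context {R : realType} {m : nat}.

(* The real Clifford algebra Cl_m with v * v = - |v|^2: an element is given by
   its coordinates in the basis e_S = e_(i1) ... e_(ik), indexed by the subsets
   S = {i1 < ... < ik} of 'I_m. *)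
Definition clifford := 'rV[R]_#|{set 'I_m}|.

Definition cl_coef (a : clifford) (S : {set 'I_m}) : R := a 0 (enum_rank S).

(* e_S * e_T = (-1)^k e_(S (+) T), where k counts the transpositions that sort
   the product (pairs j < i) and the cancellations e_i * e_i = -1. *)
Definition cl_sign (S T : {set 'I_m}) : R :=
  (-1) ^+ #|[pred ij : 'I_m * 'I_m | [&& ij.1 \in S, ij.2 \in T & (ij.2 <= ij.1)%N]]|.

Definition cl_mul (a b : clifford) : clifford :=
  \row_k \sum_S \sum_(T | (S :\: T) :|: (T :\: S) == enum_val k)
    cl_sign S T * cl_coef a S * cl_coef b T.

Definition cl_one : clifford := \row_k (enum_val k == finset.set0)%:R.

Definition cl_vec (v : 'rV[R]_m) : clifford :=
  \row_k \sum_i v 0 i * (enum_val k == finset.set1 i)%:R.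

End Clifford.
Arguments clifford : clear implicits.

Section Spin.
Context {R : realType} {n : nat}.
Local Notation V := 'rV[R]_n.+1.
Local Notation Cl := (clifford R n.+1).

(* Spin(W): products of an even number of unit vectors of the subspace W. *)
Definition spin_group (W : set V) : set Cl :=
  [set s | exists vs : seq V,
    [/\ ~~ odd (size vs),
        forall v, v \in vs -> W v /\ enorm v = 1
      & s = foldr (fun v a => cl_mul (cl_vec v) a) cl_one vs]].

Definition Spin : set Cl := spin_group setT.

(* Spin(n) inside Spin(n+1), as the spin group of the hyperplane spanned by the
   first n vectors of the canonical basis. *)
Definition Spin_sub : set Cl := spin_group [set v | v 0 ord_max = 0].

(* Ad(s) v = w, i.e. s v s^-1 = w, for the covering Ad : Spin(n+1) -> SO(n+1). *)
Definition cl_Ad (s : Cl) (v w : V) : Prop :=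
  cl_mul s (cl_vec v) = cl_mul (cl_vec w) s.

(* The spin structure induced by R^(n+1) on a hypersurface M with unit normal
   N.  The oriented orthonormal frames (e_1, ..., e_n) of M at p correspond to
   the elements (e_1, ..., e_n, N p) of SO(n+1), and the spin structure is the
   pullback of Ad by this map: its total space consists of the pairs (p, s)
   with s in Spin(n+1) and Ad(s) e_(n+1) = N p; the pair (p, s) lies above the
   frame (Ad(s) e_1, ..., Ad(s) e_n) and a in Spin(n) acts by
   (p, s) |-> (p, s a).
   If M bounds Omega, this is the spin structure induced on M as the boundary
   of Omega.  For M the unit sphere with N p = - p, it is, up to the redundant
   first component, Spin(n+1) -> SO(n+1), the usual spin structure of S^n. *)
Definition spin_bundle (M : set V) (N : V -> V) : set (V * Cl) :=
  [set ps | [/\ M ps.1, Spin ps.2 & cl_Ad ps.2 (delta_mx 0 ord_max) (N ps.1)]].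

(* The map of oriented frames induced by Phi lifts to an isomorphism of the
   spin structures: a continuous Spin(n)-equivariant map, of which F is the
   second component (such a morphism of principal bundles over a
   diffeomorphism is an isomorphism).  In particular Phi preserves the
   orientations. *)
Definition identifies_spin (M : set V) (N : V -> V) (M' : set V) (N' : V -> V)
    (Phi : V -> V) : Prop :=
  exists F : V * Cl -> Cl,
    {within spin_bundle M N, continuous F} /\
    forall x s, spin_bundle M N (x, s) ->
      [/\ spin_bundle M' N' (Phi x, F (x, s)),
          forall (i : 'I_n) (u : V),
            cl_Ad s (delta_mx 0 (lift ord_max i)) u ->
            cl_Ad (F (x, s)) (delta_mx 0 (lift ord_max i)) (tdiff M Phi x u)
        & forall a, Spin_sub a -> F (x, cl_mul s a) = cl_mul (F (x, s)) a].

(* M, with unit normal N, is isometric and isospin to the unit sphere, which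
   carries its inner unit normal - x. *)
Definition isometric_isospin_sphere (M : set V) (N : V -> V) : Prop :=
  exists Phi : V -> V,
    isometry unit_sphere M Phi /\
    identifies_spin unit_sphere (fun x => - x) M N Phi.

End Spin.

(* Main.v *)
Require Import Defs.
From HB Require Import structures.
From mathcomp Require Import ring lra.

Set Implicit Arguments.
Unset Strict Implicit.
Unset Printing Implicit Defensive.

Local Open Scope classical_set_scope.
Local Open Scope ring_scope.

(** The isometry from the unit sphere is extended to a positively homogeneous
    map [f] of degree 0 on the punctured space, where flat directional
    derivatives can be used.  [f] has the same metric as the radial projection,
    hence satisfies the same Gauss equations: in an orthonormal frame of a
    tangent space, the 2x2 minors of the second fundamental form [h] are those
    of the identity.  It suffices to prove that [h] is the identity: then
    [N + f] is constant, so the hypersurface lies on a unit sphere.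

    - In dimension at least 3, a symmetric matrix with the 2x2 minors of the
      identity is plus or minus the identity, and the trace fixes the sign.
    - In dimension 2 (Hilbert's argument), the Gauss and Codazzi equations
      contradict the second derivative test at a point where the trace of [h]
      is maximal, unless [h] is the identity there; so the trace is at most 2.
    - In dimension 1, the curvature is positive, so the domain is strictly
      convex and the normal, which turns at speed at least 1, does not take
      the same value twice along the curve; as the length is 2 pi, it turns
      at speed 1. *)


(** * Smooth functions *)

(** Charts and covariant derivatives are avoided: as [f] is constant along rays, its flat
    derivatives at a unit vector [x] in fixed directions orthogonal to [x] already span the tangent
    space, and they commute, so that the Codazzi equations are mere symmetry of third derivatives.
    The price is that a fixed direction is no longer tangent to the spheres away from [x]: terms
    that are constant on the sphere vary along straight lines, which is the origin of the constants
    2, 6, -8 and -10 in the surface case. The Gauss equations lose strength as the dimension drops.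
    They fix [h] up to sign when the dimension is at least 3; they only fix its determinant on
    surfaces, where the trace has to be bounded by a maximum over the whole sphere; they are empty
    for curves, where only the total length remains and convexity must prevent the normal from
    completing a turn too early. The normal comes as a bare function. Its smoothness is obtained by
    identifying it with the normalized gradient of a local defining function, which requires knowing
    on which side of the boundary the domain lies. *)

Section Germs.
Context {R : realType} {U W : normedModType R}.

Lemma near_eq_differentiable (f g : U -> W) (x : U) :
  (\near x, f x = g x) -> differentiable f x -> differentiable g x.
Proof.
move=> fg df.
have dg : g \o shift x = cst (g x) + 'd f x +o_ 0 id.
  apply/eqaddoP => _/posnumP[e].
  have /diff_locally/eqaddoP/(_ e%:num (ltac:(by [])))  dfx := df.
  have fg0 : \forall h \near (0 : U), f (h + x) = g (h + x).
    move: fg; rewrite (near_shift 0) subr0; exact.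
  near=> h.
  rewrite -[X in `|X|]/(g (h + x) - (g x + 'd f x h)).
  rewrite -(nbhs_singleton fg) -(near fg0 h)//.
  by near: h.
have cf : continuous ('d f x) by exact: diff_continuous.
by apply/diff_locallyP; rewrite (diff_unique cf dg).
Unshelve. all: by end_near. Qed.

Lemma smooth_on_differentiable (A : set U) (f : U -> W) x :
  smooth_on A f -> A x -> differentiable f x.
Proof. by move=> sf Ax; exact: (sf [::] x Ax). Qed.

Lemma smooth_on_derive (A : set U) (f : U -> W) v :
  smooth_on A f -> smooth_on A ('D_v f).
Proof.
move=> sf vs x Ax; have := sf (rcons vs v) x Ax.
by rewrite /iterD foldr_rcons.
Qed.

Lemma smooth_on_sub (A B : set U) (f : U -> W) :
  A `<=` B -> smooth_on B f -> smooth_on A f.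
Proof. by move=> AB sf vs x /AB; exact: sf. Qed.

Lemma smooth_is_derive (A : set U) (f : U -> W) x v :
  smooth_on A f -> A x -> is_derive x v f ('D_v f x).
Proof.
by move=> sf Ax; apply/derivableP/diff_derivable/(smooth_on_differentiable sf).
Qed.

Lemma smooth_continuous (A : set U) (f : U -> W) x :
  smooth_on A f -> A x -> {for x, continuous f}.
Proof.
by move=> sf Ax; apply/differentiable_continuous/(smooth_on_differentiable sf).
Qed.

Lemma smooth_on_eq (A : set U) (f g : U -> W) : open A ->
  (forall x, A x -> f x = g x) -> smooth_on A f -> smooth_on A g.
Proof.
move=> oA fg sf.
have E vs x : A x -> iterD vs f x = iterD vs g x.
  elim: vs x => [|v vs IH] x Ax /=; first exact: fg.
  apply: near_eq_derive; near=> y; apply: IH.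
  by near: y; exact: open_nbhs_nbhs.
move=> vs x Ax; apply: near_eq_differentiable (sf vs x Ax).
near=> y; apply: E.
by near: y; exact: open_nbhs_nbhs.
Unshelve. all: by end_near. Qed.

(* [Ck k A f] is the finite-order version of [smooth_on A f]; smoothness of
   products and compositions is proved by induction on the order. *)
Fixpoint Ck (k : nat) (A : set U) (f : U -> W) : Prop :=
  if k is k'.+1 then
    (forall x, A x -> differentiable f x) /\ forall v, Ck k' A ('D_v f)
  else True.

Lemma smooth_onP (A : set U) (f : U -> W) :
  smooth_on A f <-> forall k, Ck k A f.
Proof.
split=> [sf k|cf vs].
  elim: k f sf => [//|k IH] f sf; split.
    by move=> x; exact: smooth_on_differentiable.
  by move=> v; apply/IH/smooth_on_derive.
elim/last_ind: vs f cf => [|vs v IH] f cf x Ax /=.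
  by have [+ _] := cf 1%N; apply.
rewrite /iterD foldr_rcons; apply: IH => // k.
by have [_] := cf k.+1; apply.
Qed.

Lemma CkW k (A : set U) (f : U -> W) : Ck k.+1 A f -> Ck k A f.
Proof.
elim: k f => [//|k IH] f [df cf]; split=> // v; apply: IH; exact: cf.
Qed.

Lemma Ck_eq k (A : set U) (f g : U -> W) : open A ->
  (forall x, A x -> f x = g x) -> Ck k A f -> Ck k A g.
Proof.
move=> oA; elim: k f g => [//|k IH] f g fg [df cf]; split.
  move=> x Ax; apply: near_eq_differentiable (df x Ax).
  near=> y; apply: fg.
  by near: y; exact: open_nbhs_nbhs.
move=> v; apply: IH (cf v) => x Ax; apply: near_eq_derive.
near=> y; apply: fg.
by near: y; exact: open_nbhs_nbhs.
Unshelve. all: by end_near. Qed.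

Lemma CkD k (A : set U) (f g : U -> W) : open A ->
  Ck k A f -> Ck k A g -> Ck k A (fun x => f x + g x).
Proof.
move=> oA; elim: k f g => [//|k IH] f g [df cf] [dg cg]; split.
  by move=> x Ax; apply: (@differentiableD _ _ _ f g); [exact: df|exact: dg].
move=> v; apply: Ck_eq (IH _ _ (cf v) (cg v)) => // x Ax.
by rewrite -[in RHS]/(f + g) deriveD//; apply: diff_derivable; [exact: df|exact: dg].
Qed.

Lemma Ck_cst k (A : set U) (a : W) : Ck k A (cst a).
Proof.
elim: k a => [//|k IH] a; split=> [x Ax|v]; first exact: differentiable_cst.
rewrite (_ : 'D_v (cst a) = cst 0)//.
by apply/funext => x; rewrite derive_cst.
Qed.

Lemma Ck_sum k (A : set U) m (f : 'I_m -> U -> W) : open A ->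
  (forall i, Ck k A (f i)) -> Ck k A (fun x => \sum_(i < m) f i x).
Proof.
move=> oA; elim: m f => [|m IH] f cf.
  by apply: Ck_eq (Ck_cst k A 0) => // x _; rewrite big_ord0.
apply: Ck_eq (CkD oA (IH _ (fun i => cf (widen_ord (leqnSn m) i))) (cf ord_max)) => //.
by move=> x _; rewrite big_ord_recr.
Qed.

End Germs.

Section SmoothAlgebra.
Context {R : realType} {U : normedModType R}.
Implicit Types (A : set U) (f g : U -> R).

Lemma CkM k A f g : open A ->
  Ck k A f -> Ck k A g -> Ck k A (fun x => f x * g x).
Proof.
move=> oA; elim: k f g => [//|k IH] f g cf cg.
have [df df'] := cf; have [dg dg'] := cg; split.
  by move=> x Ax; apply: (@differentiableM _ _ f g); [exact: df|exact: dg].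
move=> v.
apply: Ck_eq (CkD oA (IH _ _ (CkW cf) (dg' v)) (IH _ _ (CkW cg) (df' v))) => //.
move=> x Ax; rewrite -[in RHS]/(f * g) deriveM//; apply: diff_derivable.
- exact: df.
- exact: dg.
Qed.

Lemma derive_coord {m1 m2} (F : U -> 'M[R]_(m1, m2)) x v i j :
  derivable F x v -> 'D_v F x i j = 'D_v (fun y => F y i j) x.
Proof. by move=> dF; rewrite derive_mx// mxE. Qed.

Lemma differentiable_coords {m} (F : U -> 'rV[R]_m) x :
  (forall i, differentiable (fun y => F y 0 i) x) -> differentiable F x.
Proof.
move=> dF.
have -> : F = \sum_(i < m) (fun y => F y 0 i *: (delta_mx 0 i : 'rV[R]_m)).
  by apply/funext => y; rewrite fct_sumE; exact: row_sum_delta.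
by apply: differentiable_sum => i; exact: differentiableZl.
Qed.

Lemma coord_differentiable {m} (F : U -> 'rV[R]_m) x i :
  differentiable F x -> differentiable (fun y => F y 0 i) x.
Proof.
move=> dF; apply: (@differentiable_comp _ _ _ _ F (fun M : 'rV[R]_m => M 0 i)) => //.
exact: differentiable_coord.
Qed.

Lemma Ck_coordP k A {m} (F : U -> 'rV[R]_m) : open A ->
  Ck k A F <-> forall i, Ck k A (fun x => F x 0 i).
Proof.
move=> oA; elim: k F => [//|k IH] F; split.
  move=> [dF cF] i; split=> [x Ax|v]; first exact/coord_differentiable/dF.
  apply: Ck_eq ((IH _).1 (cF v) i) => // x Ax.
  by apply: derive_coord; exact/diff_derivable/dF.
move=> cF.
have dF x : A x -> differentiable F x.
  by move=> Ax; apply: differentiable_coords => i; have [+ _] := cF i; apply.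
split=> // v; apply/IH => i; have [_ /(_ v)] := cF i.
apply: Ck_eq => // x Ax.
by apply/esym/derive_coord; exact/diff_derivable/dF.
Qed.

Lemma derive_linear {W : normedModType R} (F : U -> W) x : differentiable F x ->
  forall a v w, 'D_(a *: v + w) F x = a *: 'D_v F x + 'D_w F x.
Proof. by move=> dF a v w; rewrite !deriveE// linearP. Qed.

Lemma derive_comp {V W : normedModType R} (G : V -> W) (h : U -> V) x v :
  differentiable h x -> differentiable G (h x) ->
  'D_v (G \o h) x = 'D_('D_v h x) G (h x).
Proof.
move=> dh dG; rewrite deriveE; last exact: differentiable_comp.
by rewrite diff_comp//= !deriveE.
Qed.

Lemma derive_rV {W : normedModType R} {m} (G : 'rV[R]_m -> W) y w :
  differentiable G y -> 'D_w G y = \sum_i w 0 i *: 'D_(delta_mx 0 i) G y.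
Proof.
move=> dG; rewrite deriveE// {1}[w]row_sum_delta linear_sum.
by apply: eq_bigr => i _; rewrite linearZ/= deriveE.
Qed.

(** The chain rule in coordinates writes a derivative of [G \o h] as a sum of products of [Ck k]
    functions, which closes the induction on the order. *)
Lemma Ck_comp k A {m} (B : set 'rV[R]_m) (G : 'rV[R]_m -> R) (h : U -> 'rV[R]_m) :
  open A -> open B -> (forall x, A x -> B (h x)) ->
  Ck k B G -> Ck k A h -> Ck k A (G \o h).
Proof.
move=> oA oB AB; elim: k G => [//|k IH] G [dG cG] ch.
have [dh ch'] := ch; split.
  move=> x Ax; apply: differentiable_comp; [exact: dh|exact/dG/AB].
move=> v.
pose H := fun x => \sum_i 'D_v h x 0 i * ('D_(delta_mx 0 i) G \o h) x.
apply: (@Ck_eq _ _ _ _ _ H) => //.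
  move=> x Ax; rewrite derive_comp//; [|exact: dh|exact/dG/AB].
  by rewrite [RHS]derive_rV//; exact/dG/AB.
apply: Ck_sum => // i; apply: CkM => //; last exact: (IH _ (cG _) (CkW ch)).
by apply: (Ck_coordP _ _ oA).1; exact: ch'.
Qed.

Lemma smooth_coordP A {m} (F : U -> 'rV[R]_m) : open A ->
  smooth_on A F <-> forall i, smooth_on A (fun x => F x 0 i).
Proof.
move=> oA; split=> [/smooth_onP sF i|sF].
  by apply/smooth_onP => k; apply: (Ck_coordP _ _ oA).1.
by apply/smooth_onP => k; apply/Ck_coordP => // i; move/smooth_onP: (sF i).
Qed.

Lemma smoothM A f g : open A ->
  smooth_on A f -> smooth_on A g -> smooth_on A (fun x => f x * g x).
Proof.
by move=> oA /smooth_onP sf /smooth_onP sg; apply/smooth_onP => k; exact: CkM.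
Qed.

Lemma smooth_sum A m (f : 'I_m -> U -> R) : open A ->
  (forall i, smooth_on A (f i)) -> smooth_on A (fun x => \sum_i f i x).
Proof.
by move=> oA sf; apply/smooth_onP => k; apply: Ck_sum => // i; exact: (smooth_onP _ _).1.
Qed.

End SmoothAlgebra.

Lemma smooth_comp {R : realType} {U : normedModType R} (A : set U) {m p}
    (B : set 'rV[R]_m) (G : 'rV[R]_m -> 'rV[R]_p) (h : U -> 'rV[R]_m) :
  open A -> open B -> (forall x, A x -> B (h x)) ->
  smooth_on B G -> smooth_on A h -> smooth_on A (G \o h).
Proof.
move=> oA oB AB /(smooth_coordP _ oB) sG /smooth_onP sh.
apply/(smooth_coordP _ oA) => i; apply/smooth_onP => k.
apply: (@Ck_comp _ _ k A m B (fun y => G y 0 i) h oA oB AB _ (sh k)).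
exact: (smooth_onP _ _).1.
Qed.



Lemma smoothD {R : realType} {U W : normedModType R} (A : set U) (f g : U -> W) :
  open A -> smooth_on A f -> smooth_on A g -> smooth_on A (fun x => f x + g x).
Proof.
by move=> oA /smooth_onP sf /smooth_onP sg; apply/smooth_onP => k; exact: CkD.
Qed.

Lemma smooth_cst {R : realType} {U W : normedModType R} (A : set U) (a : W) :
  smooth_on A (cst a).
Proof. by apply/smooth_onP => k; exact: Ck_cst. Qed.

Lemma smooth_id {R : realType} {U : normedModType R} (A : set U) :
  smooth_on A (id : U -> U).
Proof.
apply/smooth_onP => -[//|k]; split=> [x _|v]; first by exact: ex_diff.
rewrite (_ : 'D_v id = cst v); first exact: Ck_cst.
by apply/funext => x; rewrite derive_id.
Qed.

Lemma open_smooth_preimage {R : realType} {U W : normedModType R} (A : set U)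
    (B : set W) (h : U -> W) :
  open A -> smooth_on A h -> open B -> open (A `&` h @^-1` B).
Proof.
move=> oA sh oB; rewrite openE => y [Ay By]; apply: filterI.
  exact: open_nbhs_nbhs.
by apply: (smooth_continuous sh Ay); exact: open_nbhs_nbhs.
Qed.

(** * Symmetry of second derivatives *)

Section Schwarz.
Context {R : realType}.

Lemma is_derive_line {U W : normedModType R} (g : U -> W) (x v : U) (t : R) :
  differentiable g (x + t *: v) ->
  is_derive t (1 : R) (fun s : R => g (x + s *: v)) ('D_v g (x + t *: v)).
Proof.
move=> dg.
have dl : is_diff t (fun s : R => x + s *: v) (fun s : R => s *: v).
  rewrite (_ : (fun s : R => x + s *: v) = cst x + ( *:%R^~ v))//.
  by apply: (@is_diff_eq _ _ _ _ _ _ t (is_diffD _ _)); rewrite add0r.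
have dc : differentiable (g \o (fun s : R => x + s *: v)) t.
  by apply: differentiable_comp => //; exact: ex_diff.
apply: DeriveDef; first exact: diff_derivable.
by rewrite deriveE// diff_comp//= diff_val scale1r deriveE.
Qed.

(** The mean value theorem is applied twice: along [v] to the increment of [f] by [s *: w], then
    along [w] to the derivative in the direction [v]. *)
Lemma ex_second_difference {U : normedModType R} (A : set U) (f : U -> R)
    (x v w : U) (s : R) : 0 < s -> open A -> smooth_on A f ->
  (forall p q, 0 <= p <= s -> 0 <= q <= s -> A (x + p *: v + q *: w)) ->
  exists p q, [/\ 0 <= p <= s, 0 <= q <= s &
   f (x + s *: v + s *: w) - f (x + s *: v) - f (x + s *: w) + f x =
   'D_w ('D_v f) (x + p *: v + q *: w) * (s * s)].
Proof.
move=> s0 oA sf sA.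
have ss : 0 <= s <= s by rewrite lexx ltW.
have s00 : 0 <= (0 : R) <= s by rewrite lexx ltW.
pose phi p := f (x + s *: w + p *: v) - f (x + p *: v).
have dphi (p : R) : 0 <= p <= s -> is_derive p (1 : R) phi
    ('D_v f (x + s *: w + p *: v) - 'D_v f (x + p *: v)).
  move=> ps; apply: is_deriveB; apply: is_derive_line.
    apply: smooth_on_differentiable sf _.
    by rewrite addrAC; exact: sA.
  apply: smooth_on_differentiable sf _.
  by have := sA p 0 ps s00; rewrite scale0r addr0.
have [p] : exists2 p, p \in `]0, s[%R & phi s - phi 0 =
    ('D_v f (x + s *: w + p *: v) - 'D_v f (x + p *: v)) * (s - 0).
  apply: (@MVT R phi _ 0 s s0) => [p|].
    rewrite in_itv/= => /andP[p0 ps].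
    by apply: dphi; rewrite !ltW.
  apply: derivable_within_continuous => p; rewrite in_itv/= => ps.
  by have := dphi p ps => -[].
rewrite in_itv/= subr0 => /andP[p0 ps] E1.
have p0s : 0 <= p <= s by rewrite !ltW.
have dpsi (q : R) : 0 <= q <= s -> is_derive q (1 : R)
    (fun q => 'D_v f (x + p *: v + q *: w))
    ('D_w ('D_v f) (x + p *: v + q *: w)).
  move=> qs; apply: is_derive_line.
  by apply: smooth_on_differentiable (smooth_on_derive _ sf) _; exact: sA.
have [q] : exists2 q, q \in `]0, s[%R & 'D_v f (x + p *: v + s *: w) -
   'D_v f (x + p *: v + 0 *: w) = 'D_w ('D_v f) (x + p *: v + q *: w) * (s - 0).
  apply: (@MVT R (fun q => 'D_v f (x + p *: v + q *: w))
    (fun q => 'D_w ('D_v f) (x + p *: v + q *: w)) 0 s s0) => [q|].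
    rewrite in_itv/= => /andP[q0 qs].
    by apply: dpsi; rewrite !ltW.
  apply: derivable_within_continuous => q; rewrite in_itv/= => qs.
  by have := dpsi q qs => -[].
rewrite in_itv/= subr0 scale0r addr0 => /andP[q0 qs] E2.
exists p, q; split; rewrite ?ltW//.
rewrite mulrA -E2 [x + p *: v + _]addrAC -E1 /phi !scale0r !addr0.
by rewrite [x + s *: v + _]addrAC opprB addrA [RHS]addrAC.
Qed.

(** The second difference is symmetric in the two directions, so both mixed derivatives are limits
    of the same quotient. *)
Lemma schwarz {U : normedModType R} (A : set U) (f : U -> R) (a b x : U) :
  open A -> A x -> smooth_on A f -> 'D_a ('D_b f) x = 'D_b ('D_a f) x.
Proof.
move=> oA Ax sf.
have key (v w : U) (e : R) : 0 < e -> \forall s \near (0 : R)^'+,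
   `|(f (x + s *: v + s *: w) - f (x + s *: v) - f (x + s *: w) + f x) / (s * s)
     - 'D_w ('D_v f) x| < e.
  move=> e0.
  have c2 : {for x, continuous ('D_w ('D_v f))}.
    apply: smooth_continuous Ax.
    by apply: smooth_on_derive; exact: smooth_on_derive.
  have : nbhs x [set y | A y /\ `|'D_w ('D_v f) y - 'D_w ('D_v f) x| < e].
    apply: filterI; first exact: open_nbhs_nbhs.
    by move/cvgrPdist_lt : c2 => /(_ e e0); under eq_near do rewrite distrC.
  move=> /nbhs_normP[r /= r0 br].
  have brA y : `|x - y| < r -> A y by move=> /br[].
  near=> s.
  have s0 : 0 < s by near: s; exact: nbhs_right_gt.
  have small p q : 0 <= p <= s -> 0 <= q <= s -> `|x - (x + p *: v + q *: w)| < r.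
    move=> /andP[p0 ps] /andP[q0 qs].
    rewrite -addrA opprD addrA subrr add0r normrN.
    apply: (le_lt_trans (ler_normD _ _)); rewrite !normrZ !ger0_norm//.
    apply: (@le_lt_trans _ _ (s * (`|v| + `|w| + 1))).
      by rewrite !mulrDr mulr1 -[leLHS]addr0 !lerD ?ler_wpM2r// ltW.
    rewrite -ltr_pdivlMr; last by rewrite ltr_wpDl// addr_ge0.
    by near: s; apply: nbhs_right_lt; rewrite divr_gt0// ltr_wpDl// addr_ge0.
  have [p [q [p0s q0s ->]]] := ex_second_difference s0 oA sf
    (fun p q p0s q0s => brA _ (small p q p0s q0s)).
  rewrite mulfK ?mulf_neq0 ?gt_eqF//.
  by have /br[] := small _ _ p0s q0s.
apply/eqP; rewrite -subr_eq0 -normr_le0; apply/ler_addgt0Pr => e e0; rewrite add0r.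
have e20 : 0 < e / 2 by rewrite divr_gt0.
have [s [sab sba]] := filter_ex (filterI (key a b _ e20) (key b a _ e20)).
rewrite [e]splitr.
set X := ('D_a ('D_b f) x) in sba *; set Y := ('D_b ('D_a f) x) in sab *.
set Q := _ / _ in sab.
rewrite (_ : X - Y = (Q - Y) - (Q - X)); last by ring.
apply: le_trans (ler_normB _ _) _; apply: lerD; first exact: ltW.
apply: ltW; apply: le_lt_trans sba; rewrite le_eqVlt; apply/orP; left; apply/eqP.
congr (`|_ / _ - _|); rewrite (addrAC x (s *: b)) -!addrA; congr (_ + _).
by rewrite !addrA (addrC (- _)).
Unshelve. all: by end_near. Qed.

End Schwarz.

(** * The Euclidean inner product *)

Section Dot.
Context {R : realType} {n : nat}.
Local Notation V := 'rV[R]_n.+1.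
Implicit Types (u v w x : V) (a b c : R).

Lemma dotE u v : dot u v = \sum_i u 0 i * v 0 i.
Proof. by rewrite /dot mxE; apply: eq_bigr => i _; rewrite mxE. Qed.

Lemma dotC u v : dot u v = dot v u.
Proof. by rewrite !dotE; apply: eq_bigr => i _; rewrite mulrC. Qed.

Lemma dotDl u v w : dot (u + v) w = dot u w + dot v w.
Proof. by rewrite /dot mulmxDl mxE. Qed.

Lemma dotDr u v w : dot w (u + v) = dot w u + dot w v.
Proof. by rewrite dotC dotDl !(dotC _ w). Qed.

Lemma dotZl a u v : dot (a *: u) v = a * dot u v.
Proof. by rewrite /dot -scalemxAl mxE. Qed.

Lemma dotZr a u v : dot v (a *: u) = a * dot v u.
Proof. by rewrite dotC dotZl dotC. Qed.

Lemma dotNl u v : dot (- u) v = - dot u v.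
Proof. by rewrite -scaleN1r dotZl mulN1r. Qed.

Lemma dotNr u v : dot v (- u) = - dot v u.
Proof. by rewrite dotC dotNl dotC. Qed.

Lemma dotBl u v w : dot (u - v) w = dot u w - dot v w.
Proof. by rewrite dotDl dotNl. Qed.

Lemma dotBr u v w : dot w (u - v) = dot w u - dot w v.
Proof. by rewrite dotDr dotNr. Qed.

Lemma dot0l v : dot 0 v = 0.
Proof. by rewrite /dot mul0mx mxE. Qed.

Lemma dot0r v : dot v 0 = 0.
Proof. by rewrite dotC dot0l. Qed.

Lemma dot_suml I (s : seq I) (P : pred I) (F : I -> V) v :
  dot (\sum_(i <- s | P i) F i) v = \sum_(i <- s | P i) dot (F i) v.
Proof.
by elim/big_rec2: _ => [|i y x _ <-]; [exact: dot0l|rewrite dotDl].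
Qed.

Lemma dot_sumr I (s : seq I) (P : pred I) (F : I -> V) v :
  dot v (\sum_(i <- s | P i) F i) = \sum_(i <- s | P i) dot v (F i).
Proof. by rewrite dotC dot_suml; apply: eq_bigr => i _; rewrite dotC. Qed.

Lemma dot_ge0 u : 0 <= dot u u.
Proof. by rewrite dotE; apply: sumr_ge0 => i _; rewrite -expr2 sqr_ge0. Qed.

Lemma dot_eq0 u : (dot u u == 0) = (u == 0).
Proof.
apply/eqP/eqP => [|->]; last by rewrite dot0l.
rewrite dotE => /psumr_eq0P u0; apply/rowP => i; rewrite mxE.
by apply/eqP; rewrite -sqrf_eq0 expr2 u0// => j _; rewrite -expr2 sqr_ge0.
Qed.

Lemma dot_gt0 u : (0 < dot u u) = (u != 0).
Proof. by rewrite lt_neqAle dot_ge0 andbT eq_sym dot_eq0. Qed.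

Lemma coord_le_dot u i : u 0 i ^+ 2 <= dot u u.
Proof.
rewrite dotE (bigD1 i)//= -expr2 lerDl; apply: sumr_ge0 => j _.
by rewrite -expr2 sqr_ge0.
Qed.

Lemma enorm_eq1 u : (enorm u = 1) <-> (dot u u = 1).
Proof.
rewrite /enorm; split=> [E|->]; last by rewrite sqrtr1.
by rewrite -[LHS]sqr_sqrtr ?dot_ge0// E expr1n.
Qed.

Lemma enorm_gt0 u : (0 < enorm u) = (u != 0).
Proof. by rewrite sqrtr_gt0 dot_gt0. Qed.

Lemma sqr_enorm u : enorm u ^+ 2 = dot u u.
Proof. by rewrite sqr_sqrtr// dot_ge0. Qed.

Lemma enormZ a u : 0 < a -> enorm (a *: u) = a * enorm u.
Proof.
move=> a0; rewrite /enorm dotZl dotZr mulrA -expr2.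
by rewrite sqrtrM ?sqr_ge0// sqrtr_sqr gtr0_norm.
Qed.

Lemma unit_sphereE x : unit_sphere x <-> dot x x = 1.
Proof. by rewrite /unit_sphere /round_sphere/= subr0; exact: enorm_eq1. Qed.

Lemma is_derive_coord {U : normedModType R} {m1 m2} (f : U -> 'M[R]_(m1, m2))
    (x v : U) df i j : is_derive x v f df -> is_derive x v (fun y => f y i j) (df i j).
Proof.
move=> [cf <-]; apply: DeriveDef; first exact: (derivable_mxP _ _ _).1.
by rewrite derive_coord.
Qed.

Lemma is_derive_dot {U : normedModType R} (f g : U -> V) (x v : U) df dg :
  is_derive x v f df -> is_derive x v g dg ->
  is_derive x v (fun y => dot (f y) (g y)) (dot df (g x) + dot (f x) dg).
Proof.
move=> Df Dg.
have -> : (fun y => dot (f y) (g y)) =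
    \sum_i ((fun y => f y 0 i) * (fun y => g y 0 i)).
  by apply/funext => y; rewrite dotE fct_sumE.
rewrite !dotE -big_split /=.
apply: is_derive_sum => i.
have H := is_deriveM (is_derive_coord 0 i Df) (is_derive_coord 0 i Dg).
apply: (@is_derive_eq _ _ _ _ _ _ _ _ H).
by rewrite /GRing.scale/= addrC; congr (_ + _); rewrite mulrC.
Qed.

Lemma smooth_dot {U : normedModType R} (A : set U) (f g : U -> V) : open A ->
  smooth_on A f -> smooth_on A g -> smooth_on A (fun y => dot (f y) (g y)).
Proof.
move=> oA sf sg.
apply: (@smooth_on_eq _ _ _ _ (fun y => \sum_i f y 0 i * g y 0 i)) => //.
  by move=> y _; rewrite dotE.
by apply: smooth_sum => // i; apply: smoothM => //; exact: (smooth_coordP _ oA).1.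
Qed.

Lemma smooth_schwarz {m} (A : set V) (f : V -> 'rV[R]_m) (a b x : V) :
  open A -> A x -> smooth_on A f -> 'D_a ('D_b f) x = 'D_b ('D_a f) x.
Proof.
move=> oA Ax sf.
have H (c d : V) i : 'D_c ('D_d f) x 0 i = 'D_c ('D_d (fun y => f y 0 i)) x.
  rewrite derive_coord; last first.
    apply: diff_derivable.
    exact: smooth_on_differentiable (smooth_on_derive _ sf) Ax.
  apply: near_eq_derive; near=> y; apply: derive_coord.
  apply: diff_derivable; apply: smooth_on_differentiable sf _.
  by near: y; exact: open_nbhs_nbhs.
apply/rowP => i; apply: (etrans (H a b i)); apply: esym.
apply: (etrans (H b a i)); apply: (schwarz _ _ oA Ax).
by apply: (smooth_coordP _ oA).1.
Unshelve. all: by end_near. Qed.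

Lemma derive_linear_dir {m} (A : set V) (f : V -> 'rV[R]_m) (x a u v : V) c :
  open A -> A x -> smooth_on A f ->
  'D_a ('D_(c *: u + v) f) x = c *: 'D_a ('D_u f) x + 'D_a ('D_v f) x.
Proof.
move=> oA Ax sf.
have d w : derivable ('D_w f) x a.
  apply: diff_derivable.
  exact: smooth_on_differentiable (smooth_on_derive _ sf) Ax.
rewrite -deriveZ//= -deriveD//=; last by apply: derivableZ.
apply: near_eq_derive; near=> y.
rewrite derive_linear//; apply: smooth_on_differentiable sf _.
by near: y; exact: open_nbhs_nbhs.
Unshelve. all: by end_near. Qed.

End Dot.

(** * The radial projection onto the sphere *)

Section Radial.
Context {R : realType} {n : nat}.
Local Notation V := 'rV[R]_n.+1.
Implicit Types (u v w x : V) (a b c : R).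

Definition punct : set V := [set x | x != 0].

Lemma open_punct : open punct.
Proof.
have -> : punct = (fun x : V => dot x x) @^-1` [set r : R | r != 0].
  by apply/seteqP; split=> x /=; rewrite /punct/= dot_eq0.
apply: open_comp; last exact: open_neq.
move=> x _; apply: (@smooth_continuous _ _ _ setT (fun x : V => dot x x)) => //.
by apply: smooth_dot; [exact: openT|exact: smooth_id|exact: smooth_id].
Qed.

Lemma is_derive_invnorm x v : x != 0 ->
  is_derive x v (fun y : V => (enorm y)^-1) (- (dot x v * (enorm x)^-1 ^+ 3)).
Proof.
move=> x0; have xx0 : 0 < dot x x by rewrite dot_gt0.
have s0 : enorm x != 0 by rewrite gt_eqF// enorm_gt0.
have Dd := is_derive_dot (is_derive_id x v) (is_derive_id x v).
have dd : differentiable (fun y : V => dot y y) x.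
  apply: (@smooth_on_differentiable _ _ _ setT) => //.
  by apply: smooth_dot; [exact: openT|exact: smooth_id|exact: smooth_id].
have Ds : is_derive (dot x x) (1 : R) (fun t : R => (Num.sqrt t)^-1)
    (- (Num.sqrt (dot x x)) ^- 2 *: (2 * Num.sqrt (dot x x))^-1).
  have H1 := is_derive1_sqrt xx0.
  apply: DeriveDef; first by apply: derivableV => //; case: H1.
  by rewrite deriveV// derive_val.
have ds : differentiable (fun t : R => (Num.sqrt t)^-1) (dot x x).
  by apply/derivable1_diffP; case: Ds.
apply: DeriveDef.
  apply: diff_derivable; apply: (@differentiable_comp _ _ _ _
    (fun y : V => dot y y) (fun t : R => (Num.sqrt t)^-1)) => //.
rewrite (@derive_comp _ _ _ _ (fun t : R => (Num.sqrt t)^-1)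
  (fun y : V => dot y y))//.
rewrite (_ : 'D_v (fun y : V => dot y y) x = dot v x + dot x v); last first.
  by case: Dd.
have -> : dot v x + dot x v = (dot v x + dot x v) *: (1 : R) by rewrite [RHS]mulr1.
rewrite deriveE// [LHS]linearZ/= -deriveE//.
have [_ ->] := Ds.
rewrite -/(enorm x) (dotC v) /GRing.scale/=.
by field.
Qed.

(** The derivative of the inverse norm is a polynomial in the point and the inverse norm itself, so
    each order follows from the previous one. *)
Lemma smooth_invnorm : smooth_on punct (fun y : V => (enorm y)^-1).
Proof.
apply/smooth_onP; elim=> [//|k IH]; split.
  move=> x x0; apply: (@differentiable_comp _ _ _ _ (fun y : V => dot y y)
    (fun t : R => (Num.sqrt t)^-1)).
    apply: (@smooth_on_differentiable _ _ _ setT) => //.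
    by apply: smooth_dot; [exact: openT|exact: smooth_id|exact: smooth_id].
  apply/derivable1_diffP; apply: derivableV.
    by rewrite gt_eqF// -/(enorm x) enorm_gt0.
  by have [] := is_derive1_sqrt (_ : 0 < dot x x); rewrite ?dot_gt0.
move=> v; have oP := open_punct.
apply: (@Ck_eq _ _ _ _ _ (fun x => dot x (- v) *
   ((enorm x)^-1 * ((enorm x)^-1 * (enorm x)^-1)))) => //.
  move=> x x0; have [_ ->] := is_derive_invnorm v x0.
  by rewrite dotNr mulNr !exprS expr0 mulr1.
apply: CkM => //; last by apply: CkM => //; apply: CkM.
apply: (smooth_onP _ _).1; apply: smooth_dot => //.
  exact: smooth_id.
exact: smooth_cst.
Qed.

Definition radial x : V := (enorm x)^-1 *: x.

Lemma smooth_radial : smooth_on punct radial.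
Proof.
apply/(smooth_coordP _ open_punct) => i.
apply: (@smooth_on_eq _ _ _ _ (fun x => (enorm x)^-1 * x 0 i)).
- exact: open_punct.
- by move=> x _; rewrite /radial mxE.
- apply: smoothM; [exact: open_punct|exact: smooth_invnorm|].
  by apply: (smooth_coordP _ open_punct).1; exact: smooth_id.
Qed.

Lemma is_derive_radial x v : x != 0 ->
  is_derive x v radial ((enorm x)^-1 *: v - (dot x v * (enorm x)^-1 ^+ 3) *: x).
Proof.
move=> x0.
apply: DeriveDef; first by have [] := smooth_is_derive v smooth_radial x0.
apply/rowP => i; rewrite derive_coord; last first.
  by have [] := smooth_is_derive v smooth_radial x0.
rewrite (_ : (fun y => radial y 0 i) =
   (fun y => (enorm y)^-1) * (fun y : V => y 0 i)); last first.
  by apply/funext => y; rewrite /radial mxE.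
have H1 := is_derive_invnorm v x0.
have H2 := is_derive_coord 0 i (is_derive_id x v).
have [_ ->] := is_deriveM H1 H2.
by rewrite !mxE /GRing.scale/=; ring.
Qed.

Lemma dot_radial x : x != 0 -> dot (radial x) (radial x) = 1.
Proof.
move=> x0; rewrite /radial dotZl dotZr -sqr_enorm.
by field; rewrite gt_eqF// enorm_gt0.
Qed.

Lemma radial_sphere x : x != 0 -> unit_sphere (radial x).
Proof. by move=> x0; apply/unit_sphereE; exact: dot_radial. Qed.

Lemma sphere_neq0 x : unit_sphere x -> x != 0.
Proof. by move=> /unit_sphereE x1; rewrite -dot_gt0 x1. Qed.

Lemma radial_id x : unit_sphere x -> radial x = x.
Proof.
by move=> /unit_sphereE/enorm_eq1 x1; rewrite /radial x1 invr1 scale1r.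
Qed.

Lemma radialZ c x : 0 < c -> radial (c *: x) = radial x.
Proof.
move=> c0; rewrite /radial enormZ// scalerA; congr (_ *: _).
by rewrite invfM mulrAC mulVf ?gt_eqF// mul1r.
Qed.

End Radial.

Arguments punct {R n}.

(** * Homogeneous maps and Euler's identity *)

Section Homogeneous.
Context {R : realType} {n : nat}.
Local Notation V := 'rV[R]_n.+1.
Implicit Types (u v w x : V).

(** The degree is [- k]: starting from degree 0, each derivative lowers the degree by one, so
    natural numbers suffice. *)
Definition homog (k : nat) (W : normedModType R) (g : V -> W) :=
  forall (c : R) x, 0 < c -> x != 0 -> g (c *: x) = c^-1 ^+ k *: g x.

Lemma homog_derive k (W : normedModType R) (g : V -> W) v :
  (forall x, x != 0 -> differentiable g x) -> homog k g -> homog k.+1 ('D_v g).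
Proof.
move=> dg hg c x c0 x0.
have cx0 : c *: x != 0 by rewrite scaler_eq0 (gt_eqF c0).
have dc : differentiable (fun y : V => c *: y) x.
  exact: (@ex_diff _ _ _ _ _ _ _ (is_diff_scaler c x)).
have E : 'D_v (g \o (fun y : V => c *: y)) x = c *: 'D_v g (c *: x).
  rewrite derive_comp//; last exact: dg.
  rewrite (_ : 'D_v (fun y : V => c *: y) x = c *: v).
    by rewrite !deriveE ?linearZ//; exact: dg.
  rewrite deriveE// (_ : 'd _ x = ( *:%R c) :> (V -> V))//.
  exact: (@diff_val _ _ _ _ _ _ _ (is_diff_scaler c x)).
have E' : 'D_v (g \o (fun y : V => c *: y)) x = c^-1 ^+ k *: 'D_v g x.
  rewrite -deriveZ; last exact/diff_derivable/dg.
  apply: near_eq_derive; near=> y; apply: hg => //.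
  by near: y; apply: open_nbhs_nbhs; split=> //; exact: open_punct.
apply: (scalerI (lt0r_neq0 c0)); rewrite -E E' scalerA exprS mulrA divff ?mul1r//.
by rewrite gt_eqF.
Unshelve. all: by end_near. Qed.

Lemma homog_euler k (W : normedModType R) (g : V -> W) x :
  (forall x, x != 0 -> differentiable g x) -> homog k g -> x != 0 ->
  'D_x g x = - k%:R *: g x.
Proof.
move=> dg hg x0.
have dx : differentiable g (x + (0 : R) *: x) by rewrite scale0r addr0; exact: dg.
have [_] := is_derive_line dx; rewrite scale0r addr0 => <-.
have -> : 'D_1 (fun s : R => g (x + s *: x)) 0 =
          'D_1 (fun s : R => ((1 + s) ^- k) *: g x) 0.
  apply: near_eq_derive; near=> s.
  have s1 : `|s| < 1 by near: s; exact: (@nbhs0_lt R R).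
  have s0 : 0 < 1 + s by move: s1; rewrite ltr_norml => /andP[]; lra.
  by rewrite -[X in X + _]scale1r -scalerDl hg// exprVn.
have Dp : is_derive (0 : R) (1 : R) (fun s : R => 1 + s) 1.
  have := is_deriveD (is_derive_cst (1 : R) (0 : R) (1 : R)) (is_derive_id (0 : R) (1 : R)).
  by rewrite add0r.
have Dq : is_derive (0 : R) (1 : R) (fun s : R => (1 + s) ^+ k) k%:R.
  rewrite (_ : (fun s : R => (1 + s) ^+ k) = (fun s : R => 1 + s) ^+ k); last first.
    by apply/funext => s; rewrite exprfctE.
  apply: (@is_derive_eq _ _ _ _ _ _ _ _ (is_deriveX k Dp)).
  by rewrite addr0 expr1n /GRing.scale/= !mulr1.
have Dr : is_derive (0 : R) (1 : R) (fun s : R => (1 + s) ^- k) (- k%:R).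
  have nz : (1 + 0 : R) ^+ k != 0 by rewrite addr0 expr1n oner_neq0.
  apply: DeriveDef; first by apply: derivableV => //; case: Dq.
  rewrite deriveV//; case: Dq => _ ->.
  by rewrite addr0 expr1n expr1n invr1 /GRing.scale/= mulN1r.
have dr : differentiable (fun s : R => (1 + s) ^- k) 0.
  by apply/derivable1_diffP; case: Dr.
rewrite deriveE; last exact: differentiableZl.
by rewrite diffZl//= -deriveE//; case: Dr => _ ->.
Unshelve. all: by end_near. Qed.

End Homogeneous.

(** * Gauss equations for two maps with the same metric *)

(* The directional derivative on a fixed space, locked so that comparing two
   iterated derivatives never unfolds the limits they are defined by. *)
HB.lock Definition pd {R : realType} {n : nat} (v : 'rV[R]_n.+1)
  (f : 'rV[R]_n.+1 -> 'rV[R]_n.+1) : 'rV[R]_n.+1 -> 'rV[R]_n.+1 := 'D_v f.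

Section DotDerivatives.
Context {R : realType} {n : nat}.
Local Notation V := 'rV[R]_n.+1.
Variables (A : set V) (oA : open A).
Implicit Types (F G : V -> V) (x v w : V).

Lemma derive_eq_on (W : normedModType R) (g1 g2 : V -> W) v x : A x ->
  (forall y, A y -> g1 y = g2 y) -> 'D_v g1 x = 'D_v g2 x.
Proof.
move=> Ax E; apply: near_eq_derive; near=> y; apply: E.
by near: y; exact: open_nbhs_nbhs.
Unshelve. all: by end_near. Qed.

Lemma pd_eq_on F G v x : A x -> (forall y, A y -> F y = G y) ->
  pd v F x = pd v G x.
Proof. by rewrite pd.unlock; exact: derive_eq_on. Qed.

Lemma smooth_derivable (W : normedModType R) (g : V -> W) x v :
  smooth_on A g -> A x -> derivable g x v.
Proof. by move=> sg Ax; have [] := smooth_is_derive v sg Ax. Qed.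

Lemma smooth_pd F v : smooth_on A F -> smooth_on A (pd v F).
Proof. by rewrite pd.unlock; exact: smooth_on_derive. Qed.

Lemma smooth_is_pd F x v : smooth_on A F -> A x -> is_derive x v F (pd v F x).
Proof. by rewrite pd.unlock; exact: smooth_is_derive. Qed.

Lemma pdC F v w x : A x -> smooth_on A F -> pd v (pd w F) x = pd w (pd v F) x.
Proof. by rewrite pd.unlock => Ax; exact: smooth_schwarz. Qed.

Lemma derive_dot F G v x : A x -> smooth_on A F -> smooth_on A G ->
  'D_v (fun y => dot (F y) (G y)) x =
  dot (pd v F x) (G x) + dot (F x) (pd v G x).
Proof.
move=> Ax sF sG.
by have [_ ->] := is_derive_dot (smooth_is_pd v sF Ax) (smooth_is_pd v sG Ax).
Qed.

Section Comparison.
Variables f u : V -> V.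
Hypotheses (sf : smooth_on A f) (su : smooth_on A u).
Hypothesis metric : forall x v w, A x ->
  dot (pd v f x) (pd w f x) = dot (pd v u x) (pd w u x).

Let s1 g v : smooth_on A g -> smooth_on A (pd v g).
Proof. exact: smooth_pd. Qed.

Let metric_derive x a b c : A x ->
  dot (pd a (pd b f) x) (pd c f x) + dot (pd b f x) (pd a (pd c f) x) =
  dot (pd a (pd b u) x) (pd c u x) + dot (pd b u x) (pd a (pd c u) x).
Proof.
move=> Ax.
rewrite -(derive_dot a Ax (s1 b sf) (s1 c sf)).
rewrite -(derive_dot a Ax (s1 b su) (s1 c su)).
exact: (derive_eq_on a Ax (fun y Ay => metric b c Ay)).
Qed.

(** Koszul's argument: the derivatives of the metric coefficients under the three cyclic
    permutations of the directions, together with the symmetry of second derivatives, form a linear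
    system that determines these products. *)
Lemma same_christoffel x a b c : A x ->
  dot (pd a (pd b f) x) (pd c f x) = dot (pd a (pd b u) x) (pd c u x).
Proof.
move=> Ax.
have := metric_derive a b c Ax.
have := metric_derive b c a Ax.
have := metric_derive c a b Ax.
rewrite (pdC b a Ax sf) (pdC c a Ax sf) (pdC c b Ax sf).
rewrite (pdC b a Ax su) (pdC c a Ax su) (pdC c b Ax su).
rewrite !(dotC (pd a f x)) !(dotC (pd b f x)) !(dotC (pd c f x)).
rewrite !(dotC (pd a u x)) !(dotC (pd b u x)) !(dotC (pd c u x)).
move: (dot (pd a (pd b f) x) (pd c f x)) (dot (pd a (pd c f) x) (pd b f x))
  (dot (pd b (pd c f) x) (pd a f x)) (dot (pd a (pd b u) x) (pd c u x))
  (dot (pd a (pd c u) x) (pd b u x)) (dot (pd b (pd c u) x) (pd a u x)).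
move=> *; lra.
Qed.

Lemma same_christoffel_derive x a b c d : A x ->
  dot (pd d (pd a (pd b f)) x) (pd c f x) +
    dot (pd a (pd b f) x) (pd d (pd c f) x) =
  dot (pd d (pd a (pd b u)) x) (pd c u x) +
    dot (pd a (pd b u) x) (pd d (pd c u) x).
Proof.
move=> Ax.
rewrite -(derive_dot d Ax (s1 a (s1 b sf)) (s1 c sf)).
rewrite -(derive_dot d Ax (s1 a (s1 b su)) (s1 c su)).
exact: (derive_eq_on d Ax (fun y Ay => same_christoffel a b c Ay)).
Qed.

Lemma pdCA g d a b x : smooth_on A g -> A x ->
  pd d (pd a (pd b g)) x = pd b (pd a (pd d g)) x.
Proof.
move=> sg Ax; rewrite (pdC d a Ax (s1 b sg)) (pdC b a Ax (s1 d sg)).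
by apply: pd_eq_on => // y Ay; exact: pdC.
Qed.

(** The theorema egregium. The identity of [same_christoffel_derive] is subtracted from the one with
    [b] and [d] exchanged: the third derivatives agree by [pdCA] and cancel. *)
Lemma same_curvature x a b c d : A x ->
  dot (pd a (pd b f) x) (pd c (pd d f) x) -
    dot (pd a (pd d f) x) (pd c (pd b f) x) =
  dot (pd a (pd b u) x) (pd c (pd d u) x) -
    dot (pd a (pd d u) x) (pd c (pd b u) x).
Proof.
move=> Ax.
have := same_christoffel_derive a b c d Ax.
have := same_christoffel_derive a d c b Ax.
rewrite (pdCA d a b sf Ax) (pdCA d a b su Ax).
rewrite (pdC d c Ax sf) (pdC d c Ax su) (pdC b c Ax sf) (pdC b c Ax su).
move: (dot (pd b (pd a (pd d f)) x) _) (dot (pd b (pd a (pd d u)) x) _).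
move: (dot (pd a (pd b f) x) (pd c (pd d f) x))
  (dot (pd a (pd d f) x) (pd c (pd b f) x))
  (dot (pd a (pd b u) x) (pd c (pd d u) x))
  (dot (pd a (pd d u) x) (pd c (pd b u) x)).
move=> *; lra.
Qed.

(** The full second derivatives are used instead of their normal parts. The tangential parts only
    add terms that depend on the metric, and the resulting function needs no choice of normal and
    can be differentiated along fixed directions. *)
Definition curvature_term (g : V -> V) a b y :=
  dot (pd a (pd a g) y) (pd b (pd b g) y) -
  dot (pd a (pd b g) y) (pd a (pd b g) y).

Lemma smooth_curvature_term g a b :
  smooth_on A g -> smooth_on A (curvature_term g a b).
Proof.
move=> sg; have s2 p q := s1 p (s1 q sg).
apply: (@smooth_on_eq _ _ _ _ (fun y => dot (pd a (pd a g) y) (pd b (pd b g) y) +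
  - 1 * dot (pd a (pd b g) y) (pd a (pd b g) y))) => //.
  by move=> y _; rewrite mulN1r.
apply: smoothD => //; first exact: smooth_dot.
by apply: (smoothM (f := cst (- 1))) => //; [exact: smooth_cst|exact: smooth_dot].
Qed.

Lemma same_curvature_fun x a b : A x ->
  curvature_term f a b x = curvature_term u a b x.
Proof.
move=> Ax; have := same_curvature a a b b Ax.
by rewrite (pdC b a Ax sf) (pdC b a Ax su).
Qed.

Lemma derive_curvature g a b c x : smooth_on A g -> A x ->
  'D_c (curvature_term g a b) x =
    dot (pd c (pd a (pd a g)) x) (pd b (pd b g) x) +
    dot (pd a (pd a g) x) (pd c (pd b (pd b g)) x) -
    2 * dot (pd c (pd a (pd b g)) x) (pd a (pd b g) x).
Proof.
move=> sg Ax; have s2 p q := s1 p (s1 q sg).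
have ds p q r s : derivable (fun y => dot (pd p (pd q g) y) (pd r (pd s g) y)) x c.
  by apply: smooth_derivable Ax; exact: smooth_dot.
rewrite (deriveB (ds a a b b) (ds a b a b)).
rewrite (derive_dot c Ax (s2 a a) (s2 b b)) (derive_dot c Ax (s2 a b) (s2 a b)).
rewrite (dotC (pd a (pd b g) x) (pd c _ _)).
by rewrite mulr_natl mulr2n.
Qed.

Lemma derive2_curvature g a b c x : smooth_on A g -> A x ->
  'D_c ('D_c (curvature_term g a b)) x =
    dot (pd c (pd c (pd a (pd a g))) x) (pd b (pd b g) x) +
    dot (pd a (pd a g) x) (pd c (pd c (pd b (pd b g))) x) +
    2 * dot (pd c (pd a (pd a g)) x) (pd c (pd b (pd b g)) x) -
    2 * dot (pd c (pd c (pd a (pd b g))) x) (pd a (pd b g) x) -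
    2 * dot (pd c (pd a (pd b g)) x) (pd c (pd a (pd b g)) x).
Proof.
move=> sg Ax; have s2 p q := s1 p (s1 q sg); have s3 p q r := s1 p (s2 q r).
rewrite (derive_eq_on c Ax (fun y Ay => derive_curvature a b c sg Ay)).
have ds F G : smooth_on A F -> smooth_on A G ->
    derivable (fun y => dot (F y) (G y)) x c.
  by move=> sF sG; apply: smooth_derivable Ax; exact: smooth_dot.
have d1 := ds _ _ (s3 c a a) (s2 b b); have d2 := ds _ _ (s2 a a) (s3 c b b).
have d3 := ds _ _ (s3 c a b) (s2 a b).
rewrite (deriveB (derivableD d1 d2) (@derivableZ _ _ _ _ 2 _ _ d3)) (deriveD d1 d2).
rewrite (@deriveZ _ _ _ _ 2 _ _ d3) (derive_dot c Ax (s3 c a a) (s2 b b)).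
rewrite (derive_dot c Ax (s2 a a) (s3 c b b)) (derive_dot c Ax (s3 c a b) (s2 a b)).
rewrite /GRing.scale/=.
move: (dot _ _) (dot _ _) (dot _ _) (dot _ _) (dot _ _) => *; ring.
Qed.

End Comparison.
End DotDerivatives.

(** * Orthonormal frames *)

Section Frames.
Context {R : realType} {n : nat}.
Local Notation V := 'rV[R]_n.+1.
Implicit Types (u v w x : V).

Definition orthonormal_frame (F : 'I_n.+1 -> V) :=
  forall i j, dot (F i) (F j) = (i == j)%:R.

(** A square matrix with orthonormal rows also has orthonormal columns. *)
Lemma parseval F u v : orthonormal_frame F ->
  dot u v = \sum_i dot u (F i) * dot v (F i).
Proof.
move=> oF; pose M := \matrix_(i, j) F i 0 j.
have rowM i : row i M = F i by apply/rowP => j; rewrite !mxE.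
have MMt : M *m M^T = 1%:M.
  apply/matrixP => i j; rewrite !mxE -oF dotE.
  by apply: eq_bigr => k _; rewrite !mxE.
have MtM := mulmx1C MMt.
have E w i : (w *m M^T) 0 i = dot w (F i).
  by rewrite mxE dotE; apply: eq_bigr => k _; rewrite !mxE.
transitivity ((u *m M^T *m (v *m M^T)^T) 0 0).
  by rewrite trmx_mul trmxK -mulmxA (mulmxA M^T) MtM mul1mx.
by rewrite mxE; apply: eq_bigr => i _; rewrite [X in _ * X]mxE !E.
Qed.

Lemma dot_ext u v : (forall w, dot u w = dot v w) -> u = v.
Proof.
move=> E; apply/eqP; rewrite -subr_eq0 -dot_eq0 dotBl E -dotBl subrr.
by rewrite dot0l.
Qed.

Lemma frame_sum F u : orthonormal_frame F -> u = \sum_i dot u (F i) *: F i.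
Proof.
move=> oF; apply: dot_ext => w; rewrite (parseval u w oF) dot_suml.
by apply: eq_bigr => i _; rewrite dotZl [dot (F i) w]dotC.
Qed.

Lemma dot_delta u i : dot (delta_mx 0 i) u = u 0 i.
Proof. by rewrite dotC /dot trmx_delta -colE mxE. Qed.

(* The frame is the image of the canonical basis by the reflection that
   exchanges [x] and the first basis vector. *)
Lemma exists_frame x : dot x x = 1 ->
  exists F, orthonormal_frame F /\ F ord0 = x.
Proof.
move=> xx; pose d i : V := delta_mx 0 i.
have dd i j : dot (d i) (d j) = (i == j)%:R.
  by rewrite dot_delta mxE eqxx eq_sym.
have [->|xd] := eqVneq x (d ord0); first by exists d.
have [w wE] : exists w, w = d ord0 - x by exists (d ord0 - x).
have w0 : dot w w != 0 by rewrite dot_eq0 wE subr_eq0 eq_sym.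
have wd i : dot (d i) w = w 0 i by rewrite dot_delta.
exists (fun i => d i - (2 * w 0 i / dot w w) *: w); split.
  move=> i j; rewrite dotBl !dotBr !dotZl !dotZr dd [dot w (d j)]dotC !wd.
  by field.
have E : 2 * w 0 ord0 = dot w w.
  rewrite -wd wE dotBl !dotBr dd eqxx xx [dot x _]dotC.
  by rewrite mulr1n; ring.
by rewrite E divff// scale1r wE opprB addrC subrK.
Qed.

End Frames.

(** * Derivatives of the radial projection *)

Section RadialDerivatives.
Context {R : realType} {n : nat}.
Local Notation V := 'rV[R]_n.+1.
Implicit Types (a b c d x : V).

Let r (x : V) := (enorm x)^-1.

Lemma pd_radial x a : x != 0 ->
  pd a radial x = r x *: a - (dot x a * r x ^+ 3) *: x.
Proof. by move=> x0; rewrite pd.unlock; have [_ ->] := is_derive_radial a x0. Qed.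

Lemma r_sqr x : x != 0 -> r x ^+ 2 * dot x x = 1.
Proof.
move=> x0; rewrite -sqr_enorm /r; field.
by rewrite gt_eqF// enorm_gt0.
Qed.

Lemma pd2_radial x a b : x != 0 ->
  pd a (pd b radial) x = - (dot x a * r x ^+ 3) *: b
    - (dot x b * r x ^+ 3) *: a - (dot a b * r x ^+ 3) *: x
    + (3 * dot x a * dot x b * r x ^+ 5) *: x.
Proof.
move=> x0.
rewrite (pd_eq_on open_punct a x0 (fun y y0 => pd_radial b y0)).
have Dr : is_derive x a r _ := is_derive_invnorm a x0.
have Dx : is_derive x a (fun y : V => dot y b) (dot a b).
  have := is_derive_dot (is_derive_id x a) (is_derive_cst b x a).
  by rewrite dot0r addr0.
have Dr3 := is_deriveM Dr (is_deriveM Dr Dr).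
have Dxr3 := is_deriveM Dx Dr3.
pose G y := r y *: b - (dot y b * (r y * (r y * r y))) *: y.
have dG : derivable G x a.
  have dr : differentiable r x by exact: smooth_on_differentiable smooth_invnorm x0.
  have dx : differentiable (fun y : V => dot y b) x.
    apply: (@smooth_on_differentiable _ _ _ setT) => //.
    by apply: smooth_dot; [exact: openT|exact: smooth_id|exact: smooth_cst].
  apply: diff_derivable; apply: differentiable_coords => i.
  rewrite (_ : (fun y => G y 0 i) = (fun y => r y * b 0 i) -
     (fun y => dot y b * (r y * (r y * r y)) * y 0 i)); last first.
    by apply/funext => y; rewrite /G !mxE.
  apply: differentiableB.
    by apply: (@differentiableM _ _ r (cst (b 0 i))).
  apply: (@differentiableM _ _ (fun y => dot y b * (r y * (r y * r y)))
     (fun y => y 0 i)); last exact: differentiable_coord.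
  apply: (@differentiableM _ _ (fun y => dot y b) (fun y => r y * (r y * r y))) => //.
  apply: (@differentiableM _ _ r (fun y => r y * r y)) => //.
  exact: (@differentiableM _ _ r r).
transitivity ('D_a G x).
  rewrite pd.unlock.
  by apply: (derive_eq_on open_punct) => // y y0; rewrite /G !exprS expr0 mulr1.
apply/rowP => i; rewrite derive_coord//.
rewrite (_ : (fun y => G y 0 i) = (b 0 i *: r : V -> R) -
   ((fun y => dot y b) * (r * (r * r))) * (fun y => y 0 i)); last first.
  by apply/funext => y; rewrite /G !mxE [RHS]/= ; congr (_ - _); rewrite mulrC.
have Di := is_derive_coord 0 i (is_derive_id x a).
have [_ ->] := is_deriveB (is_deriveZ (b 0 i) Dr) (is_deriveM Dxr3 Di).
by rewrite !mxE !mulrfctE -/(r x) /GRing.scale/=; ring.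
Qed.

End RadialDerivatives.

Section RadialAtUnit.
Context {R : realType} {n : nat}.
Local Notation V := 'rV[R]_n.+1.
Implicit Types (a b c d x y : V).

(** Where [h] vanishes, the derivative of the cofactor [g] drops out of the product rule; thus
    complicated cofactors only have to be derivable. *)
Lemma is_derive_mul_vanish {U : normedModType R} (h g : U -> R) (p v : U) dh :
  is_derive p v h dh -> derivable g p v -> h p = 0 ->
  is_derive p v (fun q => h q * g q) (dh * g p).
Proof.
move=> Dh dg h0; have Dg := derivableP dg.
apply: (@is_derive_eq _ _ _ _ _ _ _ _ (is_deriveM Dh Dg)).
by rewrite h0 scale0r add0r /GRing.scale/= mulrC.
Qed.

Lemma pd_radial_unit x a : dot x x = 1 -> dot x a = 0 -> pd a radial x = a.
Proof.
move=> x1 xa; have x0 : x != 0 by rewrite -dot_gt0 x1.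
by rewrite pd_radial// (enorm_eq1 x).2// invr1 scale1r xa mul0r scale0r subr0.
Qed.

Lemma pd2_radial_unit x a b : dot x x = 1 -> dot x a = 0 -> dot x b = 0 ->
  pd a (pd b radial) x = - dot a b *: x.
Proof.
move=> x1 xa xb; have x0 : x != 0 by rewrite -dot_gt0 x1.
rewrite pd2_radial// (enorm_eq1 x).2// invr1 !expr1n xa xb !(mulr0, mul0r, mulr1).
by rewrite !(oppr0, scale0r, subr0, sub0r, add0r, addr0) scaleNr.
Qed.

(** The right-hand side is arranged so that each term has a factor [dot y a] or [dot y b]. These
    factors vanish at a unit vector orthogonal to [a] and [b], where [is_derive_mul_vanish] then
    gives the derivative. *)
Lemma radial_christoffel y a b c : y != 0 ->
  dot (pd a (pd b radial) y) (pd c radial y) =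
  dot y a * (- (enorm y)^-1 ^+ 4 * dot b c +
     2 * (enorm y)^-1 ^+ 6 * dot y b * dot y c) +
  dot y b * (- (enorm y)^-1 ^+ 4 * dot a c).
Proof.
move=> y0; rewrite pd2_radial// pd_radial//.
have := r_sqr y0; set r := (enorm y)^-1.
rewrite !(dotDl, dotDr, dotNl, dotNr, dotZl, dotZr).
rewrite (dotC b y) (dotC a y).
move: (dot y y) (dot y a) (dot y b) (dot y c) (dot a b) (dot a c) (dot b c).
move=> yy ya yb yc ab ac bc E.
transitivity (ya * (- r ^+ 4 * bc + 2 * r ^+ 6 * yb * yc) +
  yb * (- r ^+ 4 * ac) +
  (r ^+ 4 * ab * yc - 3 * r ^+ 6 * ya * yb * yc) * (r ^+ 2 * yy - 1)).
  by ring.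
by rewrite E subrr mulr0 addr0.
Qed.

Lemma smooth_dotl (A : set V) b : smooth_on A (fun y : V => dot y b).
Proof.
apply: (@smooth_on_sub _ _ _ _ setT) => //.
by apply: smooth_dot; [exact: openT|exact: smooth_id|exact: smooth_cst].
Qed.

Lemma is_derive_dotl x v b : is_derive x v (fun y : V => dot y b) (dot v b).
Proof.
have := is_derive_dot (is_derive_id x v) (is_derive_cst b x v).
by rewrite dot0r addr0.
Qed.

Lemma differentiable_invnormX y k : y != 0 ->
  differentiable (fun y : V => (enorm y)^-1 ^+ k) y.
Proof.
move=> y0; have d : differentiable (fun y : V => (enorm y)^-1) y.
  exact: smooth_on_differentiable smooth_invnorm y0.
elim: k => [|k IH]; first exact: differentiable_cst.
rewrite (_ : (fun y : V => _) = (fun y : V => (enorm y)^-1) *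
  (fun y : V => (enorm y)^-1 ^+ k)); first exact: differentiableM.
by apply/funext => z; rewrite exprS.
Qed.

Lemma derive_radial_christoffel x a b c d : dot x x = 1 ->
  dot x a = 0 -> dot x b = 0 -> dot x c = 0 ->
  'D_d (fun y => dot (pd a (pd b radial) y) (pd c radial y)) x =
  - (dot d a * dot b c + dot d b * dot a c).
Proof.
move=> x1 xa xb xc; have x0 : x != 0 by rewrite -dot_gt0 x1.
rewrite (derive_eq_on open_punct d x0 (fun y (y0 : punct y) => radial_christoffel a b c y0)).
have dl q : differentiable (fun y : V => dot y q) x.
  by apply: (@smooth_on_differentiable _ _ _ setT) => //; exact: smooth_dotl.
pose r (y : V) := (enorm y)^-1.
have D1 : derivable (fun y : V => - r y ^+ 4 * dot b c + 2 * r y ^+ 6 * dot y b * dot y c) x d.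
  apply: diff_derivable.
  apply: (@differentiableD _ _ _ (fun y : V => - r y ^+ 4 * dot b c)
            (fun y : V => 2 * r y ^+ 6 * dot y b * dot y c)).
    apply: (@differentiableM _ _ (fun y : V => - r y ^+ 4) (cst (dot b c))) => //.
    by apply: differentiableN; exact: differentiable_invnormX.
  apply: (@differentiableM _ _ (fun y : V => 2 * r y ^+ 6 * dot y b)) => //.
  apply: (@differentiableM _ _ (fun y : V => 2 * r y ^+ 6)) => //.
  apply: (@differentiableM _ _ (cst 2) (fun y : V => r y ^+ 6)) => //.
  exact: differentiable_invnormX.
have D2 : derivable (fun y : V => - r y ^+ 4 * dot a c) x d.
  apply: diff_derivable.
  apply: (@differentiableM _ _ (fun y : V => - r y ^+ 4) (cst (dot a c))) => //.
  by apply: differentiableN; exact: differentiable_invnormX.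
have H1 := is_derive_mul_vanish (is_derive_dotl x d a) D1 xa.
have H2 := is_derive_mul_vanish (is_derive_dotl x d b) D2 xb.
have [_ ->] := is_deriveD H1 H2.
rewrite /r (enorm_eq1 x).2// invr1 !expr1n xb xc.
by ring.
Qed.

(** For orthonormal [x] and [a], this is the inverse square of the norm of [x + t *: a]. *)
Let w (t : R) := (1 + t ^+ 2)^-1.

Let pos (t : R) : 1 + t ^+ 2 != 0.
Proof. by rewrite gt_eqF// ltr_wpDr// sqr_ge0. Qed.

Let Dw t : is_derive t (1 : R) w (- (2 * t * w t ^+ 2)).
Proof.
have H : is_derive t (1 : R) (fun t : R => 1 + t ^+ 2) (2 * t).
  have := is_deriveD (is_derive_cst (1 : R) t (1 : R))
    (is_deriveX 2 (is_derive_id t (1 : R))).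
  by rewrite add0r /GRing.scale/= mulr1 expr1 mulr_natl.
apply: (@is_derive_eq _ _ _ _ _ _ _ _ (@is_deriveV _ (fun t : R => 1 + t ^+ 2) _ _ _ (pos t) H)).
rewrite /w /GRing.scale/=; field.
exact: pos.
Qed.

(* [t * phi t] is the derivative of the value (1 - t^2) / (1 + t^2)^3 of the
   curvature term at [x + t *: a]. *)
Let phi (t : R) := - 2 * w t ^+ 3 - 6 * (1 - t ^+ 2) * w t ^+ 4.

Let Dk t : is_derive t (1 : R) (fun s => (1 - s ^+ 2) * w s ^+ 3) (t * phi t).
Proof.
have D1 : is_derive t (1 : R) (fun s : R => 1 - s ^+ 2) (- (2 * t)).
  have H := is_deriveB (is_derive_cst (1 : R) t (1 : R))
    (is_deriveX 2 (is_derive_id t (1 : R))).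
  apply: (@is_derive_eq _ _ _ _ _ _ _ _ H).
  by rewrite /GRing.scale/=; ring.
have D3 := is_deriveM (Dw t) (is_deriveM (Dw t) (Dw t)).
have := is_deriveM D1 D3.
rewrite (_ : (fun s : R => 1 - s ^+ 2) * (w * (w * w)) =
   (fun s => (1 - s ^+ 2) * w s ^+ 3)); last first.
  by apply/funext => s; rewrite !mulrfctE !exprS expr0 !mulr1.
move=> H; apply: (@is_derive_eq _ _ _ _ _ _ _ _ H).
by rewrite /GRing.scale/= !mulrfctE /phi; ring.
Qed.

Let dphi : derivable phi 0 1.
Proof.
have dw : derivable w 0 1 by case: (Dw 0).
have dX k : derivable (fun s => w s ^+ k) 0 1.
  rewrite (_ : (fun s => w s ^+ k) = w ^+ k); first exact: derivableX.
  by apply/funext => s; rewrite exprfctE.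
apply: (@derivableB _ _ _ (fun t : R => - 2 * w t ^+ 3)
  (fun t : R => 6 * (1 - t ^+ 2) * w t ^+ 4)).
  exact: (@derivableZ _ _ _ _ (- 2) _ _ (dX 3)).
apply: (@derivableM _ _ (fun t : R => 6 * (1 - t ^+ 2)) (fun t => w t ^+ 4)) => //.
Qed.

Lemma radial_curvature_line x a b (t : R) : dot x x = 1 -> dot a a = 1 ->
  dot b b = 1 -> dot x a = 0 -> dot x b = 0 -> dot a b = 0 ->
  curvature_term radial a b (x + t *: a) = (1 - t ^+ 2) * w t ^+ 3.
Proof.
move=> x1 a1 b1 xa xb ab; have [y yE] : exists y, y = x + t *: a by eexists.
have yy : dot y y = 1 + t ^+ 2.
  by rewrite yE !(dotDl, dotDr, dotZl, dotZr) (dotC a x) x1 a1 xa; ring.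
have y0 : y != 0 by rewrite -dot_eq0 yy pos.
have ya : dot y a = t by rewrite yE dotDl dotZl xa a1 add0r mulr1.
have yb : dot y b = 0 by rewrite yE dotDl dotZl xb ab mulr0 addr0.
have rr := r_sqr y0; rewrite yy in rr.
have wE : w t = (enorm y)^-1 ^+ 2.
  by apply: (mulIf (pos t)); rewrite rr /w mulVf ?pos.
rewrite -yE /curvature_term !pd2_radial// wE.
rewrite !(dotDl, dotDr, dotNl, dotNr, dotZl, dotZr).
rewrite ?(dotC b a) ?(dotC b y) ?(dotC a y) ya yb yy a1 b1 ?ab.
move: rr; move: (enorm y)^-1 => r rr.
transitivity ((1 - t ^+ 2) * r ^+ 2 ^+ 3 +
  (- 3 * r ^+ 6 * t ^+ 2) * (r ^+ 2 * (1 + t ^+ 2) - 1)).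
  by ring.
by rewrite rr subrr mulr0 addr0.
Qed.

Lemma derive_radial_curvature x a b (t : R) : dot x x = 1 -> dot a a = 1 ->
  dot b b = 1 -> dot x a = 0 -> dot x b = 0 -> dot a b = 0 ->
  'D_a (curvature_term radial a b) (x + t *: a) = t * phi t.
Proof.
move=> x1 a1 b1 xa xb ab.
have [y yE] : exists y, y = x + t *: a by eexists.
have y0 : y != 0.
  rewrite -dot_eq0 yE !(dotDl, dotDr, dotZl, dotZr) (dotC a x) x1 a1 xa.
  by rewrite (_ : _ + _ = 1 + t ^+ 2) ?pos//; ring.
have sK := smooth_curvature_term open_punct a b (@smooth_radial R n).
have dK := smooth_on_differentiable sK y0.
rewrite yE in dK; have [_ <-] := is_derive_line dK.
have [_ <-] := Dk t; congr ('D_1 _ t); apply/funext => s.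
exact: radial_curvature_line.
Qed.

(** The value (1 - t^2) / (1 + t^2)^3 on the line expands as 1 - 4 t^2 + ..., whence 0 and -8. It is
    not constant, because [a] is no longer tangent to the spheres away from [x]. *)
Lemma derive2_radial_curvature x a b : dot x x = 1 -> dot a a = 1 ->
  dot b b = 1 -> dot x a = 0 -> dot x b = 0 -> dot a b = 0 ->
  'D_a (curvature_term radial a b) x = 0 /\
  'D_a ('D_a (curvature_term radial a b)) x = - 8.
Proof.
move=> x1 a1 b1 xa xb ab.
have E t := derive_radial_curvature t x1 a1 b1 xa xb ab.
split; first by have := E 0; rewrite scale0r addr0 mul0r.
have x0 : punct x by rewrite /punct/= -dot_eq0 x1 oner_neq0.
have sK := smooth_curvature_term open_punct a b (@smooth_radial R n).
have dK : differentiable ('D_a (curvature_term radial a b)) (x + (0 : R) *: a).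
  rewrite scale0r addr0.
  exact: smooth_on_differentiable (smooth_on_derive a sK) x0.
have [_] := is_derive_line dK; rewrite scale0r addr0 => <-.
rewrite (_ : (fun s : R => _) = (fun s => s * phi s)); last first.
  by apply/funext => s; exact: E.
have [_ ->] := is_derive_mul_vanish (is_derive_id (0 : R) (1 : R)) dphi (erefl _).
by rewrite /phi /w expr0n /= addr0 subr0 invr1 !expr1n; ring.
Qed.

End RadialAtUnit.

(** * The second fundamental form of an isometric sphere *)

Section MinorsOfIdentity.
Context {R : realType} {n : nat}.
Variable H : 'I_n -> 'I_n -> R.
Hypothesis n_ge3 : (2 < n)%N.
Hypothesis minors : forall i j k l, H i j * H k l - H i l * H k j =
  (i == j)%:R * (k == l)%:R - (i == l)%:R * (k == j)%:R.

Hypothesis symH : forall i j, H i j = H j i.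

Let third (i j : 'I_n) : exists k : 'I_n, (k != i) && (k != j).
Proof.
have : ~~ [forall k, (k == i) || (k == j)].
  apply/negP => /forallP E.
  have : (#|'I_n| <= #|[set i; j]%SET|)%N.
    by apply: subset_leq_card; apply/fintype.subsetP => k _; rewrite !inE.
  rewrite card_ord cards2 => /(leq_trans n_ge3).
  by case: (i != j).
by rewrite negb_forall => /existsP[k]; rewrite negb_or; exists k.
Qed.

(** With a third index [j], the entry is multiplied by the principal minor on [i] and [j], which is
    1; the product is a combination of two minors that vanish for the identity. *)
Lemma minors_offdiag i k : i != k -> H i k = 0.
Proof.
move=> ik; have [j /andP[ji jk]] := third i k.
have := minors i i j k; have := minors j j i k; have := minors i i j j.
rewrite !eqxx (negbTE ik) (negbTE jk) (eq_sym i j) (negbTE ji).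
rewrite (symH j i) !(mulr0, mul0r, mulr1, subr0).
move: (H i i) (H j j) (H i j) (H i k) (H j k) => ii jj ij ik' jk' E1 E2 E3.
have -> : ik' = ik' * (ii * jj - ij * ij) by rewrite E1 mulr1.
transitivity (ij * (ii * jk' - ik' * ij) + ii * (jj * ik' - jk' * ij)); first ring.
by rewrite E2 E3 !mulr0 addr0.
Qed.

Lemma minors_diag i j : i != j -> H i i * H j j = 1.
Proof.
move=> ij; have := minors i i j j.
by rewrite (minors_offdiag ij) !eqxx (negbTE ij) !mul0r !subr0 mulr1.
Qed.

(** The products of any two of three distinct diagonal entries are 1, and these three equations
    determine each square. *)
Lemma minors_diag_sqr i : H i i ^+ 2 = 1.
Proof.
have [j /andP[ji _]] := third i i; have [k /andP[ki kj]] := third i j.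
have E1 : H i i * H j j = 1 by apply: minors_diag; rewrite eq_sym.
have E2 : H i i * H k k = 1 by apply: minors_diag; rewrite eq_sym.
have E3 := minors_diag kj.
transitivity (H i i ^+ 2 * (H k k * H j j)); first by rewrite E3 mulr1.
transitivity ((H i i * H j j) * (H i i * H k k)); first by ring.
by rewrite E1 E2 mulr1.
Qed.

Lemma minors_scalar i j : H i i = H j j.
Proof.
have [->//|ij] := eqVneq i j.
by rewrite -[LHS]mulr1 -(minors_diag_sqr j) expr2 mulrA (minors_diag ij) mul1r.
Qed.

Lemma minors_id : n%:R <= \sum_i H i i -> forall i j, H i j = (i == j)%:R.
Proof.
move=> tr i j; have [<-|ij] := eqVneq i j; last exact: minors_offdiag.
have E : \sum_k H k k = H i i *+ n.
  rewrite (eq_bigr (fun=> H i i)) => [|k _]; last exact: minors_scalar.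
  by rewrite sumr_const card_ord.
have n0 : (0 < n%:R :> R) by rewrite ltr0n; apply: leq_trans n_ge3.
have : 1 <= H i i by rewrite -(ler_pM2r n0) mul1r mulr_natr -E.
have := minors_diag_sqr i; rewrite mulr1n => /eqP.
by rewrite sqrf_eq1 => /orP[/eqP//|/eqP ->]; lra.
Qed.

End MinorsOfIdentity.

(** * The Gauss equation for a homogeneous isometric immersion *)

Section RoundImmersion.
Context {R : realType} {n : nat}.
Local Notation V := 'rV[R]_n.+1.
Implicit Types (a b c d x v : V).

(* The homogeneous extension of degree 0 of an isometric immersion of the
   unit sphere. *)
Definition round_immersion (f : V -> V) :=
  [/\ smooth_on punct f, homog 0 f
    & forall x v w, punct x ->
        dot (pd v f x) (pd w f x) = dot (pd v radial x) (pd w radial x)].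

Variable f : V -> V.
Hypothesis rf : round_immersion f.

Let sf : smooth_on punct f. Proof. by case: rf. Qed.
Let hf : homog 0 f. Proof. by case: rf. Qed.
Let metric x v w : punct x ->
  dot (pd v f x) (pd w f x) = dot (pd v radial x) (pd w radial x).
Proof. by case: rf => _ _; apply. Qed.
Let sr : smooth_on punct (@radial R n). Proof. exact: smooth_radial. Qed.

Lemma smooth_pd_homog k (g : V -> V) v :
  smooth_on punct g -> homog k g -> homog k.+1 (pd v g).
Proof.
move=> sg hg; rewrite pd.unlock; apply: homog_derive => // y y0.
exact: smooth_on_differentiable sg y0.
Qed.

Lemma smooth_pd_euler k (g : V -> V) x :
  smooth_on punct g -> homog k g -> x != 0 -> pd x g x = - k%:R *: g x.
Proof.
move=> sg hg x0; rewrite pd.unlock; apply: homog_euler => // y y0.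
exact: smooth_on_differentiable sg y0.
Qed.

Section AtUnit.
Variables (x N : V).
Hypothesis x1 : dot x x = 1.
Hypothesis N1 : dot N N = 1.
Hypothesis Nf : forall v, dot (pd v f x) N = 0.

Let x0 : x != 0. Proof. by rewrite -dot_gt0 x1. Qed.

Lemma pd_tangential a b : dot x a = 0 -> dot x b = 0 ->
  dot (pd a f x) (pd b f x) = dot a b.
Proof. by move=> xa xb; rewrite metric// !pd_radial_unit. Qed.

Lemma pd_axis : pd x f x = 0.
Proof. by rewrite (smooth_pd_euler sf hf x0) oppr0 scale0r. Qed.

Definition sff a b := dot (pd a (pd b f) x) N.

Lemma sffC a b : sff a b = sff b a.
Proof. by rewrite /sff (pdC open_punct _ _ x0 sf). Qed.

Variable e : 'I_n.+1 -> V.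
Hypotheses (oe : orthonormal_frame e) (e0 : e ord0 = x).

Lemma frame_tangential i : dot x (e (lift ord0 i)) = 0.
Proof. by rewrite -e0 oe. Qed.

(** Index 0 is the radial direction, along which [f] has derivative 0; the normal takes its place,
    so that the images of the other directions are completed to a basis of the ambient space. *)
Lemma adapted_frame : orthonormal_frame
  (fun i => if unlift ord0 i is Some j then pd (e (lift ord0 j)) f x else N).
Proof.
move=> i j; case: (unliftP ord0 i) => [i'|] ->; case: (unliftP ord0 j) => [j'|] ->.
- by rewrite pd_tangential ?frame_tangential// oe.
- by rewrite Nf eq_sym (negbTE (neq_lift _ _)).
- by rewrite dotC Nf (negbTE (neq_lift _ _)).
- by rewrite N1 eqxx.
Qed.

Lemma dot_adapted u v : dot u v = dot u N * dot v N +
  \sum_(i < n) dot u (pd (e (lift ord0 i)) f x) * dot v (pd (e (lift ord0 i)) f x).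
Proof.
rewrite (parseval u v adapted_frame) big_ord_recl unlift_none; congr (_ + _).
by apply: eq_bigr => i _; rewrite liftK.
Qed.

(** The tangential components are determined by the metric, and for the radial projection the second
    derivatives at [x] are multiples of [x], hence have none. *)
Lemma pd2_tangential a b : dot x a = 0 -> dot x b = 0 ->
  pd a (pd b f) x = sff a b *: N.
Proof.
move=> xa xb; apply: dot_ext => w; rewrite dot_adapted big1 => [|i _].
  by rewrite addr0 dotZl (dotC w).
rewrite (same_christoffel open_punct sf sr metric)//.
rewrite pd2_radial_unit// pd_radial_unit ?frame_tangential//.
by rewrite dotZl frame_tangential mulr0 mul0r.
Qed.

Lemma gauss_equation a b c d :
  dot x a = 0 -> dot x b = 0 -> dot x c = 0 -> dot x d = 0 ->
  sff a b * sff c d - sff a d * sff c b = dot a b * dot c d - dot a d * dot c b.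
Proof.
move=> xa xb xc xd.
have := same_curvature open_punct sf sr metric a b c d x0.
rewrite !pd2_tangential// !pd2_radial_unit// !(dotZl, dotZr) N1 x1.
by rewrite !mulr1 !mulrN !mulNr !opprK.
Qed.

(** This differentiates the equality of Christoffel products: the left summand comes from the radial
    projection, the product of two values of [sff] from the derivative that falls on the second
    factor. *)
Lemma pd3_tangential a b c d :
  dot x a = 0 -> dot x b = 0 -> dot x c = 0 -> dot x d = 0 ->
  dot (pd d (pd a (pd b f)) x) (pd c f x) =
  - (dot d a * dot b c + dot d b * dot a c) - sff a b * sff d c.
Proof.
move=> xa xb xc xd.
have := same_christoffel_derive open_punct sf sr metric a b c d x0.
rewrite -(derive_dot d x0 (smooth_pd a (smooth_pd b sr)) (smooth_pd c sr)).
rewrite derive_radial_christoffel// !pd2_tangential// dotZl dotZr N1 mulr1.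
by move=> <-; rewrite addrK.
Qed.

Lemma sff_lin a b c k : sff a (k *: b + c) = k * sff a b + sff a c.
Proof.
rewrite /sff pd.unlock (derive_linear_dir a b c k open_punct x0 sf).
by rewrite dotDl dotZl.
Qed.

Lemma sffZ a b k : sff a (k *: b) = k * sff a b.
Proof.
have h0 : sff a 0 = 0.
  have := sff_lin a b 0 1; rewrite scale1r mul1r addr0.
  by move: (sff _ _) (sff _ _) => A B; lra.
by rewrite -[k *: b]addr0 sff_lin h0 addr0.
Qed.

Lemma sff_id_of_trace : (2 < n)%N ->
  n%:R <= \sum_(i < n) sff (e (lift ord0 i)) (e (lift ord0 i)) ->
  forall i j, sff (e (lift ord0 i)) (e (lift ord0 j)) = (i == j)%:R.
Proof.
move=> n3 tr; apply: (minors_id n3) => // [i j k l|i j]; last exact: sffC.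
rewrite gauss_equation ?frame_tangential// !oe.
by rewrite !(inj_eq lift_inj).
Qed.

End AtUnit.
End RoundImmersion.

(** * Surfaces: Hilbert's argument *)

(** A positive derivative of [g'] at its zero makes [g'] positive just to the right, and the mean
    value theorem concludes. It serves both for the test at a maximum and for showing that tangent
    lines leave a convex domain. *)
Lemma second_derivative_gt0_incr {R : realType} (g g' : R -> R) (c r : R) :
  0 < r -> (forall t, `|t| < r -> is_derive t (1 : R) g (g' t)) ->
  is_derive (0 : R) (1 : R) g' c -> g' 0 = 0 -> 0 < c ->
  forall d, 0 < d -> exists t, 0 < t < d /\ g 0 < g t.
Proof.
move=> r0 Dg Dg' g'0 c0 d d0.
have : \forall t \near 0^', 0 < t^-1 * g' t.
  have [+ Ec] := Dg'; rewrite /derivable => cg.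
  have : t^-1 *: (g' (t *: 1 + 0) - g' 0) @[t --> (0 : R)^'] --> c.
    by rewrite -Ec; exact: cg.
  move=> /(cvgr_gt c) /(_ 0 c0); apply: filterS => t.
  by rewrite g'0 subr0 addr0 /GRing.scale/= mulr1.
move=> /nbhs_ballP[q /= q0 bq].
pose s := Num.min (d / 2) (Num.min (r / 2) (q / 2)).
have s0 : 0 < s by rewrite !lt_min !divr_gt0.
have sd : s < d by rewrite gt_min; apply/orP; left; lra.
have sr : s < r by rewrite !gt_min; apply/orP; right; apply/orP; left; lra.
have sq : s < q by rewrite !gt_min; apply/orP; right; apply/orP; right; lra.
exists s; rewrite s0 sd; split=> //.
have D t : 0 <= t <= s -> is_derive t (1 : R) g (g' t).
  by move=> /andP[t0 ts]; apply: Dg; rewrite ger0_norm// (le_lt_trans ts).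
have [t] : exists2 t, t \in `]0, s[%R & g s - g 0 = g' t * (s - 0).
  apply: MVT => //.
    by move=> t; rewrite in_itv/= => /andP[t0 ts]; apply: D; rewrite !ltW.
  apply: derivable_within_continuous => t; rewrite in_itv/= => ts.
  by case: (D t ts).
rewrite in_itv/= => /andP[t0 ts] E.
have g't : 0 < t^-1 * g' t.
  apply: bq; last by rewrite gt_eqF.
  by rewrite /ball/= sub0r normrN gtr0_norm// (lt_trans ts).
have {}g't : 0 < g' t by rewrite pmulr_rgt0 ?invr_gt0 in g't.
by rewrite -subr_gt0 E subr0 mulr_gt0.
Qed.

Lemma second_derivative_at_max {R : realType} (g g' : R -> R) (c : R) :
  (forall t, is_derive t (1 : R) g (g' t)) -> is_derive (0 : R) (1 : R) g' c ->
  (forall t, g t <= g 0) -> g' 0 = 0 /\ c <= 0.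
Proof.
move=> Dg Dg' gmax.
have g'0 : g' 0 = 0.
  have oo : (0 : R) \in `](-1), 1[%R by rewrite in_itv/=; apply/andP; split; lra.
  have [_ <-] := Dg 0.
  by have [_ ->] := @derive1_at_max R g (-1) 1 0 (ltac:(lra))
    (fun t _ => @ex_derive _ _ _ _ _ _ _ (Dg t)) oo (fun t _ => gmax t).
split=> //; rewrite leNgt; apply/negP => c0.
have [t [_]] := second_derivative_gt0_incr ltr01 (fun t _ => Dg t) Dg' g'0 c0 ltr01.
by rewrite ltNge gmax.
Qed.

Section Laplacian.
Context {R : realType} {n : nat}.
Local Notation V := 'rV[R]_n.+1.
Implicit Types (a b c d x v : V).

(** The flat Laplacian, in fixed directions and hence smooth. At a unit vector the radial second
    derivative of [f] vanishes, so that there it is the trace of the second fundamental form times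
    the normal. *)
Definition laplacian (f : V -> V) x : V :=
  \sum_i pd (delta_mx 0 i) (pd (delta_mx 0 i) f) x.

Lemma pd_delta (f : V -> V) v x : punct x -> smooth_on punct f ->
  pd v f x = \sum_i v 0 i *: pd (delta_mx 0 i) f x.
Proof.
move=> x0 sf; rewrite pd.unlock derive_rV//.
exact: smooth_on_differentiable sf x0.
Qed.

Lemma laplacian_frame (f : V -> V) e x : punct x -> smooth_on punct f ->
  orthonormal_frame e -> laplacian f x = \sum_i pd (e i) (pd (e i) f) x.
Proof.
move=> x0 sf oe; pose d i : V := delta_mx 0 i.
transitivity (\sum_i \sum_j \sum_k (e i 0 j * e i 0 k) *: pd (d k) (pd (d j) f) x).
  rewrite exchange_big/=; apply: eq_bigr => j _.
  rewrite exchange_big/= (bigD1 j)//= -scaler_suml.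
  have E k : \sum_i e i 0 j * e i 0 k = (j == k)%:R.
    transitivity (dot (d j) (d k)).
      rewrite (parseval _ _ oe); apply: eq_bigr => i _.
      by rewrite !dot_delta.
    by rewrite dot_delta mxE eqxx.
  rewrite E eqxx scale1r big1 ?addr0// => k kj.
  by rewrite -scaler_suml E eq_sym (negbTE kj) scale0r.
apply: eq_bigr => i _.
rewrite (pd_delta _ x0 (smooth_pd _ sf)); apply: eq_bigr => j _.
rewrite (pdC open_punct _ _ x0 sf) (pd_delta _ x0 (smooth_pd _ sf)) scaler_sumr.
by apply: eq_bigr => k _; rewrite scalerA.
Qed.

End Laplacian.

Lemma pdD {R : realType} {n} (A : set 'rV[R]_n.+1) (F G : 'rV[R]_n.+1 -> 'rV[R]_n.+1)
    v x : A x -> smooth_on A F -> smooth_on A G ->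
  pd v (fun y => F y + G y) x = pd v F x + pd v G x.
Proof.
move=> Ax sF sG; rewrite pd.unlock.
exact: (deriveD (smooth_derivable sF Ax) (smooth_derivable sG Ax)).
Qed.

Section Hilbert.
Context {R : realType} {n : nat}.
Local Notation V := 'rV[R]_n.+1.
Implicit Types (a b c d x v : V).
Variable f : V -> V.
Hypothesis rf : round_immersion f.

Let sf : smooth_on punct f. Proof. by case: rf. Qed.
Let hf : homog 0 f. Proof. by case: rf. Qed.
Let oP : open (@punct R n). Proof. exact: open_punct. Qed.
Let s2 v : smooth_on punct (pd v (pd v f)).
Proof. by do 2!apply: smooth_pd. Qed.

(** The direction [x] is fixed during differentiation, so the radial term contributes although it
    vanishes at [x]. With [v] moved inside, Euler's identity applies in degrees -2 and -1: the
    factor is (-2)(-1). *)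
Lemma pd_pd2_axis x v : punct x -> dot x x = 1 ->
  pd v (pd x (pd x f)) x = 2 *: pd v f x.
Proof.
move=> x0 x1; rewrite (pdCA oP v x x sf x0).
have sv := smooth_pd v sf; have hv := smooth_pd_homog v sf hf.
have svx := smooth_pd x sv; have hvx := smooth_pd_homog x sv hv.
rewrite (smooth_pd_euler svx hvx x0) (smooth_pd_euler sv hv x0).
by rewrite scalerA mulrNN mulr1.
Qed.

Lemma pd2_pd2 v w y : punct y ->
  pd v (pd v (pd w (pd w f))) y = pd w (pd w (pd v (pd v f))) y.
Proof.
move=> y0; rewrite -(pdCA oP v w w (smooth_pd v sf) y0).
by apply: (pd_eq_on oP) => // z z0; exact: (pdCA oP v w w sf z0).
Qed.

(** Euler's identity in degrees -3 and -2, whence the factor 6. *)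
Lemma pd2_pd2_axis x v : punct x -> dot x x = 1 ->
  pd v (pd v (pd x (pd x f))) x = 6 *: pd v (pd v f) x.
Proof.
move=> x0 x1; rewrite pd2_pd2//.
have sv := smooth_pd v sf; have hv := smooth_pd_homog v sf hf.
have svv := smooth_pd v sv; have hvv := smooth_pd_homog v sv hv.
have svx := smooth_pd x svv; have hvx := smooth_pd_homog x svv hvv.
rewrite (smooth_pd_euler svx hvx x0) (smooth_pd_euler svv hvv x0).
by rewrite scalerA mulrNN -natrM.
Qed.

Section Point.
Variables (x N : V).
Hypothesis x1 : dot x x = 1.
Hypothesis N1 : dot N N = 1.
Hypothesis Nf : forall v, dot (pd v f x) N = 0.
Let x0 : punct x. Proof. by rewrite /punct/= -dot_gt0 x1. Qed.

Section Side.
Variables (a b : V).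
Hypotheses (a1 : dot a a = 1) (b1 : dot b b = 1) (ab : dot a b = 0).
Hypotheses (xa : dot x a = 0) (xb : dot x b = 0).
Hypothesis basis : forall u v, dot u v = dot u N * dot v N +
  (dot u (pd a f x) * dot v (pd a f x) + dot u (pd b f x) * dot v (pd b f x)).
Hypothesis Ef2 : forall c d, dot x c = 0 -> dot x d = 0 ->
  pd c (pd d f) x = sff f x N c d *: N.
Hypothesis Ef3 : forall c d p q,
  dot x c = 0 -> dot x d = 0 -> dot x p = 0 -> dot x q = 0 ->
  dot (pd q (pd c (pd d f)) x) (pd p f x) =
  - (dot q c * dot d p + dot q d * dot c p) - sff f x N c d * sff f x N q p.
Hypothesis Mab : sff f x N a b = 0.
Let lam := sff f x N a a.
Let mu := sff f x N b b.
Hypothesis lm1 : lam * mu = 1.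

(* Only the normal components of the higher derivatives are unknown: the
   tangential ones are determined by the metric. *)
Definition cubic c d p := dot (pd c (pd d (pd p f)) x) N.
Definition quartic c d p q := dot (pd c (pd d (pd p (pd q f))) x) N.

Let ml1 : mu * lam = 1. Proof. by rewrite mulrC. Qed.
Let ba : dot b a = 0. Proof. by rewrite dotC. Qed.

Let Mba : sff f x N b a = 0.
Proof. by rewrite (sffC rf N x1). Qed.

(** The Gauss equation differentiated once along [a]: the derivative of the curvature term of the
    radial projection is 0 at [x]. *)
Lemma cubic_gauss : mu * cubic a a a + lam * cubic a b b = 0.
Proof.
have E : 'D_a (curvature_term f a b) x = 0.
  have [<- _] := derive2_radial_curvature x1 a1 b1 xa xb ab.
  apply: (derive_eq_on oP) => // y y0.
  case: rf => _ _ metric.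
  exact: (same_curvature_fun oP sf smooth_radial metric).
move: E; rewrite (derive_curvature oP a b a sf x0) !Ef2// Mab scale0r dot0r mulr0 subr0.
by rewrite dotZl dotZr -/lam -/mu /cubic (dotC N).
Qed.

Hypotheses (p1 : cubic a a a = 0) (p2 : cubic a b b = 0) (p3 : cubic b a a = 0).

Let faaa_N : dot (pd a (pd a (pd a f)) x) N = 0. Proof. exact: p1. Qed.
Let fabb_N : dot (pd a (pd b (pd b f)) x) N = 0. Proof. exact: p2. Qed.
Let faab_N : dot (pd a (pd a (pd b f)) x) N = 0.
Proof. by rewrite (pdCA oP a a b sf x0); exact: p3. Qed.

(** The Gauss equation differentiated twice along [a], where the cubic normal terms vanish. The
    radial projection gives -8; the tangential parts of the third derivatives contribute 2 (2 +
    lam^2) - 2 on the other side, from the pairs [aaa], [abb] and [aab], [aab]. *)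
Lemma quartic_gauss :
  mu * quartic a a a a + lam * quartic a a b b = - 10 - 2 * lam ^+ 2.
Proof.
have E : 'D_a ('D_a (curvature_term f a b)) x = - 8.
  have [_ <-] := derive2_radial_curvature x1 a1 b1 xa xb ab.
  apply: (derive_eq_on oP) => // y y0; apply: (derive_eq_on oP) => // z z0.
  case: rf => _ _ metric.
  exact: (same_curvature_fun oP sf smooth_radial metric).
move: E; rewrite (derive2_curvature oP a b a sf x0) !Ef2// Mab scale0r dot0r mulr0 subr0.
rewrite dotZl dotZr -/lam -/mu (dotC N).
rewrite (basis (pd a (pd a (pd a f)) x)) (basis (pd a (pd a (pd b f)) x)).
rewrite faaa_N fabb_N faab_N !Ef3// ?a1 ?b1 ?ab ?ba ?Mab ?Mba -/lam -/mu.
rewrite -/(quartic a a a a) -/(quartic a a b b) ml1.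
move: lam mu (quartic _ _ _ _) (quartic _ _ _ _) => l m q1 q2 E; lra.
Qed.

Let L y := pd x (pd x f) y + (pd a (pd a f) y + pd b (pd b f) y).

Let sL1 : smooth_on punct (fun y => pd a (pd a f) y + pd b (pd b f) y).
Proof. exact: smoothD. Qed.

Let pdL v y : punct y -> pd v L y = pd v (pd x (pd x f)) y +
  (pd v (pd a (pd a f)) y + pd v (pd b (pd b f)) y).
Proof. by move=> y0; rewrite (pdD v y0 (s2 x) sL1) (pdD v y0 (s2 a) (s2 b)). Qed.

Lemma cubic_laplacian : dot (pd a L x) N = cubic a a a + cubic a b b.
Proof.
rewrite pdL// pd_pd2_axis// !dotDl dotZl Nf mulr0 add0r.
by [].
Qed.

(** The first derivative of the Laplacian is tangential here, along [pd a f x] only, with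
    coefficient 2 - (2 + lam^2) - 1 coming from the radial term and from the directions [a] and [b].
    In the second derivative the radial term gives the 6. *)
Lemma quartic_laplacian :
  dot (pd a (pd a L) x) N = 6 * lam + quartic a a a a + quartic a a b b /\
  dot (pd a L x) (pd a L x) = (1 + lam ^+ 2) ^+ 2.
Proof.
have s3 v : smooth_on punct (pd a (pd v (pd v f))) by exact: smooth_pd.
split.
  have -> : pd a (pd a L) x = pd a (fun y => pd a (pd x (pd x f)) y +
      (pd a (pd a (pd a f)) y + pd a (pd b (pd b f)) y)) x.
    by apply: (pd_eq_on oP) => // y y0; exact: pdL.
  rewrite (pdD a x0 (s3 x) (smoothD oP (s3 a) (s3 b))) (pdD a x0 (s3 a) (s3 b)).
  by rewrite pd2_pd2_axis// Ef2// !dotDl !dotZl N1 mulr1 addrA.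
have axis w : dot (pd a L x) w = 2 * dot (pd a f x) w +
    (dot (pd a (pd a (pd a f)) x) w + dot (pd a (pd b (pd b f)) x) w).
  by rewrite pdL// pd_pd2_axis// !dotDl dotZl.
rewrite basis !axis faaa_N fabb_N Nf !Ef3// ?a1 ?b1 ?ab ?ba ?Mab ?Mba -/lam -/mu.
have [_ _ metric] := rf.
rewrite !(pd_tangential rf)// a1 ab.
rewrite ml1.
move: lam => l; ring.
Qed.

End Side.
End Point.
End Hilbert.

Section LineTest.
Context {R : realType} {n : nat}.
Local Notation V := 'rV[R]_n.+1.

(** The line leaves the sphere, and the squared norm of a Laplacian of a map of degree 0 has degree
    -4. The factor [dot y y ^+ 2] compensates for this and adds [4 * dot (L x) (L x)] to the second
    derivative. *)
Lemma line_test (L : V -> V) (x a : V) : smooth_on punct L ->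
  dot x x = 1 -> dot a a = 1 -> dot x a = 0 ->
  (forall t, dot (x + t *: a) (x + t *: a) ^+ 2 *
     dot (L (x + t *: a)) (L (x + t *: a)) <= dot (L x) (L x)) ->
  dot (pd a L x) (L x) = 0 /\
  4 * dot (L x) (L x) + 2 * dot (pd a (pd a L) x) (L x) +
    2 * dot (pd a L x) (pd a L x) <= 0.
Proof.
move=> sL x1 a1 xa maxL.
have yy t : dot (x + t *: a) (x + t *: a) = 1 + t ^+ 2.
  rewrite !(dotDl, dotDr, dotZl, dotZr) (dotC a x) x1 a1 xa; ring.
have y0 t : punct (x + t *: a).
  by rewrite /punct/= -dot_gt0 yy ltr_wpDr// sqr_ge0.
have sL1 := smooth_pd a sL.
have x0 : punct x by have := y0 0; rewrite scale0r addr0.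
pose q t := dot (L (x + t *: a)) (L (x + t *: a)).
pose q1 t := dot (pd a L (x + t *: a)) (L (x + t *: a)).
have Dq t : is_derive t (1 : R) q (2 * q1 t).
  have dd : differentiable (fun y => dot (L y) (L y)) (x + t *: a).
    exact: smooth_on_differentiable (smooth_dot open_punct sL sL) (y0 t).
  apply: (@is_derive_eq _ _ _ _ _ _ _ _ (is_derive_line dd)).
  rewrite (derive_dot a (y0 t) sL sL) (dotC (L _)) -/(q1 t).
  by rewrite mulr_natl mulr2n.
have Dq1 : is_derive (0 : R) (1 : R) q1
    (dot (pd a (pd a L) x) (L x) + dot (pd a L x) (pd a L x)).
  have dd : differentiable (fun y => dot (pd a L y) (L y)) (x + 0 *: a).
    exact: smooth_on_differentiable (smooth_dot open_punct sL1 sL) (y0 0).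
  apply: (@is_derive_eq _ _ _ _ _ _ _ _ (is_derive_line dd)).
  by rewrite (derive_dot a (y0 0) sL1 sL) scale0r addr0.
have Dt t : is_derive t (1 : R) (fun t : R => 1 + t ^+ 2) (2 * t).
  have H := is_deriveD (is_derive_cst (1 : R) t (1 : R))
    (is_deriveX 2 (is_derive_id t (1 : R))).
  apply: (@is_derive_eq _ _ _ _ _ _ _ _ H).
  by rewrite /GRing.scale/=; ring.
pose g' t := 4 * t * (1 + t ^+ 2) * q t + (1 + t ^+ 2) ^+ 2 * (2 * q1 t).
have Dg t : is_derive t (1 : R) (fun t => (1 + t ^+ 2) * (1 + t ^+ 2) * q t) (g' t).
  have H := is_deriveM (is_deriveM (Dt t) (Dt t)) (Dq t).
  apply: (@is_derive_eq _ _ _ _ _ _ _ _ H).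
  by rewrite /GRing.scale/= mulrfctE /g'; ring.
have Dg' : is_derive (0 : R) (1 : R) g' (4 * q 0 +
     2 * (dot (pd a (pd a L) x) (L x) + dot (pd a L x) (pd a L x))).
  have H1 := is_deriveM (is_deriveM (is_deriveZ 4 (is_derive_id (0 : R) (1 : R))) (Dt 0)) (Dq 0).
  have H2 := is_deriveM (is_deriveM (Dt 0) (Dt 0)) (is_deriveZ 2 Dq1).
  have H := is_deriveD H1 H2.
  rewrite (_ : g' = ((4 *: id : R -> R) * (fun t : R => 1 + t ^+ 2) * q) +
    (fun t : R => 1 + t ^+ 2) * (fun t : R => 1 + t ^+ 2) * (2 *: q1)); last first.
    by apply/funext => t; rewrite /g' !addrfctE !mulrfctE expr2.
  apply: (@is_derive_eq _ _ _ _ _ _ _ _ H).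
  rewrite /GRing.scale/= !mulrfctE.
  rewrite -[(4 \*: (id : R -> R)) 0]/(4 * (0 : R)).
  move: (q 0) (q1 0) => A B; rewrite /GRing.scale/= expr0n /=; ring.
have [|g'0 g''0] := second_derivative_at_max Dg Dg'.
  move=> t; rewrite -expr2 -yy; apply: le_trans (maxL t) _.
  by rewrite expr0n /= addr0 !mul1r /q scale0r addr0.
split.
  move: g'0; rewrite /g' expr0n /= addr0 expr1n mulr0 !mul0r add0r mul1r.
  by rewrite /q1 scale0r addr0 => /eqP; rewrite mulf_eq0 pnatr_eq0 => /orP[//|/eqP].
move: g''0; rewrite /q scale0r addr0.
by move: (dot _ _) (dot _ _) (dot _ _) => A B C; lra.
Qed.

End LineTest.

Lemma compact_unit_sphere {R : realType} {n : nat} :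
  compact (@unit_sphere R n).
Proof.
have cd : continuous (fun x : 'rV[R]_n.+1 => dot x x).
  move=> x; apply: (@smooth_continuous _ _ _ setT (fun x : 'rV[R]_n.+1 => dot x x)) => //.
  by apply: smooth_dot; [exact: openT|exact: smooth_id|exact: smooth_id].
apply: bounded_closed_compact; last first.
  have -> : @unit_sphere R n = (fun x => dot x x) @^-1` [set 1].
    by apply/seteqP; split=> x /=; rewrite unit_sphereE.
  by apply: closed_comp => // x _; exact: cd.
exists 1; split=> [//|M M1 x /unit_sphereE x1].
apply: le_trans (ltW M1); rewrite [leLHS]/Num.Def.normr/= mx_normrE.
apply: bigmax_le => // -[i j] _ /=; rewrite ord1.
rewrite -(@ler_pXn2r _ 2) ?nnegrE// expr1n -[leLHS]normrX ger0_norm ?sqr_ge0//.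
by rewrite -x1 coord_le_dot.
Qed.

Section RotateFrame.
Context {R : realType}.
Local Notation V := 'rV[R]_3.
Variables (f : V -> V) (x N : V).
Hypotheses (rf : round_immersion f) (x1 : dot x x = 1).

Definition frame3 (u v w : V) : 'I_3 -> V := fun i => nth 0 [:: u; v; w] i.

Lemma frame3_orthonormal (a b : V) : dot a a = 1 -> dot b b = 1 -> dot a b = 0 ->
  dot x a = 0 -> dot x b = 0 -> orthonormal_frame (frame3 x a b).
Proof.
move=> a1 b1 ab xa xb [[|[|[|i]]] hi] [[|[|[|j]]] hj] //=;
 by rewrite /frame3/= ?x1 ?a1 ?b1 ?ab ?xa ?xb// dotC.
Qed.

Lemma diagonal_frame : exists a b,
  [/\ [/\ dot a a = 1, dot b b = 1 & dot a b = 0],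
      dot x a = 0, dot x b = 0 & sff f x N a b = 0].
Proof.
have [e [oe e0]] := exists_frame x1.
have [a [b [[a1 b1 ab] xa xb]]] : exists a b,
    [/\ [/\ dot a a = 1, dot b b = 1 & dot a b = 0], dot x a = 0 & dot x b = 0].
  by exists (e (inord 1)), (e (inord 2)); rewrite -e0 !oe -!val_eqE/= !inordK.
have [M0|M0] := eqVneq (sff f x N a b) 0; first by exists a, b.
have hC := sffC rf N x1; have hl := sff_lin rf N x1.
have hr p q r k : sff f x N (k *: q + r) p = k * sff f x N q p + sff f x N r p.
  by rewrite hC hl !(hC p).
have hZ p k q : sff f x N p (k *: q) = k * sff f x N p q := sffZ rf N x1 p q k.
move: M0; set M := sff f x N a b; set L := sff f x N a a; set P := sff f x N b b.
move=> M0.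
pose D := Num.sqrt ((L - P) ^+ 2 + 4 * M ^+ 2).
have DD : D ^+ 2 = (L - P) ^+ 2 + 4 * M ^+ 2.
  by rewrite sqr_sqrtr// addr_ge0 ?sqr_ge0// mulr_ge0 ?sqr_ge0.
(* The vector (M, m) is an eigenvector of the symmetric matrix with rows (L, M) and (M, P), for the
   eigenvalue L + m; it is not zero as M is not. The new frame is this vector, normalized, and its
   rotation by a right angle. *)
pose m := (P - L + D) / 2.
have mm : m ^+ 2 + (L - P) * m - M ^+ 2 = 0.
  transitivity ((D ^+ 2 - ((L - P) ^+ 2 + 4 * M ^+ 2)) / 4); first by rewrite /m; field.
  by rewrite DD subrr mul0r.
clearbody m; have k0 : 0 < M ^+ 2 + m ^+ 2 by rewrite ltr_pwDl ?sqr_ge0// exprn_even_gt0.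
pose k := Num.sqrt (M ^+ 2 + m ^+ 2).
have kk : k ^+ 2 = M ^+ 2 + m ^+ 2 by rewrite sqr_sqrtr// ltW.
have kn0 : k != 0 by rewrite gt_eqF// sqrtr_gt0.
clearbody k; have ba : dot b a = 0 by rewrite dotC.
exists ((M / k) *: a + (m / k) *: b), ((- m / k) *: a + (M / k) *: b).
have kE : (M / k) ^+ 2 + (m / k) ^+ 2 = 1.
  transitivity ((M ^+ 2 + m ^+ 2) / k ^+ 2); first by field.
  by rewrite -kk divff// expf_neq0.
split; [split| | |].
- rewrite !(dotDl, dotDr, dotZl, dotZr) a1 b1 ab ba -[RHS]kE; ring.
- rewrite !(dotDl, dotDr, dotZl, dotZr) a1 b1 ab ba -[RHS]kE; ring.
- rewrite !(dotDl, dotDr, dotZl, dotZr) a1 b1 ab ba; ring.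
- by rewrite dotDr !dotZr xa xb !mulr0 addr0.
- by rewrite dotDr !dotZr xa xb !mulr0 addr0.
- rewrite hr !hl !hZ (hC ((m / k) *: b) a) (hC ((m / k) *: b) b) !hZ -/M -/L -/P.
  transitivity (- (M / k ^+ 2) * (m ^+ 2 + (L - P) * m - M ^+ 2)); first by field.
  by rewrite mm mulr0.
Qed.

End RotateFrame.

Section HilbertTheorem.
Context {R : realType}.
Local Notation V := 'rV[R]_3.
Variables (f N : V -> V).
Hypothesis rf : round_immersion f.
Hypothesis N1 : forall x, dot x x = 1 -> dot (N x) (N x) = 1.
Hypothesis Nf : forall x v, dot x x = 1 -> dot (pd v f x) (N x) = 0.
Hypothesis mean_ge1 : forall x e, dot x x = 1 -> orthonormal_frame e ->
  e ord0 = x ->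
  2 <= \sum_(i < 2) sff f x (N x) (e (lift ord0 i)) (e (lift ord0 i)).

Let sf : smooth_on punct f. Proof. by case: rf. Qed.
Let hf : homog 0 f. Proof. by case: rf. Qed.
Let unit_punct (x : V) : dot x x = 1 -> punct x.
Proof. by move=> x1; rewrite /punct/= -dot_gt0 x1. Qed.

(* The square of the trace of the second fundamental form, homogeneous of
   degree 0. *)
Let S (x : V) := dot x x ^+ 2 * dot (laplacian f x) (laplacian f x).

Let lap_unit x e : dot x x = 1 -> orthonormal_frame e -> e ord0 = x ->
  laplacian f x =
  (\sum_(i < 2) sff f x (N x) (e (lift ord0 i)) (e (lift ord0 i))) *: N x.
Proof.
move=> x1 oe e0; have x0 := unit_punct x1.
rewrite (laplacian_frame x0 sf oe) big_ord_recl e0.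
rewrite (smooth_pd_euler (smooth_pd x sf) (smooth_pd_homog x sf hf) x0).
rewrite (pd_axis rf x1) scaler0 add0r scaler_suml.
apply: eq_bigr => i _.
have xi := frame_tangential oe e0 i.
exact: (pd2_tangential rf x1 (N1 x1) (fun v => Nf v x1) oe e0 xi xi).
Qed.

Let lapZ (c : R) (x : V) : 0 < c -> punct x ->
  laplacian f (c *: x) = c^-1 ^+ 2 *: laplacian f x.
Proof.
move=> c0 x0; rewrite /laplacian scaler_sumr; apply: eq_bigr => i _.
have s1 := smooth_pd (delta_mx 0 i) sf.
exact: (smooth_pd_homog _ s1 (smooth_pd_homog (delta_mx 0 i) sf hf) c0 x0).
Qed.

Let SZ (c : R) (x : V) : 0 < c -> punct x -> S (c *: x) = S x.
Proof.
move=> c0 x0; rewrite /S lapZ// !(dotZl, dotZr).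
by field; rewrite gt_eqF.
Qed.

Let smooth_lap : smooth_on punct (laplacian f).
Proof.
apply/smooth_onP => k; apply: Ck_sum => [|i]; first exact: open_punct.
by apply: (smooth_onP _ _).1; do 2!apply: smooth_pd.
Qed.

(** Everything that the maximum at [c] yields along one principal direction: the two linear
    equations on the cubic terms come from the first order of the maximum and of the Gauss equation,
    the last two statements from the second order. It is applied to both principal directions. *)
Let hilbert_side c a b (s := sff f c (N c) a a + sff f c (N c) b b) :
  dot c c = 1 -> (forall y, punct y -> S y <= S c) ->
  dot a a = 1 -> dot b b = 1 -> dot a b = 0 -> dot c a = 0 -> dot c b = 0 ->
  sff f c (N c) a b = 0 -> 2 <= s ->
  [/\ S c = s ^+ 2, sff f c (N c) a a * sff f c (N c) b b = 1,
      cubic f c (N c) a a a + cubic f c (N c) a b b = 0,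
      sff f c (N c) b b * cubic f c (N c) a a a +
        sff f c (N c) a a * cubic f c (N c) a b b = 0 &
      cubic f c (N c) a a a = 0 -> cubic f c (N c) a b b = 0 ->
      cubic f c (N c) b a a = 0 ->
      sff f c (N c) b b * quartic f c (N c) a a a a +
        sff f c (N c) a a * quartic f c (N c) a a b b =
        - 10 - 2 * sff f c (N c) a a ^+ 2 /\
      4 * s ^+ 2 + 2 * (s * (6 * sff f c (N c) a a + quartic f c (N c) a a a a +
        quartic f c (N c) a a b b)) + 2 * (1 + sff f c (N c) a a ^+ 2) ^+ 2 <= 0].
Proof.
move=> c1 Smax a1 b1 ab xa xb M0 s2; have c0 := unit_punct c1.
have oe := frame3_orthonormal c1 a1 b1 ab xa xb.
have e0 : frame3 c a b ord0 = c by [].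
have n1 := N1 c1; have nf v := Nf v c1.
have lamu : sff f c (N c) a a * sff f c (N c) b b = 1.
  have := gauss_equation rf c1 n1 nf oe e0 xa xa xb xb.
  by rewrite a1 b1 ab M0 !mul0r !subr0 mulr1.
have basis u v : dot u v = dot u (N c) * dot v (N c) +
    (dot u (pd a f c) * dot v (pd a f c) + dot u (pd b f c) * dot v (pd b f c)).
  by rewrite (dot_adapted rf c1 n1 nf oe e0 u v) !big_ord_recl big_ord0 addr0.
have E2 p q := @pd2_tangential _ _ _ rf _ _ c1 n1 nf _ oe e0 p q.
have E3 p q r t := @pd3_tangential _ _ _ rf _ _ c1 n1 nf _ oe e0 p q r t.
have lap := lap_unit c1 oe e0.
rewrite !big_ord_recl big_ord0 addr0 in lap.
pose L y := pd c (pd c f) y + (pd a (pd a f) y + pd b (pd b f) y).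
have LE y : punct y -> laplacian f y = L y.
  move=> y0; rewrite (laplacian_frame y0 sf oe).
  by rewrite !big_ord_recl big_ord0 addr0.
have sL : smooth_on punct L by apply: smooth_on_eq LE smooth_lap; exact: open_punct.
have SE y : punct y -> S y = dot y y ^+ 2 * dot (L y) (L y).
  by move=> y0; rewrite /S LE.
have Lc : L c = s *: N c by rewrite -LE.
have LLc : dot (L c) (L c) = s ^+ 2 by rewrite Lc dotZl dotZr n1 mulr1.
have Sc : S c = s ^+ 2 by rewrite SE// c1 expr1n mul1r.
have spos t : punct (c + t *: a).
  rewrite /punct/= -dot_gt0 !(dotDl, dotDr, dotZl, dotZr) (dotC a c) c1 a1 xa.
  by rewrite !mulr0 !mulr1 add0r addr0 -expr2 ltr_pwDl// sqr_ge0.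
have Lmax t : dot (c + t *: a) (c + t *: a) ^+ 2 *
     dot (L (c + t *: a)) (L (c + t *: a)) <= dot (L c) (L c).
  by rewrite -SE// LLc -Sc; exact: Smax.
have [D1 D2] := line_test sL c1 a1 xa Lmax.
have sn0 : s != 0 by rewrite gt_eqF// (lt_le_trans _ s2).
split=> //.
- rewrite -(cubic_laplacian rf c1 nf).
  by move: D1; rewrite Lc dotZr => /eqP; rewrite mulf_eq0 (negbTE sn0) => /eqP.
- exact: (cubic_gauss rf c1 a1 b1 ab xa xb E2 M0).
move=> p1 p2 p3; split.
  exact: (quartic_gauss rf c1 a1 b1 ab xa xb basis E2 E3 M0 lamu p1 p2 p3).
have [Q1 Q2] := quartic_laplacian rf c1 n1 nf a1 b1 ab xa xb basis E2 E3 M0 lamu p1 p2.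
by move: D2; rewrite LLc Lc dotZr -Q1 -Q2.
Qed.

Let S_unit_le4 x : dot x x = 1 -> S x <= 4.
Proof.
have A0 : @unit_sphere R 2 !=set0.
  by exists (delta_mx 0 ord0); apply/unit_sphereE; rewrite dot_delta mxE !eqxx.
have cS : {within @unit_sphere R 2, continuous S}.
  apply: continuous_in_subspaceT => y /[1!inE] /sphere_neq0 y0.
  apply: (@smooth_continuous _ _ _ punct S) y0.
  apply: smoothM; [exact: open_punct| |].
    apply: (@smooth_on_eq _ _ _ _ (fun y => dot y y * dot y y)).
    - exact: open_punct.
    - by move=> z _; rewrite expr2.
    - by apply: smoothM; [exact: open_punct|..]; apply: smooth_dot;
        (exact: open_punct || exact: smooth_id).
  by apply: smooth_dot; [exact: open_punct|..].
have [c {}cS cmax] := compact_EVT_max A0 compact_unit_sphere cS.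
move=> x1; apply: (@le_trans _ _ (S c)).
  by apply: cmax; rewrite inE; exact/unit_sphereE.
move: cS; rewrite inE => /unit_sphereE c1; clear x x1.
have c0 := unit_punct c1.
(* Since [S] is homogeneous of degree 0, its maximum over the sphere is one over the punctured
   space, and can be tested along straight lines. *)
have Smax y : punct y -> S y <= S c.
  move=> y0; rewrite -(@SZ (enorm y)^-1 y) ?invr_gt0 ?enorm_gt0//.
  by apply: cmax; rewrite inE; exact: radial_sphere.
have [a [b [[a1 b1 ab] xa xb M0]]] := diagonal_frame (N c) rf c1.
have oe := frame3_orthonormal c1 a1 b1 ab xa xb.
have tr := mean_ge1 c1 oe (erefl _).
rewrite !big_ord_recl big_ord0 addr0 /frame3/= in tr.
have ba : dot b a = 0 by rewrite dotC.
have M0' : sff f c (N c) b a = 0 by rewrite (sffC rf (N c) c1).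
have tr' : 2 <= sff f c (N c) b b + sff f c (N c) a a by rewrite addrC.
have [Sc lm ca ga qa] := hilbert_side c1 Smax a1 b1 ab xa xb M0 tr.
have [_ _ cb gb qb] := hilbert_side c1 Smax b1 a1 ba xb xa M0' tr'.
rewrite Sc.
have qC : quartic f c (N c) b b a a = quartic f c (N c) a a b b.
  by rewrite /quartic (pd2_pd2 rf).
rewrite qC in qb.
move: Sc lm ca ga qa cb gb qb tr => _.
move: (sff f c (N c) a a) (sff f c (N c) b b) => l m.
move: (cubic _ _ _ a a a) (cubic _ _ _ a b b) (cubic _ _ _ b b b) (cubic _ _ _ b a a).
move: (quartic _ _ _ _ _ _ _) (quartic _ _ _ _ _ _ _) (quartic _ _ _ _ _ _ _).
move=> q1 q2 q3 p1 p2 p3 p4 lm ca ga qa cb gb qb tr.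
(* At an umbilic point the product 1 of the principal curvatures gives the bound directly. Otherwise
   [l - m] is, up to sign, the determinant of the linear systems on the cubic terms, which therefore
   vanish. *)
have [lmE|lmN] := eqVneq l m.
  by rewrite lmE in lm tr *; nra.
have dz (p q : R) : p + q = 0 -> m * p + l * q = 0 -> p = 0 /\ q = 0.
  move=> pq E; have p0 : p = 0.
    have : (m - l) * p = 0 by rewrite -[RHS]E (_ : q = - p); [ring|lra].
    move=> /eqP; rewrite mulf_eq0 subr_eq0 eq_sym (negbTE lmN) => /eqP //.
  by split=> //; lra.
have dz' (p q : R) : p + q = 0 -> l * p + m * q = 0 -> p = 0 /\ q = 0.
  by move=> pq; rewrite addrC => E; have [|-> ->] := dz q p _ E; rewrite // addrC.
have [z1 z2] := dz _ _ ca ga; have [z3 z4] := dz' _ _ cb gb.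
have [A1 A2] := qa z1 z2 z4; have [B1 B2] := qb z3 z4 z2.
have l0 : 0 < l by nra.
have m0 : 0 < m by nra.
have h1 : 1 + l ^+ 2 = l * (l + m) by rewrite -[in LHS]lm; ring.
have h2 : 1 + m ^+ 2 = m * (l + m) by rewrite -[in LHS]lm; ring.
rewrite h1 in A2; rewrite h2 (addrC m) in B2.
(* With the weight [m] along the direction of curvature [l], and [l] along the other, the unknown
   quartic terms add up to the two combinations that [A1] and [B1] evaluate. *)
have A3 := mulr_ge0_le0 (ltW m0) A2; have B3 := mulr_ge0_le0 (ltW l0) B2.
have : 2 * (l + m) * ((l + m) ^+ 2 - 4) <= 0.
  have := lerD A3 B3; rewrite addr0; congr (_ <= 0).
  transitivity (4 * (l + m) ^+ 3 + 2 * (l + m) * (12 * (l * m) +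
    (m * q3 + l * q2) + (l * q1 + m * q2)) + 2 * (l + m) ^+ 3 * (l * m)).
    by ring.
  rewrite A1 B1 lm.
  transitivity (2 * (l + m) * ((l + m) ^+ 2 - 4) + 8 * (l + m) * (l * m - 1)).
    by ring.
  by rewrite lm subrr mulr0 addr0.
rewrite pmulr_rle0; first by rewrite subr_le0.
by rewrite mulr_gt0// addr_gt0.
Qed.

Theorem round_immersion_sff2 x e : dot x x = 1 -> orthonormal_frame e ->
  e ord0 = x -> forall i j : 'I_2,
  sff f x (N x) (e (lift ord0 i)) (e (lift ord0 j)) = (i == j)%:R.
Proof.
move=> x1 oe e0; have x0 := unit_punct x1.
have n1 := N1 x1; have nf v := Nf v x1.
have tr := mean_ge1 x1 oe e0; have lap := lap_unit x1 oe e0.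
have Sx := S_unit_le4 x1.
rewrite /S x1 lap dotZl dotZr n1 mulr1 expr1n mul1r in Sx.
have t k := frame_tangential oe e0 k.
have G := gauss_equation rf x1 n1 nf oe e0 (t ord0) (t ord0) (t ord_max) (t ord_max).
rewrite !oe -!val_eqE/= !(mulr0, mulr1, subr0) in G.
rewrite !big_ord_recl big_ord0 addr0 in tr Sx.
have oE : lift ord0 (ord0 : 'I_1) = ord_max :> 'I_2 by apply/val_inj.
rewrite oE in tr Sx.
have C := sffC rf (N x) x1 (e (lift ord0 ord_max)) (e (lift ord0 ord0)).
rewrite C in G.
have alg (L M P : R) : L * P - M * M = 1 -> 2 <= L + P -> (L + P) ^+ 2 <= 4 ->
    [/\ L = 1, M = 0 & P = 1].
  move=> E h1 h2; have h3 : L + P = 2 by apply/eqP; rewrite eq_le h1 andbT; nra.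
  have PE : P = 2 - L by rewrite -h3; ring.
  (* A trace 2 and a determinant 1 are extremal for a symmetric matrix: the discriminant is zero. *)
  have h4 : (L - 1) ^+ 2 + M ^+ 2 = 0.
    by transitivity (1 - (L * P - M * M)); [rewrite PE; ring|rewrite E subrr].
  move/eqP: h4; rewrite paddr_eq0 ?sqr_ge0// !sqrf_eq0 subr_eq0.
  by move=> /andP[/eqP L1 /eqP ->]; split=> //; rewrite PE L1; ring.
have [h1 h2 h3] := alg _ _ _ G tr Sx.
have two (i : 'I_2) : i = ord0 \/ i = ord_max.
  by case: i => [[|[|i]]] hi //; [left|right]; apply/val_inj.
by move=> i j; case: (two i) => ->; case: (two j) => ->; rewrite ?C.
Qed.

End HilbertTheorem.

(** * Isometries of the sphere as homogeneous maps *)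

Section Curves.
Context {R : realType} {n : nat}.
Local Notation V := 'rV[R]_n.+1.
Implicit Types (M : set V) (p q v x : V).

Lemma smooth_line (x v : V) (I : set R) : smooth_on I (fun t : R => x + t *: v).
Proof.
apply: (@smooth_on_sub _ _ _ _ setT) => //.
apply: smoothD; [exact: openT|exact: smooth_cst|].
apply/smooth_coordP; first exact: openT.
move=> i; apply: (@smooth_on_eq _ _ _ _ (fun t : R => t * v 0 i)).
- exact: openT.
- by move=> t _; rewrite mxE.
- by apply: smoothM; [exact: openT|exact: smooth_id|exact: smooth_cst].
Qed.

Lemma open_line (x v : V) (A : set V) : open A -> open [set t : R | A (x + t *: v)].
Proof.
move=> oA; apply: (@open_comp _ _ (fun t : R => x + t *: v)) => // t _.
exact: (smooth_continuous (@smooth_line x v setT)).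
Qed.

Lemma near_line (x v : V) (A : set V) : open A -> A x ->
  \forall t \near (0 : R), A (x + t *: v).
Proof.
move=> oA Ax; apply: open_nbhs_nbhs; split; first exact: open_line.
by rewrite /= scale0r addr0.
Qed.

Lemma near_right_line (x v : V) (A : set V) : open A -> A x ->
  \forall t \near (0 : R)^'+, A (x + t *: v).
Proof.
move=> oA Ax; have /nbhs_ballP[r /= r0 br] := near_line v oA Ax; near=> t.
have t0 : 0 < t by near: t; exact: nbhs_right_gt.
have tr : t < r by near: t; exact: nbhs_right_lt.
by apply: br; rewrite /ball/= sub0r normrN gtr0_norm.
Unshelve. all: by end_near. Qed.

Lemma line_tangent_curve M (A : set V) (h : V -> V) x v :
  open A -> A x -> smooth_on A h -> (forall y, A y -> M (h y)) ->
  tangent_curve M (h x) ('D_v h x) (fun t => h (x + t *: v)).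
Proof.
move=> oA Ax sh Mh; split.
- exists [set t | A (x + t *: v)].
    by split; [exact: open_line|rewrite /= scale0r addr0].
  split; last by move=> t; exact: Mh.
  apply: (@smooth_comp _ _ _ _ _ A h) => //; first exact: open_line.
  exact: smooth_line.
- by rewrite scale0r addr0.
- have dh : differentiable h (x + (0 : R) *: v).
    by rewrite scale0r addr0; exact: smooth_on_differentiable sh Ax.
  by have := is_derive_line dh; rewrite scale0r addr0.
Qed.

Section LocalExtension.
Variables (M U : set V) (m : nat) (g G : V -> 'rV[R]_m.+1) (p : V).
Hypotheses (oU : open U) (Up : U p) (dG : differentiable G p).
Hypothesis GE : forall q, U q -> M q -> G q = g q.

Lemma tangent_curve_comp v gamma : tangent_curve M p v gamma ->
  is_derive (0 : R) (1 : R) (g \o gamma) ('D_v G p).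
Proof.
move=> [[I [oI I0] [sg Mg]] g0 Dg].
have dg : differentiable gamma 0 by exact: smooth_on_differentiable sg I0.
apply: (@near_eq_is_derive _ _ _ (G \o gamma)).
  near=> t; apply: GE; last first.
    by apply: Mg; near: t; exact: open_nbhs_nbhs.
  near: t; have : gamma t @[t --> (0 : R)] --> p.
    by rewrite -g0; exact: differentiable_continuous.
  by apply; exact: open_nbhs_nbhs.
have dG0 : differentiable G (gamma 0) by rewrite g0.
apply: DeriveDef; first by apply: diff_derivable; exact: differentiable_comp.
by rewrite derive_comp// g0; case: Dg => _ ->.
Unshelve. all: by end_near. Qed.

(** [tdiff] picks a value with [xget]; a smooth local extension shows that all curves with the same
    velocity give the same value, and that there is one. *)
Lemma tdiffE v : tangent M p v -> tdiff M g p v = 'D_v G p.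
Proof.
move=> [gamma tg]; rewrite /tdiff.
case: xgetP => [w _ [gamma' tg' [_ <-]]|].
  by have [_ ->] := tangent_curve_comp tg'.
move=> /(_ ('D_v G p))[]; exists gamma => //.
exact: tangent_curve_comp.
Qed.

End LocalExtension.
End Curves.

Section IsometricSphere.
Context {R : realType} {n : nat}.
Local Notation V := 'rV[R]_n.+1.
Variables (M : set V) (Phi : V -> V).
Hypothesis iso : isometry unit_sphere M Phi.

Let f := Phi \o radial.


Lemma smooth_extension : smooth_on punct f.
Proof.
have [_ sPhi _ _] := iso.
move=> vs x x0.
have [U [G [oU Ux sG GE]]] := sPhi _ (radial_sphere x0).
pose A := punct `&` radial @^-1` U.
have oA : open A by exact: open_smooth_preimage open_punct smooth_radial oU.
suff: smooth_on A f by apply.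
apply: (@smooth_on_eq _ _ _ _ (G \o radial)) => //.
  by move=> y [y0 Uy]; apply: GE => //; exact: radial_sphere.
apply: (@smooth_comp _ _ _ _ _ U) => //; first by move=> y [].
by apply: smooth_on_sub smooth_radial => y [].
Qed.

Lemma extension_tdiff x v : punct x ->
  tangent unit_sphere (radial x) (pd v radial x) /\
  tdiff unit_sphere Phi (radial x) (pd v radial x) = pd v f x.
Proof.
move=> x0; have [_ sPhi _ _] := iso.
have tc := line_tangent_curve v open_punct x0 smooth_radial
  (fun y y0 => radial_sphere y0).
have tg : tangent unit_sphere (radial x) (pd v radial x).
  by rewrite pd.unlock; exists (fun t => radial (x + t *: v)).
split=> //.
have [U [G [oU Ux sG GE]]] := sPhi _ (radial_sphere x0).
have dG := smooth_on_differentiable sG Ux.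
rewrite (tdiffE oU Ux dG GE tg).
have := tangent_curve_comp oU Ux dG GE tc.
have df : differentiable f (x + (0 : R) *: v).
  by rewrite scale0r addr0; exact: smooth_on_differentiable smooth_extension x0.
have [_ E] := is_derive_line df; rewrite scale0r addr0 in E.
by rewrite pd.unlock -E => -[_ <-].
Qed.

Lemma round_immersion_extension : round_immersion f.
Proof.
split; first exact: smooth_extension.
  by move=> c x c0 x0; rewrite /f/= radialZ// expr0 scale1r.
move=> x v w x0; have [_ _ _ metric] := iso.
have [tv <-] := extension_tdiff v x0; have [tw <-] := extension_tdiff w x0.
by apply: metric => //; exact: radial_sphere.
Qed.

Lemma extension_in x : punct x -> M (f x).
Proof.
move=> x0; have [[/(_ (radial x)) + _ _] _ _ _] := iso; apply.
exact: radial_sphere.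
Qed.

Lemma extension_surj p : M p -> exists2 x, dot x x = 1 & f x = p.
Proof.
move=> Mp; have [[_ _ /(_ p Mp)[x xS <-]] _ _ _] := iso.
by exists x; [exact/unit_sphereE|rewrite /f/= radial_id].
Qed.

Lemma extension_tangent x v : punct x -> tangent M (f x) (pd v f x).
Proof.
move=> x0; exists (fun t => f (x + t *: v)); rewrite pd.unlock.
exact: (line_tangent_curve v open_punct x0 smooth_extension extension_in).
Qed.

End IsometricSphere.

(** * The two sides of the boundary *)

Section Sides.
Context {R : realType} {n : nat}.
Local Notation V := 'rV[R]_n.+1.
Variables (Sigma Omega : set V).
Hypothesis enc : encloses Sigma Omega.
Implicit Types (p q x y z v a : V).

Lemma closed_domain : closed Omega.
Proof.
by have [/compact_closed + _ _ _] := enc; apply; exact: norm_hausdorff.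
Qed.

Lemma domain_interior y : Omega y -> ~ Sigma y -> Omega° y.
Proof.
have [_ _ _ SE] := enc; rewrite -SE => Oy nS.
by apply: contrapT => nO; apply: nS.
Qed.

Lemma boundary_domain y : Sigma y -> Omega y.
Proof. by have [_ _ _ <-] := enc => -[]. Qed.

Lemma boundary_not_interior y : Sigma y -> ~ Omega° y.
Proof. by have [_ _ _ <-] := enc => -[]. Qed.


(** Off the boundary, belonging to the closed set [Omega] and to its interior are the same, so the
    parameters of the points inside form a relatively open and closed subset of an interval. *)
Lemma segment_side y a (t0 : R) : 0 <= t0 ->
  (forall t, 0 <= t <= t0 -> ~ Sigma (y + t *: a)) ->
  Omega° y <-> Omega° (y + t0 *: a).
Proof.
move=> t00 nS.
have cg : continuous (fun t : R => y + t *: a).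
  by move=> t; apply: (smooth_continuous (@smooth_line _ _ y a setT)).
pose B := [set t : R | 0 <= t <= t0] `&` [set t | Omega° (y + t *: a)].
have BE : B = [set t : R | 0 <= t <= t0] `&` [set t | Omega (y + t *: a)].
  apply/seteqP; split=> t [/= tt Ot]; split=> //.
    exact: interior_subset Ot.
  exact: domain_interior Ot (nS _ tt).
have cI : connected [set t : R | 0 <= t <= t0].
  by have := @segment_connected R 0 t0; rewrite set_itvE.
have full : B !=set0 -> B = [set t : R | 0 <= t <= t0].
  move=> B0; apply: (cI B B0).
    exists [set t | Omega° (y + t *: a)] => //.
    by apply: open_line; exact: open_interior.
  exists [set t | Omega (y + t *: a)] => //.
  apply: (@closed_comp _ _ (fun t : R => y + t *: a)); last exact: closed_domain.
  by move=> t _; exact: cg.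
split=> Oy.
  have : B t0 by rewrite full /= ?lexx ?t00//; exists 0; split;
    rewrite /= ?lexx// scale0r addr0.
  by case.
have : B 0 by rewrite full /= ?lexx ?t00//; exists t0; split;
  rewrite /= ?lexx ?t00.
by rewrite /B/= scale0r addr0 => -[].
Qed.

(* Pushing a point of [phi > 0] in the direction [a] along which [phi]
   increases stays away from the boundary, hence on the same side of it. *)
Lemma push_side (phi : V -> R) (U : set V) p a : open U -> U p ->
  smooth_on U phi -> (forall q, U q -> (Sigma q <-> phi q = 0)) ->
  phi p = 0 -> 0 < 'D_a phi p ->
  (\forall y \near p, 0 < phi y -> Omega° y) \/
  (\forall y \near p, 0 < phi y -> ~ Omega y).
Proof.
move=> oU Up sphi SE phip Dp.
have : nbhs p (U `&` [set q | 0 < 'D_a phi q]).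
  apply: filterI; first exact: open_nbhs_nbhs.
  have := smooth_continuous (smooth_on_derive a sphi) Up.
  by move=> /cvgr_gt; apply.
move=> /nbhs_normP[r /= r0 br].
(* Points within [r / 2] of [p] remain in the ball of radius [r] when pushed up to time [t0]. *)
pose t0 := r / 2 / (1 + `|a|).
have a1 : 0 < 1 + `|a| by rewrite ltr_wpDr.
have t00 : 0 < t0 by rewrite !divr_gt0.
have small y t : `|p - y| < r / 2 -> 0 <= t <= t0 ->
    U (y + t *: a) /\ 0 < 'D_a phi (y + t *: a).
  move=> py /andP[tt0 tt]; apply: br.
  rewrite /ball_/= opprD addrA (le_lt_trans (ler_normB _ _))// [ltRHS]splitr ltr_leD//.
  rewrite normrZ ger0_norm//; apply: (@le_trans _ _ (t0 * `|a|)).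
    by rewrite ler_wpM2r.
  rewrite /t0 -mulrA -[leRHS]mulr1 ler_pM2l ?divr_gt0//.
  by rewrite mulrC ler_pdivrMr// mul1r lerDr.
have incr y t : `|p - y| < r / 2 -> 0 < t <= t0 -> phi y < phi (y + t *: a).
  move=> py /andP[tpos tt].
  have D s : 0 <= s <= t -> is_derive s (1 : R) (fun s => phi (y + s *: a))
      ('D_a phi (y + s *: a)).
    move=> /andP[s0 st]; apply: is_derive_line.
    apply: smooth_on_differentiable sphi _; apply: (small y s py _).1.
    by rewrite s0 (le_trans st).
  have [s] : exists2 s, s \in `]0, t[%R & phi (y + t *: a) - phi (y + 0 *: a) =
      'D_a phi (y + s *: a) * (t - 0).
    apply: (@MVT R (fun s => phi (y + s *: a)) (fun s => 'D_a phi (y + s *: a))) => //.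
      by move=> s; rewrite in_itv/= => /andP[s0 st]; apply: D; rewrite !ltW.
    apply: derivable_within_continuous => s; rewrite in_itv/= => ss.
    by case: (D s ss).
  rewrite in_itv/= scale0r addr0 subr0 => /andP[s0 st] E.
  rewrite -subr_gt0 E mulr_gt0//; apply: (small y s py _).2.
  by rewrite (ltW s0) (le_trans (ltW st)).
have stay y : `|p - y| < r / 2 -> 0 < phi y ->
    Omega° y <-> Omega° (y + t0 *: a).
  move=> py phiy; apply: segment_side (ltW t00) _ => t tt.
  rewrite SE; last exact: (small y t py tt).1.
  apply/eqP; rewrite gt_eqF//; have [<-|tn0] := eqVneq 0 t.
    by rewrite scale0r addr0.
  by apply: lt_trans phiy (incr _ _ py _); case/andP: tt => tt0 ->; rewrite lt_neqAle tn0 tt0.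
have tt0 : 0 <= t0 <= t0 by rewrite lexx ltW.
have pp : `|p - p| < r / 2 by rewrite subrr normr0 divr_gt0.
have nSp : ~ Sigma (p + t0 *: a).
  rewrite SE; last exact: (small p t0 pp tt0).1.
  by apply/eqP; rewrite gt_eqF// -phip; apply: incr; rewrite ?lexx ?t00.
have cont : {for p, continuous (fun y => y + t0 *: a)}.
  apply: (@smooth_continuous _ _ _ setT (fun y : V => y + t0 *: a)) => //.
  by apply: smoothD; [exact: openT|exact: smooth_id|exact: smooth_cst].
have nearp : \forall y \near p, `|p - y| < r / 2.
  by apply/nbhs_normP; exists (r / 2) => //=; rewrite divr_gt0.
(* The pushed point is off the boundary, hence in one of two open sets, the interior and the
   complement; the nearby points pushed with it are in the same one. *)
have [Op|nOp] := pselect (Omega (p + t0 *: a)).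
  left; have Oi := domain_interior Op nSp.
  have : \forall y \near p, Omega° (y + t0 *: a).
    by apply: cont; apply: open_nbhs_nbhs; split=> //; exact: open_interior.
  move=> nO; near=> y => phiy; apply/stay => //; near: y; first exact: nearp.
  exact: nO.
right; have : \forall y \near p, (~` Omega) (y + t0 *: a).
  apply: cont; apply: open_nbhs_nbhs; split=> //.
  by apply: closed_openC; exact: closed_domain.
move=> nO; near=> y => phiy Oy.
have py : `|p - y| < r / 2 by near: y; exact: nearp.
have : ~ Omega (y + t0 *: a) by near: y; exact: nO.
apply; apply: interior_subset; apply/(stay y py phiy).
apply: domain_interior Oy _; rewrite SE; first by apply/eqP; rewrite gt_eqF.
have := small y 0 py; rewrite scale0r addr0 lexx ltW// => /(_ isT).
by case.
Unshelve. all: by end_near. Qed.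

End Sides.

Section LocalDescription.
Context {R : realType} {n : nat}.
Local Notation V := 'rV[R]_n.+1.
Variables (Sigma Omega : set V).
Hypothesis hyp : hypersurface Sigma.
Hypothesis enc : encloses Sigma Omega.
Implicit Types (p q x y z v a : V).

Definition defining_function (W : set V) (psi : V -> R) :=
  [/\ open W, smooth_on W psi,
     (forall q, W q -> (Omega q <-> 0 <= psi q)),
     (forall q, W q -> (Omega° q <-> 0 < psi q))
   & (forall q, W q -> (Sigma q <-> psi q = 0))].

(** [push_side] is used on both sides of the hypersurface. Two sides in the interior would make [p]
    an interior point; two sides in the complement would take [p] out of the closure of the
    interior. In the remaining cases [phi] or its opposite has the right sign. *)
Lemma exists_defining_function p : Sigma p -> exists W psi,
  [/\ defining_function W psi, W p & exists v, 'D_v psi p != 0].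
Proof.
move=> Sp; have [U [phi [oU Up sphi [v Dv] SE]]] := hyp Sp.
have dphi := smooth_on_differentiable sphi Up.
have phip : phi p = 0 by exact/SE.
pose phi' y := - 1 * phi y.
have sphi' : smooth_on U phi'.
  by apply: smoothM => //; exact: smooth_cst.
have SE' q : U q -> (Sigma q <-> phi' q = 0).
  move=> Uq; rewrite SE// /phi' mulN1r.
  by split=> /eqP; rewrite ?oppr_eq0 => /eqP// ->; rewrite oppr0.
have DN w : 'D_w phi' p = - 'D_w phi p.
  rewrite -deriveN; last exact: diff_derivable.
  by congr ('D_w _ p); apply/funext => y; rewrite /phi' mulN1r.
have DNl w : 'D_(- w) phi p = - 'D_w phi p by rewrite !deriveE// linearN.
have DNl' w : 'D_(- w) phi' p = 'D_w phi p by rewrite DN DNl opprK.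
have [a Da] : exists a, 0 < 'D_a phi p.
  move: Dv; rewrite neq_lt => /orP[Dv|Dv]; last by exists v.
  by exists (- v); rewrite DNl oppr_gt0.
have nU : \forall y \near p, U y by exact: open_nbhs_nbhs.
have phip' : phi' p = 0 by rewrite /phi' phip mulr0.
have pos' y : (0 < phi' y) = (phi y < 0) by rewrite /phi' mulN1r oppr_gt0.
have P1 := push_side enc oU Up sphi SE phip Da.
have P2 := push_side (a := - a) enc oU Up sphi' SE' phip' (ltac:(by rewrite DNl')).
have fin (psi : V -> R) : smooth_on U psi -> (exists v, 'D_v psi p != 0) ->
    (forall q, U q -> (Sigma q <-> psi q = 0)) ->
    (\forall y \near p, 0 < psi y -> Omega° y) ->
    (\forall y \near p, psi y < 0 -> ~ Omega y) ->
    exists W psi, [/\ defining_function W psi, W p & exists v, 'D_v psi p != 0].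
  move=> spsi ex SEpsi np nn.
  have [W [oW Wp] WE] : exists2 W, open_nbhs p W &
      W `<=` [set y | U y /\ (0 < psi y -> Omega° y) /\ (psi y < 0 -> ~ Omega y)].
    have : nbhs p [set y | U y /\ (0 < psi y -> Omega° y) /\ (psi y < 0 -> ~ Omega y)].
      by near=> y; split; [near: y|split; near: y].
    by rewrite nbhsE => -[W]; exists W.
  exists W, psi; split=> //; split=> //.
  - by apply: smooth_on_sub spsi => y /WE[].
  - move=> q /WE[Uq [h1 h2]]; split=> [Oq|].
      by rewrite leNgt; apply/negP => /h2.
    rewrite le_eqVlt => /orP[/eqP E|/h1/interior_subset//].
    by apply: (boundary_domain enc); rewrite SEpsi.
  - move=> q /WE[Uq [h1 h2]]; split=> // Oq.
    rewrite lt_neqAle; apply/andP; split.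
      apply/eqP => E; apply: (boundary_not_interior enc) Oq.
      by rewrite SEpsi.
    by rewrite leNgt; apply/negP => /h2; apply; exact: interior_subset.
  - by move=> q /WE[Uq _]; exact: SEpsi.
have [_ _ clE _] := enc.
case: P1 => P1; case: P2 => P2.
- exfalso; apply: (boundary_not_interior enc Sp).
  rewrite /interior/=.
  near=> y; have [h|h|h] := ltgtP (phi y) 0.
  + by apply: interior_subset; move: h; rewrite -pos'; near: y.
  + by apply: interior_subset; move: h; near: y.
  + by apply: (boundary_domain enc); apply/SE => //; near: y.
- apply: (fin phi) => //; first by exists a; rewrite gt_eqF.
  by near=> y; rewrite -pos'; near: y.
- apply: (fin phi') => //.
    by exists (- a); rewrite DNl' gt_eqF.
  near=> y; rewrite /phi' mulN1r oppr_lt0; by near: y.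
- exfalso; have /= := boundary_domain enc Sp; rewrite -clE => cp.
  have : nbhs p [set y | ~ Omega° y].
    near=> y => Oy; have [h|h|h] := ltgtP (phi y) 0.
    + have : ~ Omega y by move: h; rewrite -pos'; near: y.
      by apply; exact: interior_subset.
    + have : ~ Omega y by move: h; near: y.
      by apply; exact: interior_subset.
    + by apply: (boundary_not_interior enc) Oy; apply/SE => //; near: y.
  by move=> /cp[y []].
Unshelve. all: by end_near. Qed.

Definition gradient (psi : V -> R) q : V := \row_i 'D_(delta_mx 0 i) psi q.

Lemma derive_gradient (psi : V -> R) q v :
  differentiable psi q -> 'D_v psi q = dot (gradient psi q) v.
Proof.
move=> d; rewrite derive_rV// dotE; apply: eq_bigr => i _.
by rewrite mxE mulrC.
Qed.

Lemma smooth_gradient W (psi : V -> R) : open W -> smooth_on W psi ->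
  smooth_on W (gradient psi).
Proof.
move=> oW spsi; apply/smooth_coordP => // i.
apply: (smooth_on_eq (f := 'D_(delta_mx 0 i) psi)) => //.
  by move=> y _; rewrite mxE.
exact: smooth_on_derive.
Qed.

End LocalDescription.

(** * The normal and the mean curvature *)

Lemma right_derivative_ge0 {R : realType} (h : R -> R) (c : R) :
  is_derive (0 : R) (1 : R) h c -> h 0 = 0 ->
  (\forall t \near (0 : R)^'+, 0 <= h t) -> 0 <= c.
Proof.
move=> [dh Ec] h0 hge; rewrite leNgt; apply/negP => c0.
have : \forall t \near 0^', t^-1 * h t < 0.
  have : t^-1 *: (h (t *: 1 + 0) - h 0) @[t --> (0 : R)^'] --> c.
    by rewrite -Ec; exact: dh.
  move=> /(cvgr_lt c) /(_ 0 c0); apply: filterS => t.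
  by rewrite h0 subr0 addr0 /GRing.scale/= mulr1.
move=> /nbhs_ballP[r /= r0 br].
have [t [[ht t0] tr]] : exists t, (0 <= h t /\ 0 < t) /\ t < r.
  apply: (@filter_ex _ ((0 : R)^'+)); near=> t; split; first split.
  - by near: t.
  - by near: t; exact: nbhs_right_gt.
  - by near: t; exact: nbhs_right_lt.
have : t^-1 * h t < 0.
  by apply: br; rewrite ?gt_eqF// /ball/= sub0r normrN gtr0_norm.
by rewrite ltNge mulr_ge0// invr_ge0 ltW.
Unshelve. all: by end_near. Qed.

Section Normal.
Context {R : realType} {n : nat}.
Local Notation V := 'rV[R]_n.+1.
Variables (Sigma Omega : set V) (N Phi : V -> V).
Hypothesis hyp : hypersurface Sigma.
Hypothesis enc : encloses Sigma Omega.
Hypothesis nor : inner_unit_normal Sigma Omega N.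
Hypothesis iso : isometry unit_sphere Sigma Phi.
Implicit Types (p q x y z v a : V).

Let f := Phi \o radial.
Let rf : round_immersion f. Proof. exact: round_immersion_extension iso. Qed.
Let sf : smooth_on punct f. Proof. by case: rf. Qed.
Let hf : homog 0 f. Proof. by case: rf. Qed.
Let unit_punct x : dot x x = 1 -> punct x.
Proof. by move=> x1; rewrite /punct/= -dot_gt0 x1. Qed.
Let fS x : punct x -> Sigma (f x). Proof. by move=> x0; exact: (extension_in iso x0). Qed.

Lemma normal_unit p : Sigma p -> dot (N p) (N p) = 1.
Proof. by move=> /nor[/enorm_eq1]. Qed.

Lemma normal_extension x v : punct x -> dot (pd v f x) (N (f x)) = 0.
Proof.
move=> x0; have [_ + _] := nor (fS x0); rewrite dotC; apply.
exact: (extension_tangent iso).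
Qed.

Lemma gradient_inward W psi q e : defining_function Sigma Omega W psi ->
  W q -> Sigma q -> (\forall t \near (0 : R)^'+, Omega (q + t *: e)) ->
  0 <= dot (gradient psi q) e.
Proof.
move=> [oW spsi O1 O2 S1] Wq Sq Ot.
have dpsi := smooth_on_differentiable spsi Wq.
rewrite -derive_gradient//.
have d0 : differentiable psi (q + (0 : R) *: e) by rewrite scale0r addr0.
have D := is_derive_line d0; rewrite scale0r addr0 in D.
apply: (right_derivative_ge0 D); first by rewrite scale0r addr0; exact/S1.
by apply: filterS2 (near_right_line e oW Wq) Ot => t Wt ?; apply/(O1 _ Wt).
Qed.

(** The gradient is orthogonal to all tangent vectors, hence a multiple of the normal, nonnegative
    because the normal points into the domain. This is where the smoothness of [N] comes from. *)
Lemma normal_gradient W psi q : defining_function Sigma Omega W psi ->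
  W q -> Sigma q -> gradient psi q != 0 -> N q = radial (gradient psi q).
Proof.
move=> def Wq Sq G0; have [oW spsi O1 O2 S1] := def.
have [x x1 fx'] := extension_surj iso Sq; have x0 := unit_punct x1.
have fx : f x = q := fx'.
have [e [oe e0]] := exists_frame x1.
have dpsi := smooth_on_differentiable spsi Wq.
have n1 := normal_unit Sq; rewrite -fx in n1.
have nf v := normal_extension v x0.
have Gf v : dot (gradient psi q) (pd v f x) = 0.
  rewrite -derive_gradient// -[X in 'D__ _ X]fx pd.unlock.
  rewrite -(derive_comp (G := psi)).
  - rewrite (_ : 'D_v _ x = 'D_v (cst 0 : V -> R) x); first by rewrite derive_cst.
    apply: near_eq_derive; near=> y.
    apply/S1; last first.
      apply: fS; near: y; apply: open_nbhs_nbhs.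
      by split=> //; exact: open_punct.
    near: y; apply: (smooth_continuous sf x0).
    by apply: open_nbhs_nbhs; split=> //; rewrite fx.
  - exact: smooth_on_differentiable sf x0.
  - by rewrite fx.
have GE : gradient psi q = dot (gradient psi q) (N q) *: N q.
  apply: dot_ext => w; rewrite (dot_adapted rf x1 n1 nf oe e0) fx.
  rewrite big1 ?addr0; first by rewrite dotZl (dotC w).
  by move=> i _; rewrite Gf mul0r.
have c0 : 0 <= dot (gradient psi q) (N q).
  apply: (gradient_inward def) => //; have [_ _] := nor Sq.
  by apply: filterS => t; exact: interior_subset.
rewrite GE radialZ.
  by rewrite radial_id//; apply/unit_sphereE; rewrite -fx.
rewrite lt_neqAle c0 andbT; apply/eqP => c00.
by move: G0; rewrite GE -c00 scale0r eqxx.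
Unshelve. all: by end_near. Qed.

Lemma normal_local p : Sigma p -> exists (W : set V) (b : V -> V),
  [/\ open W, W p, smooth_on W b & forall q, W q -> Sigma q -> b q = N q].
Proof.
move=> Sp; have [W [psi [def Wp [v Dv]]]] := exists_defining_function hyp enc Sp.
have [oW spsi _ _ _] := def.
have sG := smooth_gradient oW spsi.
pose W' := W `&` gradient psi @^-1` punct.
have oW' : open W' by exact: open_smooth_preimage oW sG open_punct.
exists W', (radial \o gradient psi); split=> //.
- split=> //; rewrite /punct/=; apply: contraNneq Dv => G0.
  rewrite derive_gradient ?G0 ?dot0l//.
  exact: smooth_on_differentiable spsi Wp.
- apply: (smooth_comp oW' open_punct) => [y []//||]; first exact: smooth_radial.
  by apply: smooth_on_sub sG => y [].
- by move=> q [Wq Gq] Sq /=; rewrite (normal_gradient def).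
Qed.

Let g := N \o f.

Lemma smooth_normal_extension : smooth_on punct g.
Proof.
move=> vs x x0.
have [W [b [oW Wx sb bE]]] := normal_local (fS x0).
pose A := punct `&` f @^-1` W.
have oA : open A by exact: open_smooth_preimage open_punct sf oW.
suff: smooth_on A g by apply.
apply: (@smooth_on_eq _ _ _ _ (b \o f)) => //.
  by move=> y [y0 Uy]; apply: bE => //; exact: fS.
apply: (@smooth_comp _ _ _ _ _ W) => //; first by move=> y [].
by apply: smooth_on_sub sf => y [].
Qed.

Lemma normal_extension_homog : homog 0 g.
Proof. by move=> c x c0 x0; rewrite /g/= /f/= radialZ// expr0 scale1r. Qed.

(** Obtained by differentiating the orthogonality of [pd v f] and the normal along [w]. *)
Lemma weingarten x v w : punct x ->
  dot (pd w g x) (pd v f x) = - sff f x (g x) w v.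
Proof.
move=> x0; apply/eqP; rewrite -addr_eq0; apply/eqP.
rewrite /sff (dotC _ (g x)).
rewrite -(derive_dot w x0 smooth_normal_extension (smooth_pd v sf)).
rewrite (derive_eq_on (g2 := cst 0) open_punct w x0) ?derive_cst//.
by move=> y y0; rewrite dotC; exact: normal_extension.
Qed.

Lemma pd_normal_perp x w : punct x -> dot (pd w g x) (g x) = 0.
Proof.
move=> x0; have : 'D_w (fun y => dot (g y) (g y)) x = 0.
  rewrite (derive_eq_on (g2 := cst (1 : R)) open_punct w x0) ?derive_cst//.
  by move=> y y0; apply: normal_unit; exact: fS.
rewrite (derive_dot w x0 smooth_normal_extension smooth_normal_extension).
by rewrite (dotC (g x)); lra.
Qed.

(* The lower bound excludes the junk value 0 of [tangent_trace]. *)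
Lemma mean_curvature_trace x e : dot x x = 1 -> orthonormal_frame e ->
  e ord0 = x -> (0 < n)%N -> 1 <= mean_curvature Sigma N (f x) ->
  n%:R * mean_curvature Sigma N (f x) =
  \sum_(i < n) sff f x (g x) (e (lift ord0 i)) (e (lift ord0 i)).
Proof.
move=> x1 oe e0 n0; have x0 := unit_punct x1.
have n1 := normal_unit (fS x0); have nf v := normal_extension v x0.
have nR : (n%:R : R) != 0 by rewrite pnatr_eq0 -lt0n.
rewrite /mean_curvature mulVKf// /tangent_trace.
case: xgetP => [t _|_]; last by rewrite mulr0 leNgt ltr01.
move=> [E [B [rE tE AE ->]]] _.
have [W [b [oW Wx sb bE]]] := normal_local (fS x0).
have db := smooth_on_differentiable sb Wx.
have tdN v : tangent Sigma (f x) v -> tdiff Sigma N (f x) v = 'D_v b (f x).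
  by move=> tv; rewrite (tdiffE oW Wx db bE tv).
have tdNf v : 'D_(pd v f x) b (f x) = pd v g x.
  rewrite [in RHS]pd.unlock (_ : 'D_v g x = 'D_v (b \o f) x).
    have df := smooth_on_differentiable sf x0.
    by rewrite (derive_comp v df db) pd.unlock.
  apply: near_eq_derive; near=> y; apply/esym/bE; last first.
    by apply: fS; near: y; apply: open_nbhs_nbhs; split=> //; exact: open_punct.
  near: y; apply: (smooth_continuous sf x0); exact: open_nbhs_nbhs.
(* [C] is the change of basis from the arbitrary basis [E] to the orthonormal one [F]. It conjugates
   [B] to the matrix [H] of the second fundamental form, so that the traces agree. *)
pose F := \matrix_(i < n) pd (e (lift ord0 i)) f x.
pose C := \matrix_(i < n, j < n) dot (row i E) (pd (e (lift ord0 j)) f x).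
pose H := \matrix_(i < n, j < n) sff f x (g x) (e (lift ord0 i)) (e (lift ord0 j)).
have ECF : E = C *m F.
  apply/row_matrixP => i; rewrite row_mul mulmx_sum_row.
  apply: dot_ext => w; rewrite (dot_adapted rf x1 n1 nf oe e0).
  have [_ perp _] := nor (fS x0).
  rewrite (dotC (row i E) (N _)) perp// mul0r add0r dot_suml.
  by apply: eq_bigr => j _; rewrite rowK !mxE dotZl (dotC w).
have BCH : B *m C = C *m H.
  apply/matrixP => i k.
  transitivity (dot (row i (B *m E)) (pd (e (lift ord0 k)) f x)).
    rewrite ECF mulmxA row_mul mulmx_sum_row dot_suml (bigD1 k)//= rowK dotZl.
    rewrite (pd_tangential rf x1) ?(frame_tangential oe e0)// oe eqxx mulr1.
    rewrite big1 ?addr0; first by rewrite [RHS]mxE.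
    move=> j jk; rewrite rowK dotZl.
    rewrite (pd_tangential rf x1) ?(frame_tangential oe e0)// oe.
    by rewrite (inj_eq lift_inj) (negbTE jk) mulr0.
  rewrite -AE /shape_operator tdN// {1}ECF row_mul mulmx_sum_row dotNl.
  rewrite deriveE// linear_sum dot_suml -sumrN mxE.
  apply: eq_bigr => j _; rewrite linearZ/= rowK -deriveE// tdNf dotZl.
  by rewrite weingarten// mulrN opprK !mxE.
have Cu : C \in unitmx.
  rewrite -row_free_unit /row_free eqn_leq rank_leq_row.
  by apply: leq_trans (mxrankM_maxl C F); rewrite -ECF (eqP rE).
rewrite -[B](mulmxK Cu) BCH mxtrace_mulC mulmxA mulVmx// mul1mx.
by rewrite /mxtrace; apply: eq_bigr => i _; rewrite mxE.
Unshelve. all: by end_near. Qed.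

End Normal.

(** * Umbilic hypersurfaces *)

Section DiscOfSphere.
Context {R : realType} {n : nat}.
Local Notation V := 'rV[R]_n.+1.
Variables (Sigma Omega : set V) (c : V).
Hypothesis enc : encloses Sigma Omega.
Hypothesis Sigma0 : Sigma !=set0.
Hypothesis sphere : forall p, Sigma p -> dot (p - c) (p - c) = 1.

Let d (x : V) := dot (x - c) (x - c).

Let dline (x v : V) t : d (x + t *: v) = d x + 2 * t * dot (x - c) v + t ^+ 2 * dot v v.
Proof.
rewrite /d (_ : x + t *: v - c = (x - c) + t *: v); last by rewrite addrAC.
by move: (x - c) => u; rewrite !(dotDl, dotDr, dotZl, dotZr) (dotC v u); ring.
Qed.

Let continuous_d : continuous d.
Proof.
move=> x; apply: (@smooth_continuous _ _ _ setT) => //.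
by apply: smooth_dot; [exact: openT|..];
  (apply: smoothD; [exact: openT|exact: smooth_id|exact: smooth_cst]).
Qed.

Let small_step (A : set V) x v : open A -> A x ->
  exists t : R, [/\ 0 < t, t < 1 & A (x + t *: v)].
Proof.
move=> oA Ax.
have /nbhs_ballP[r /= r0 br] := near_line v oA Ax.
exists (Num.min (1 / 2) (r / 2)).
have m0 : 0 < Num.min (1 / 2 : R) (r / 2) by rewrite lt_min !divr_gt0.
split=> //; first by rewrite gt_min; apply/orP; left; lra.
apply: br; rewrite /ball/= sub0r normrN gtr0_norm// gt_min; apply/orP; right; lra.
Qed.

Let push_out x : Omega° x -> 0 < d x -> exists2 y, Omega y & d x < d y.
Proof.
move=> Ox dx; have [t [t0 _ Ot]] := small_step (x - c) (open_interior Omega) Ox.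
exists (x + t *: (x - c)); first exact: interior_subset.
rewrite dline -/(d x); nra.
Qed.

(** The distance to [c] attains its maximum on the compact domain; at an interior point other than
    [c], moving away from [c] would increase it, so if the maximum exceeded 1 it would be on the
    boundary, where it is 1. *)
Let domain_sub x : Omega x -> d x <= 1.
Proof.
have [cO _ _ _] := enc; have [p Sp] := Sigma0.
have O0 : Omega !=set0 by exists p; exact: (boundary_domain enc).
have [y yO ymax] := compact_EVT_max O0 cO (continuous_subspaceT continuous_d).
rewrite inE in yO => Ox; apply: (@le_trans _ _ (d y)); first exact/ymax/mem_set.
have [Sy|nSy] := pselect (Sigma y); first by rewrite /d sphere.
have Oy := domain_interior enc yO nSy.
rewrite leNgt; apply/negP => y1.
have [z Oz] := push_out Oy (lt_trans ltr01 y1).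
by rewrite ltNge ymax//; exact/mem_set.
Qed.

Let interior_ball x : Omega° x -> d x < 1.
Proof.
move=> Ox; rewrite lt_neqAle domain_sub ?andbT; last exact: interior_subset.
apply/eqP => dx; have [|z Oz] := push_out Ox; first by rewrite dx.
by rewrite dx ltNge domain_sub.
Qed.

(** The segment from some interior point to [x] stays in the open ball by convexity, hence never
    meets the boundary. *)
Let ball_interior x : d x < 1 -> Omega° x.
Proof.
move=> dx; have [_ _ clE _] := enc; have [p Sp] := Sigma0.
have : closure Omega° p by rewrite clE; exact: (boundary_domain enc).
clear clE; move=> /(_ setT filterT)[z [Oz _]]; have dz := interior_ball Oz.
have H : forall t : R, 0 <= t <= 1 -> ~ Sigma (z + t *: (x - z)).
  move=> t /andP[t0 t1] /sphere; rewrite -/(d _) dline -/(d z).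
  have dx' : d x = d z + 2 * 1 * dot (z - c) (x - z) + 1 ^+ 2 * dot (x - z) (x - z).
    by rewrite -dline scale1r addrC subrK.
  have := dot_ge0 (x - z); rewrite dx' in dx.
  move: (dot (z - c) (x - z)) (dot (x - z) (x - z)) (d z) dx dz => A B D dx dz B0 E.
  have P1 : 0 <= t * (1 - t) * B by rewrite !mulr_ge0// subr_ge0.
  have P2 : 0 <= (1 - t) * (1 - D) by rewrite mulr_ge0 ?subr_ge0// ltW.
  have : 0 <= t * (1 - (D + 2 * 1 * A + 1 ^+ 2 * B)).
    by rewrite mulr_ge0 ?subr_ge0// ltW.
  rewrite le_eqVlt eq_sym mulf_eq0 subr_eq0 (gt_eqF dx) orbF.
  move=> /orP[/eqP t00|P3]; first by rewrite t00 in E; lra.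
  lra.
have := (segment_side enc ler01 H).1 Oz.
by rewrite scale1r addrC subrK.
Qed.

Lemma disc_of_sphere : Omega = round_disc c 1 /\ Sigma = round_sphere c 1.
Proof.
have dE x : (enorm (x - c) <= 1) = (d x <= 1).
  by rewrite /enorm -[X in (_ <= X) = _]sqrtr1 ler_sqrt.
have OD : Omega = [set x | d x <= 1].
  apply/seteqP; split=> x /=; first exact: domain_sub.
  move=> dx; apply: contrapT => nO.
  (* The complement is open, so a small step from [x] towards the center remains in it, but that
     step enters the open ball. *)
  have [t [t0 t1 nOt]] := small_step (c - x) (closed_openC (closed_domain enc)) nO.
  apply: nOt; apply: interior_subset; apply: ball_interior.
  rewrite dline -[c - x]opprB dotNl !dotNr opprK -/(d x).
  have h : 0 <= (1 - t) ^+ 2 * (1 - d x) by rewrite mulr_ge0 ?sqr_ge0 ?subr_ge0.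
  move: (d x) dx h => D dx h; nra.
have [_ _ _ <-] := enc; split.
  by rewrite OD; apply/seteqP; split=> x /=; rewrite /round_disc/= dE.
rewrite OD; apply/seteqP; split=> x /=; rewrite /round_sphere/= enorm_eq1.
  move=> [dx nO]; apply/eqP; rewrite eq_le dx leNgt; apply/negP => dx1.
  by apply: nO; rewrite -OD; exact: ball_interior.
move=> dx; split; first by rewrite /d dx.
by rewrite -OD => /interior_ball; rewrite /d dx ltxx.
Qed.

End DiscOfSphere.

Section ConstantOnPunct.
Context {R : realType} {n : nat}.
Local Notation V := 'rV[R]_n.+1.
Implicit Types (x y v : V).

Lemma pd_frame (h : V -> V) e v x : smooth_on punct h -> punct x ->
  orthonormal_frame e -> pd v h x = \sum_i dot v (e i) *: pd (e i) h x.
Proof.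
move=> sh x0 oe; have dh := smooth_on_differentiable sh x0.
rewrite {1}(frame_sum v oe) pd.unlock deriveE// linear_sum.
by apply: eq_bigr => i _; rewrite linearZ/= deriveE.
Qed.

Lemma const_of_pd0 (h : V -> V) x y : smooth_on punct h ->
  (forall v z, punct z -> pd v h z = 0) ->
  (forall t : R, 0 <= t <= 1 -> punct (x + t *: (y - x))) -> h x = h y.
Proof.
move=> sh h0 seg; apply/rowP => i.
have D (t : R) : 0 <= t <= 1 -> is_derive t (1 : R) (fun t => h (x + t *: (y - x)) 0 i) 0.
  move=> tt; have dh := smooth_on_differentiable sh (seg t tt).
  have H := is_derive_coord 0 i (is_derive_line dh).
  apply: (@is_derive_eq _ _ _ _ _ _ _ _ H).
  by have := h0 (y - x) _ (seg t tt); rewrite pd.unlock => ->; rewrite mxE.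
have [t] : exists2 t, t \in `]0, 1[%R &
   h (x + 1 *: (y - x)) 0 i - h (x + 0 *: (y - x)) 0 i = (fun _ : R => 0) t * (1 - 0).
  apply: (@MVT R (fun t => h (x + t *: (y - x)) 0 i) (fun _ : R => 0)) => //.
    by move=> t; rewrite in_itv/= => /andP[t0 t1]; apply: D; rewrite !ltW.
  apply: derivable_within_continuous => t; rewrite in_itv/= => tt.
  by case: (D t tt).
move=> _ /eqP; rewrite mul0r subr_eq0 scale1r scale0r addr0 addrC subrK.
by move=> /eqP.
Qed.

(** The segment between two unit vectors avoids the origin unless they are antipodal; antipodal
    vectors are joined through a unit vector orthogonal to both, which exists as [n] is positive. *)
Lemma const_on_sphere (h : V -> V) x y : (0 < n)%N -> smooth_on punct h ->
  (forall v z, punct z -> pd v h z = 0) ->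
  dot x x = 1 -> dot y y = 1 -> h x = h y.
Proof.
move=> n0 sh h0.
have main a b : dot a a = 1 -> dot b b = 1 -> a != - b -> h a = h b.
  move=> a1 b1 ab; apply: const_of_pd0 => // t /andP[t0 t1].
  rewrite /punct/=; apply: contra_neq ab => E.
  have E1 : (1 - t) *: a = - (t *: b).
    apply/eqP; rewrite -addr_eq0 -[X in _ == X]E scalerBl scale1r scalerBr.
    by rewrite addrAC addrA.
  have E2 : (1 - t) ^+ 2 = t ^+ 2.
    have := congr1 (fun z => dot z z) E1.
    by rewrite dotNl dotNr opprK !(dotZl, dotZr) a1 b1 !mulr1 -!expr2.
  have tE : t = 1 / 2 by nra.
  apply: (@scalerI _ _ (1 / 2)); first by rewrite mul1r invr_eq0.
  by rewrite scalerN -[in RHS]tE -E1 tE; congr (_ *: _); field.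
move=> x1 y1; have [xy|] := eqVneq x (- y); last exact: main.
have [e [oe e0]] := exists_frame x1.
pose w := e (lift ord0 (Ordinal n0)).
have w1 : dot w w = 1 by rewrite oe eqxx.
have xw : dot x w = 0 by rewrite -e0 oe.
have nw u : u = x \/ u = y -> u != - w.
  move=> uxy; apply/eqP => uw; have : dot x u = 0 by rewrite uw dotNr xw oppr0.
  by case: uxy => ->; rewrite ?x1 ?xy ?dotNl ?y1 => /eqP; rewrite ?oppr_eq0 oner_eq0.
rewrite (main x w) ?nw//; [by apply/esym/main => //; apply: nw; right|by left].
Qed.

End ConstantOnPunct.

Section Umbilic.
Context {R : realType} {n : nat}.
Local Notation V := 'rV[R]_n.+1.
Variables (Sigma Omega : set V) (N Phi : V -> V).
Hypothesis hyp : hypersurface Sigma.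
Hypothesis enc : encloses Sigma Omega.
Hypothesis nor : inner_unit_normal Sigma Omega N.
Hypothesis iso : isometry unit_sphere Sigma Phi.
Hypothesis n0 : (0 < n)%N.

Let f := Phi \o radial.
Let g := N \o f.

Hypothesis umbilic : forall x, dot x x = 1 -> exists e,
  [/\ orthonormal_frame e, e ord0 = x & forall i j : 'I_n,
    sff f x (g x) (e (lift ord0 i)) (e (lift ord0 j)) = (i == j)%:R].

Let rf : round_immersion f. Proof. exact: round_immersion_extension iso. Qed.
Let sf : smooth_on punct f. Proof. by case: rf. Qed.
Let hf : homog 0 f. Proof. by case: rf. Qed.
Let sg : smooth_on punct g.
Proof. exact: smooth_normal_extension hyp enc nor iso. Qed.
Let hg : homog 0 g. Proof. exact: normal_extension_homog. Qed.

Let pd_normal_unit x v : dot x x = 1 -> pd v g x = - pd v f x.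
Proof.
move=> x1; have x0 : punct x by rewrite /punct/= -dot_gt0 x1.
have [e [oe e0 sffE]] := umbilic x1.
have n1 := normal_unit nor (extension_in iso x0).
have nf w := normal_extension nor iso w x0.
rewrite (pd_frame v sg x0 oe) (pd_frame v sf x0 oe) -sumrN.
apply: eq_bigr => i _; rewrite -scalerN; congr (_ *: _).
case: (unliftP ord0 i) => [j|] ->; last first.
  rewrite e0 (smooth_pd_euler sg hg x0) (smooth_pd_euler sf hf x0).
  by rewrite oppr0 !scale0r oppr0.
apply: dot_ext => w; rewrite (dot_adapted rf x1 n1 nf oe e0 (pd _ g x)).
rewrite (pd_normal_perp hyp enc nor iso _ x0) mul0r add0r.
rewrite (bigD1 j)//= big1 ?addr0.
  rewrite (weingarten hyp enc nor iso _ _ x0) sffE eqxx mulN1r.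
  by rewrite dotNl dotC.
move=> k kj; rewrite (weingarten hyp enc nor iso _ _ x0) sffE.
by rewrite eq_sym (negbTE kj) oppr0 mul0r.
Qed.

(** Both derivatives are homogeneous of degree -1, so the equality extends from unit vectors. *)
Let pd_normal x v : punct x -> pd v g x = - pd v f x.
Proof.
move=> x0; have r0 : 0 < enorm x by rewrite enorm_gt0.
have y0 : punct (radial x) by apply: sphere_neq0; exact: radial_sphere.
have -> : x = enorm x *: radial x.
  by rewrite scalerA divff ?scale1r// gt_eqF.
rewrite (smooth_pd_homog v sg hg r0 y0) (smooth_pd_homog v sf hf r0 y0).
by rewrite pd_normal_unit ?scalerN//; exact: dot_radial.
Qed.

Theorem umbilic_round : exists c, Omega = round_disc c 1 /\ Sigma = round_sphere c 1.
Proof.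
pose h y := g y + f y.
have sh : smooth_on punct h by apply: smoothD => //; exact: open_punct.
have h0 v z : punct z -> pd v h z = 0.
  by move=> z0; rewrite (pdD v z0 sg sf) pd_normal// addNr.
pose x0 : V := delta_mx 0 ord0.
have x1 : dot x0 x0 = 1 by rewrite dot_delta mxE !eqxx.
have p0 : punct x0 by rewrite /punct/= -dot_gt0 x1.
exists (h x0); apply: disc_of_sphere => //.
  by exists (f x0); exact: (extension_in iso p0).
move=> p Sp; have [x xx fx] := extension_surj iso Sp.
have fxp : f x = p := fx.
rewrite -(const_on_sphere n0 sh h0 xx x1) -fxp.
have -> : f x - h x = - N (f x) by rewrite /h opprD addrCA subrr addr0.
by rewrite dotNl dotNr opprK (normal_unit nor)// fxp.
Qed.

End Umbilic.

(** * Convexity *)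

Section Convexity.
Context {R : realType} {n : nat}.
Local Notation V := 'rV[R]_n.+1.
Variables (Sigma Omega : set V) (N Phi : V -> V).
Hypothesis hyp : hypersurface Sigma.
Hypothesis enc : encloses Sigma Omega.
Hypothesis nor : inner_unit_normal Sigma Omega N.
Hypothesis iso : isometry unit_sphere Sigma Phi.
Implicit Types (p q x y z v a e : V).

Let f := Phi \o radial.
Let g := N \o f.

Hypothesis sff_pos : forall x a, dot x x = 1 -> dot x a = 0 -> a != 0 ->
  0 < sff f x (g x) a a.

Let rf : round_immersion f. Proof. exact: round_immersion_extension iso. Qed.
Let sf : smooth_on punct f. Proof. by case: rf. Qed.
Let fS x : punct x -> Sigma (f x).
Proof. by move=> x0; exact: (extension_in iso x0). Qed.

Lemma tangent_vector x e : dot x x = 1 -> dot (g x) e = 0 ->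
  exists2 a, dot x a = 0 & pd a f x = e.
Proof.
move=> x1 ge; have x0 : punct x by rewrite /punct/= -dot_gt0 x1.
have [b [oe e0]] := exists_frame x1.
have n1 := normal_unit nor (fS x0); have nf v := normal_extension nor iso v x0.
exists (\sum_(i < n) dot e (pd (b (lift ord0 i)) f x) *: b (lift ord0 i)).
  rewrite dot_sumr big1// => i _.
  by rewrite dotZr (frame_tangential oe e0) mulr0.
apply: dot_ext => w; rewrite (dot_adapted rf x1 n1 nf oe e0 e w) (dotC e) ge mul0r add0r.
have df := smooth_on_differentiable sf x0.
rewrite {1}pd.unlock deriveE// linear_sum dot_suml; apply: eq_bigr => i _.
by rewrite linearZ/= -deriveE// dotZl (dotC _ w) pd.unlock.
Qed.

(** Along a tangent line the defining function has first derivative 0 and, by positivity of the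
    second fundamental form, a negative second derivative; it therefore takes negative values
    arbitrarily close to [p]. *)
Lemma leaves_domain p e (d : R) : Sigma p -> e != 0 -> dot (N p) e = 0 -> 0 < d ->
  exists t, 0 < t < d /\ ~ Omega (p + t *: e).
Proof.
move=> Sp en0 Ne d0; have [x x1 fx'] := extension_surj iso Sp.
have fx : f x = p := fx'; have x0 : punct x by rewrite /punct/= -dot_gt0 x1.
have [a xa ae] : exists2 a, dot x a = 0 & pd a f x = e.
  by apply: tangent_vector => //; rewrite /g/= fx.
have an0 : a != 0.
  by apply: contraNneq en0 => a0; rewrite -ae a0 pd.unlock derive0.
have [W [psi [def Wp [v Dv]]]] := exists_defining_function hyp enc Sp.
have [oW spsi O1 O2 S1] := def.
have sG := smooth_gradient oW spsi.
have dpsi := smooth_on_differentiable spsi Wp.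
have G0 : gradient psi p != 0.
  by apply: contraNneq Dv => G0; rewrite derive_gradient// G0 dot0l.
pose k := enorm (gradient psi p).
have k0 : 0 < k by rewrite enorm_gt0.
have GE : gradient psi p = k *: N p.
  rewrite (normal_gradient nor iso def Wp Sp G0) /radial scalerA.
  by rewrite divff ?scale1r// gt_eqF.
pose A := punct `&` f @^-1` W.
have oA : open A by exact: open_smooth_preimage open_punct sf oW.
have Ax : A x by split=> //; rewrite /= fx.
have sfA : smooth_on A f by apply: smooth_on_sub sf => y [].
have sGf : smooth_on A (gradient psi \o f).
  by apply: (@smooth_comp _ _ _ _ _ W) => // y [].
(* The derivative of the vanishing product of the gradient along [f] and [pd a f] relates the
   Hessian of [psi] to the second fundamental form. *)
have c_val : dot ('D_e (gradient psi) p) e = - (k * sff f x (g x) a a).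
  have E0 : 'D_a (fun y => dot ((gradient psi \o f) y) (pd a f y)) x = 0.
    rewrite (derive_eq_on (g2 := cst (0 : R)) oA a Ax) ?derive_cst//.
    move=> y [y0 Wy] /=.
    rewrite -derive_gradient; last exact: smooth_on_differentiable spsi Wy.
    rewrite pd.unlock -(derive_comp (G := psi)).
    - rewrite (derive_eq_on (g2 := cst (0 : R)) oA a) ?derive_cst//.
      by move=> z [z0 Wz]; apply/S1 => //; exact: fS.
    - exact: smooth_on_differentiable sf y0.
    - exact: smooth_on_differentiable spsi Wy.
  move: E0; rewrite (derive_dot a Ax sGf (smooth_pd a sfA)).
  rewrite {1}pd.unlock (derive_comp (G := gradient psi)); last 2 first.
  - exact: smooth_on_differentiable sf x0.
  - by rewrite fx; exact: smooth_on_differentiable sG Wp.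
  rewrite /= fx GE dotZl ae (_ : 'D_a f x = e); last by rewrite -ae pd.unlock.
  by rewrite /sff /g/= fx (dotC (N p)) => /eqP; rewrite addr_eq0 => /eqP.
have /nbhs_ballP[r /= r0 br] := near_line e oW Wp.
have Wt (t : R) : `|t| < r -> W (p + t *: e).
  by move=> tr; apply: br; rewrite /ball/= sub0r normrN.
pose h (t : R) := - psi (p + t *: e).
pose h' (t : R) := - 'D_e psi (p + t *: e).
have Dh t : `|t| < r -> is_derive t (1 : R) h (h' t).
  move=> /Wt Wte; apply: is_deriveN; apply: is_derive_line.
  exact: smooth_on_differentiable spsi Wte.
have Dh' : is_derive (0 : R) (1 : R) h' (k * sff f x (g x) a a).
  have d2 : differentiable ('D_e psi) (p + (0 : R) *: e).
    rewrite scale0r addr0.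
    exact: smooth_on_differentiable (smooth_on_derive e spsi) Wp.
  apply: (@is_derive_eq _ _ _ _ _ _ _ _ (is_deriveN (is_derive_line d2))).
  rewrite scale0r addr0 -[RHS]opprK -c_val; congr (- _).
  transitivity ('D_e (fun q => dot (gradient psi q) e) p).
    apply: (derive_eq_on oW e Wp) => q Wq.
    by rewrite derive_gradient//; exact: smooth_on_differentiable spsi Wq.
  have [_ ->] := is_derive_dot (smooth_is_derive e sG Wp) (is_derive_cst e p e).
  by rewrite dot0r addr0.
have h'0 : h' 0 = 0.
  by rewrite /h' scale0r addr0 derive_gradient// GE dotZl Ne mulr0 oppr0.
have c0 : 0 < k * sff f x (g x) a a by rewrite mulr_gt0// sff_pos.
have [t [/andP[t0 tm] ht]] := second_derivative_gt0_incr r0 Dh Dh' h'0 c0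
  (ltac:(by rewrite lt_min d0 r0) : 0 < Num.min d r).
exists t; rewrite t0 (lt_le_trans tm) ?ge_min ?lexx//; split=> //.
have tr : `|t| < r by rewrite gtr0_norm// (lt_le_trans tm)// ge_min lexx orbT.
rewrite O1; last exact: Wt.
apply/negP; rewrite -ltNge -oppr_gt0; apply: le_lt_trans ht.
rewrite /h scale0r addr0; have -> : psi p = 0 by exact/S1.
by rewrite oppr0.
Qed.

Lemma inward p e : Sigma p -> (\forall t \near (0 : R)^'+, Omega (p + t *: e)) ->
  0 <= dot (N p) e.
Proof.
move=> Sp Ot.
have [W [psi [def Wp [v Dv]]]] := exists_defining_function hyp enc Sp.
have [oW spsi O1 O2 S1] := def.
have dpsi := smooth_on_differentiable spsi Wp.
have G0 : gradient psi p != 0.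
  by apply: contraNneq Dv => G0; rewrite derive_gradient// G0 dot0l.
rewrite (normal_gradient nor iso def Wp Sp G0) /radial dotZl.
rewrite pmulr_rge0 ?invr_gt0 ?enorm_gt0//.
exact: (gradient_inward def).
Qed.

(** If the segment touched the boundary strictly between its ends, both of its directions there
    would point inward, so it would be tangent and leave the domain. *)
Lemma open_segment_interior x y t : Omega° x -> Omega° y ->
  (forall s, 0 <= s <= 1 -> Omega (x + s *: (y - x))) -> 0 <= t <= 1 ->
  Omega° (x + t *: (y - x)).
Proof.
move=> Ox Oy seg /andP[t0 t1].
have [->|tn0] := eqVneq t 0; first by rewrite scale0r addr0.
have [->|tn1] := eqVneq t 1; first by rewrite scale1r addrC subrK.
have tp : 0 < t by rewrite lt_neqAle eq_sym tn0.
have tl : t < 1 by rewrite lt_neqAle tn1.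
apply: (domain_interior enc) => [|Sp]; first by apply: seg; rewrite t0 t1.
set p := x + t *: (y - x) in Sp *; set e := y - x in p Sp *.
have e0 : e != 0.
  rewrite subr_eq0; apply/eqP => xy; apply: (boundary_not_interior enc Sp).
  by rewrite /p /e xy subrr scaler0 addr0 -xy.
have near_p (s : R) : `|s| < Num.min t (1 - t) -> Omega (p + s *: e).
  rewrite lt_min ltr_norml => /andP[/andP[s1 s2]]; rewrite ltr_norml => /andP[s3 s4].
  by rewrite /p -addrA -scalerDl; apply: seg; apply/andP; split; lra.
have m0 : 0 < Num.min t (1 - t) by rewrite lt_min tp subr_gt0.
have side (s : R) : `|s| = 1 -> \forall t \near (0 : R)^'+, Omega (p + t *: (s *: e)).
  move=> s1; near=> u; rewrite scalerA; apply: near_p.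
  rewrite normrM s1 mulr1 gtr0_norm; last by near: u; exact: nbhs_right_gt.
  by near: u; exact: nbhs_right_lt.
have i1 := inward Sp (side 1 (normr1 _)).
have i2 := inward Sp (side (-1) (normrN1 _)).
rewrite scale1r in i1; rewrite scaleN1r dotNr in i2.
have Ne : dot (N p) e = 0 by lra.
have [s [/andP[s0 sm] nO]] := leaves_domain Sp e0 Ne m0.
by apply: nO; apply: near_p; rewrite gtr0_norm.
Unshelve. all: by end_near. Qed.

End Convexity.

Section Convexity.
Context {R : realType} {n : nat}.
Local Notation V := 'rV[R]_n.+1.
Variables (Sigma Omega : set V) (N Phi : V -> V).
Hypothesis hyp : hypersurface Sigma.
Hypothesis enc : encloses Sigma Omega.
Hypothesis nor : inner_unit_normal Sigma Omega N.
Hypothesis iso : isometry unit_sphere Sigma Phi.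
Implicit Types (p q x y z v a e : V).

Let f := Phi \o radial.
Let g := N \o f.

Hypothesis sff_pos : forall x a, dot x x = 1 -> dot x a = 0 -> a != 0 ->
  0 < sff f x (g x) a a.

Let affine_continuous (s : R) x : continuous (fun y : V => x + s *: (y - x)).
Proof.
move=> y; apply: (@smooth_continuous _ _ _ setT (fun y : V => x + s *: (y - x))) => //.
apply: smoothD; [exact: openT|exact: smooth_cst|].
apply/smooth_coordP; first exact: openT.
move=> i; apply: (@smooth_on_eq _ _ _ _ (fun z : V => s * (z - x) 0 i)).
- exact: openT.
- by move=> t _; rewrite !mxE.
- apply: (smoothM (f := cst s)); [exact: openT|exact: smooth_cst|].
  apply: (smooth_coordP _ (@openT _)).1.
  by apply: smoothD; [exact: openT|exact: smooth_id|exact: smooth_cst].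
Qed.

Let affine_continuous' (s : R) z : continuous (fun y : V => y + s *: (z - y)).
Proof.
rewrite (_ : (fun y : V => y + s *: (z - y)) = (fun y => z + (1 - s) *: (y - z))).
  exact: affine_continuous.
apply/funext => y; rewrite scalerBl scale1r addrA addrCA subrr addr0.
by rewrite -scalerN opprB.
Qed.

(* The set of the points of the interior that are visible from [x] is both
   open and closed in it. *)
Lemma interior_convex x y s : Omega° x -> Omega° y -> 0 <= s <= 1 ->
  Omega° (x + s *: (y - x)).
Proof.
move=> Ox Oy.
pose I := [set s : R | 0 <= s <= 1].
pose C := [set y | forall s, I s -> Omega° (x + s *: (y - x))].
pose D := \bigcap_(s in I) (fun y => x + s *: (y - x)) @^-1` Omega.
pose B := Omega° `&` C.
have BD : B = Omega° `&` D.
  apply/seteqP; split=> z [Oz H]; split=> // t tI.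
    exact: interior_subset (H t tI).
  exact: (open_segment_interior hyp enc nor iso sff_pos Ox Oz H).
have cI : compact I.
  by have := @segment_compact R 0 1; rewrite set_itvE.
have oC : open C.
  rewrite openE => z Cz.
  (* Visibility is an open condition for each parameter; compactness of the segment makes it
     uniform. *)
  apply: ((compact_near_coveringP I).1 cI V (nbhs z)
    (fun z' t => Omega° (x + t *: (z' - x)))) => t tI.
  have : (x + u.1 *: (u.2 - x)) @[u --> (t, z)] --> x + t *: (z - x).
    apply: cvgD; first exact: cvg_cst.
    apply: cvgZ; first exact: cvg_fst.
    by apply: cvgB; [exact: cvg_snd|exact: cvg_cst].
  apply; apply: open_nbhs_nbhs; split; first exact: open_interior.
  exact: Cz.
have cD : closed D.
  apply: closed_bigI => t _; apply: closed_comp; last exact: closed_domain enc.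
  by move=> z _; exact: affine_continuous.
have [_ conn _ _] := enc.
have BE : B = Omega°.
  apply: conn.
  - exists x; split=> // t _.
    by rewrite subrr scaler0 addr0.
  - by exists C.
  - by exists D.
by have : B y by [rewrite BE]; case=> _ + sI; apply.
Qed.

(** Convexity passes from the interior to its closure, in one endpoint after the other. *)
Lemma domain_convex y z s : Omega y -> Omega z -> 0 <= s <= 1 ->
  Omega (y + s *: (z - y)).
Proof.
move=> + + sI; have [_ _ clE _] := enc; have cO := closed_domain enc.
have sub (A : set V) : closed A -> Omega° `<=` A -> Omega `<=` A.
  by move=> cA OA; rewrite -clE; apply: (subset_trans (closure_subset OA));
    rewrite -(closure_id A).1.
move: y z; suff H z : Omega° z -> Omega `<=` [set y | Omega (y + s *: (z - y))].
  move=> y z Oy; apply: (sub [set z | Omega (y + s *: (z - y))]).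
    by apply: (@closed_comp _ _ (fun z => y + s *: (z - y))) => // w _; exact: affine_continuous.
  by move=> w Ow; exact: (H w Ow _ Oy).
move=> Oz; apply: sub.
  by apply: (@closed_comp _ _ (fun y => y + s *: (z - y))) => // w _; exact: affine_continuous'.
by move=> w Ow; exact: interior_subset (interior_convex Ow Oz sI).
Qed.

(** By convexity the chord points inward at both ends. Equal normals make it tangent at [p], so it
    would have to leave the domain if its ends were distinct. *)
Lemma gauss_map_injective p q : Sigma p -> Sigma q -> N p = N q -> p = q.
Proof.
move=> Sp Sq Npq; have Op := boundary_domain enc Sp; have Oq := boundary_domain enc Sq.
have near01 (u w : V) : Omega u -> Omega w ->
    \forall t \near (0 : R)^'+, Omega (u + t *: (w - u)).
  move=> Ou Ow; near=> t; apply: domain_convex => //; apply/andP; split.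
    by apply: ltW; near: t; exact: nbhs_right_gt.
  by apply: ltW; near: t; exact: nbhs_right_lt.
have i1 := inward hyp enc nor iso Sp (near01 _ _ Op Oq).
have i2 := inward hyp enc nor iso Sq (near01 _ _ Oq Op).
rewrite -Npq -opprB dotNr in i2.
have E : dot (N p) (q - p) = 0 by lra.
apply/eqP; rewrite eq_sym -subr_eq0; apply/negP => /negP e0.
have [t [/andP[t0 t1] nO]] := leaves_domain hyp enc nor iso sff_pos Sp e0 E ltr01.
by apply: nO; apply: domain_convex => //; rewrite !ltW.
Unshelve. all: by end_near. Qed.

End Convexity.

(** * Plane curves *)

Section Turning.
Context {R : realType}.

Lemma exists_primitive (w : R -> R) (T : R) : continuous w -> 0 < T ->
  exists th : R -> R, th 0 = 0 /\
    forall t, -1 < t < T + 1 -> is_derive t (1 : R) th (w t).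
Proof.
move=> cw T0.
(* Integration starts at -1, so that 0 is an interior point and the derivative is two-sided on the
   closed interval from 0 to [T]. *)
pose F x := (\int[lebesgue_measure]_(t in `[(-1 : R), x]) (w t))%R.
exists (fun x => F x - F 0); split; first by rewrite subrr.
move=> t /andP[t0 tT].
have int : lebesgue_measure.-integrable `[(-1 : R), T + 1] (EFin \o w).
  apply: continuous_compact_integrable; first exact: segment_compact.
  exact: continuous_subspaceT.
have [dF EF] := @continuous_FTC1_closed _ w (-1) t (T + 1) tT int t0 (cw t).
have DF : is_derive t (1 : R) F (w t).
  by apply: DeriveDef; [exact: dF|rewrite -derive1E].
have := is_deriveB DF (is_derive_cst (F 0) t (1 : R)).
by rewrite subr0.
Qed.

(** By the intermediate value theorem, [w] cannot pass from one side of the gap between -1 and 1 to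
    the other; [s] is its sign. *)
Lemma continuous_sign (w : R -> R) : continuous w -> (forall t, 1 <= w t ^+ 2) ->
  exists s : R, s ^+ 2 = 1 /\ forall t, 1 <= s * w t.
Proof.
move=> cw w1.
have dich t : w t <= -1 \/ 1 <= w t.
  have := w1 t; rewrite -[X in X <= _](expr1n _ 2) -[leRHS]real_normK ?num_real//.
  rewrite ler_pXn2r ?nnegrE// ler_normr => /orP[]; [by right|left; lra].
have nz t : w t <> 0 by move=> E; case: (dich t); rewrite E; lra.
have same a b : a <= b -> ~ (w a <= -1 /\ 1 <= w b) /\ ~ (1 <= w a /\ w b <= -1).
  move=> ab; have cab := continuous_subspaceT cw.
  by split=> -[ha hb];
    (have [|c _ /nz//] := @IVT R w a b 0 ab (cab _));
    rewrite ge_min le_max; apply/andP; split; apply/orP; (left; lra) || (right; lra).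
have all s t : (1 <= w s -> 1 <= w t).
  move=> ws; case: (dich t) => // wt; have [st|ts] := leP s t.
    by have [_ []] := same _ _ st.
  by have [[]] := same _ _ (ltW ts).
case: (dich 0) => w0; [exists (-1)|exists 1]; split.
- by rewrite sqrrN expr1n.
- move=> t; rewrite mulN1r; case: (dich t) => wt; first lra.
  by have := all t 0 wt; lra.
- by rewrite expr1n.
- by move=> t; rewrite mul1r; exact: all w0.
Qed.

Lemma increment_ge (th w : R -> R) (a b lo hi : R) :
  (forall t, lo < t < hi -> is_derive t (1 : R) th (w t)) ->
  (forall t, 1 <= w t) -> lo < a -> a <= b -> b < hi -> b - a <= th b - th a.
Proof.
move=> D w1 la ab bh.
have D' t : a <= t <= b -> is_derive t (1 : R) th (w t).
  by move=> /andP[ta tb]; apply: D; rewrite (lt_le_trans la ta) (le_lt_trans tb bh).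
have [t] : exists2 t, t \in `[a, b]%R & th b - th a = w t * (b - a).
  apply: MVT_segment => //.
    by move=> t; rewrite in_itv/= => /andP[ta tb]; apply: D'; rewrite !ltW.
  apply: derivable_within_continuous => t; rewrite in_itv/= => tt.
  by case: (D' t tt).
by move=> _ ->; rewrite ler_peMl// subr_ge0.
Qed.

(** The vector (nu1, nu2) turns with angular velocity [w]; turned back by the angle [s * th], it has
    derivative 0. *)
Lemma rotation_constant (nu1 nu2 w th : R -> R) (s lo hi : R) :
  s ^+ 2 = 1 -> lo < 0 ->
  (forall t, is_derive t (1 : R) nu1 (- (w t * nu2 t))) ->
  (forall t, is_derive t (1 : R) nu2 (w t * nu1 t)) ->
  (forall t, lo < t < hi -> is_derive t (1 : R) th (s * w t)) -> th 0 = 0 ->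
  forall t, 0 <= t < hi ->
    cos (th t) * nu1 t + s * sin (th t) * nu2 t = nu1 0 /\
    cos (th t) * nu2 t - s * sin (th t) * nu1 t = nu2 0.
Proof.
move=> s1 lo0 D1 D2 D th0 t /andP[t0 th_].
have const (h : R -> R) : (forall u, lo < u < hi -> is_derive u (1 : R) h 0) -> h t = h 0.
  move=> Dh; apply/eqP; rewrite -subr_eq0.
  have [u] : exists2 u, u \in `[0, t]%R & h t - h 0 = (fun _ : R => 0) u * (t - 0).
    apply: (@MVT_segment R h (fun _ : R => 0)) => //.
      move=> u; rewrite in_itv/= => /andP[u0 ut]; apply: Dh.
      by rewrite (lt_trans lo0 u0) (lt_trans ut th_).
    apply: derivable_within_continuous => u; rewrite in_itv/= => /andP[u0 ut].
    by case: (Dh u _) => //; rewrite (lt_le_trans lo0 u0) (le_lt_trans ut th_).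
  by move=> _ ->; rewrite mul0r.
have Dc u : lo < u < hi -> is_derive u (1 : R) (cos \o th) (- sin (th u) * (s * w u)).
  by move=> uu; apply: is_derive1_comp; exact: D.
have Ds u : lo < u < hi -> is_derive u (1 : R) (sin \o th) (cos (th u) * (s * w u)).
  by move=> uu; apply: is_derive1_comp; exact: D.
have Ds' u : lo < u < hi -> is_derive u (1 : R) (fun u => s * sin (th u))
    (s * (cos (th u) * (s * w u))).
  by move=> uu; exact: (is_deriveZ s (Ds u uu)).
split.
  transitivity (cos (th 0) * nu1 0 + s * sin (th 0) * nu2 0); last first.
    by rewrite th0 cos0 sin0; ring.
  apply: (const (fun u => cos (th u) * nu1 u + s * sin (th u) * nu2 u)) => u uu.
  have H := is_deriveD (is_deriveM (Dc u uu) (D1 u))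
    (is_deriveM (Ds' u uu) (D2 u)).
  apply: (@is_derive_eq _ _ _ _ _ _ _ _ H).
  rewrite /GRing.scale/=.
  move: (cos _) (sin _) (nu1 _) (nu2 _) (w _) => C S n1 n2 W.
  transitivity (C * n2 * W * (s ^+ 2 - 1)); first by ring.
  by rewrite s1 subrr mulr0.
transitivity (cos (th 0) * nu2 0 - s * sin (th 0) * nu1 0); last first.
  by rewrite th0 cos0 sin0; ring.
apply: (const (fun u => cos (th u) * nu2 u - s * sin (th u) * nu1 u)) => u uu.
have H := is_deriveB (is_deriveM (Dc u uu) (D2 u))
  (is_deriveM (Ds' u uu) (D1 u)).
apply: (@is_derive_eq _ _ _ _ _ _ _ _ H).
rewrite /GRing.scale/=.
move: (cos _) (sin _) (nu1 _) (nu2 _) (w _) => C S n1 n2 W.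
transitivity (- (C * n1 * W * (s ^+ 2 - 1))); first by ring.
by rewrite s1 subrr mulr0 oppr0.
Qed.

(** The angle grows at speed at least 1. Were it to exceed a full turn at time [pi *+ 2], it would
    have completed the turn earlier, against the absence of returns; so it is exactly a full turn,
    and the lower bound on each subinterval leaves no excess. *)
Lemma unit_turning_speed (nu1 nu2 w : R -> R) : continuous w ->
  (forall t, 1 <= w t ^+ 2) ->
  (forall t, is_derive t (1 : R) nu1 (- (w t * nu2 t))) ->
  (forall t, is_derive t (1 : R) nu2 (w t * nu1 t)) ->
  (forall t, 0 < t < pi *+ 2 -> ~ (nu1 t = nu1 0 /\ nu2 t = nu2 0)) ->
  forall t, 0 < t < pi *+ 2 -> w t ^+ 2 = 1.
Proof.
move=> cw w1 D1 D2 inj t /andP[t0 tT].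
have T0 : 0 < pi *+ 2 :> R by rewrite pmulrn_lgt0// pi_gt0.
have [s [s1 sw]] := continuous_sign cw w1.
have csw : continuous (fun t => s * w t).
  by move=> u; apply: cvgM; [exact: cvg_cst|exact: cw].
have [th [th0 Dth]] := exists_primitive csw T0.
have rot := rotation_constant s1 (ltrN10 R) D1 D2 Dth th0.
set T := pi *+ 2 in T0 tT inj Dth rot.
have noT u : 0 < u < T -> th u <> T.
  move=> /andP[u0 uT] E; have [|r1 r2] := rot u.
    by rewrite ltW//= (lt_trans uT)// ltrDl.
  apply: (inj u); first by rewrite u0 uT.
  by rewrite -r1 -r2 E /T cos2pi sin2pi; split; ring.
have inc := increment_ge Dth sw.
have TT : T < T + 1 by rewrite ltrDl.
have thT : th T = T.
  have h := inc 0 T (ltrN10 R) (ltW T0) TT; rewrite th0 !subr0 in h.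
  apply/eqP; rewrite eq_le h andbT leNgt; apply/negP => lt.
  have [||u] := @IVT R th 0 T T (ltW T0).
  - apply: derivable_within_continuous => u; rewrite in_itv/= => /andP[u0 uT].
    by case: (Dth u _) => //; rewrite (lt_le_trans _ u0)// (le_lt_trans uT TT).
  - by rewrite th0 ge_min le_max (ltW T0) (ltW lt) orbT.
  rewrite in_itv/= => /andP[u0 uT] E; apply: (noT u) => //.
  rewrite !lt_neqAle u0 uT !andbT; apply/andP; split; apply/eqP => uE.
    by move: E; rewrite -uE th0 => T00; move: T0; rewrite -T00 ltxx.
  by move: lt; rewrite -{2}uE E ltxx.
have thE u : 0 <= u <= T -> th u = u.
  move=> /andP[u0 uT]; apply/eqP; rewrite eq_le; apply/andP; split.
    have := inc u T (lt_le_trans (ltrN10 R) u0) uT TT; rewrite thT; lra.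
  by have := inc 0 u (ltrN10 R) u0 (le_lt_trans uT TT); rewrite th0 !subr0.
have E1 : s * w t = 1.
  have [|_ <-] := Dth t; first by rewrite (lt_trans _ t0)//= (lt_trans tT TT).
  rewrite -[RHS](@derive_id R R t 1); apply: near_eq_derive.
  near=> u; apply: thE; apply/andP; split; apply: ltW.
    by near: u; exact: lt_nbhsr.
  by near: u; exact: lt_nbhsl.
by rewrite -[LHS]mul1r -s1 -exprMn E1 expr1n.
Unshelve. all: by end_near. Qed.

End Turning.

Lemma is_derive_scale {R : realType} {U : normedModType R} (k : R -> R) (v : U) (t dk : R) :
  is_derive t (1 : R) k dk -> is_derive t (1 : R) (fun s => k s *: v) (dk *: v).
Proof.
move=> Dk; have dk' : differentiable k t by apply/derivable1_diffP; case: Dk.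
have dkv : differentiable (fun s => k s *: v) t by exact: differentiableZl.
apply: DeriveDef; first exact: diff_derivable.
by rewrite deriveE// diffZl//= -deriveE//; case: Dk => _ ->.
Qed.

Section PlaneCurve.
Context {R : realType}.
Local Notation V := 'rV[R]_2.
Variables (Sigma Omega : set V) (N Phi : V -> V).
Hypothesis hyp : hypersurface Sigma.
Hypothesis enc : encloses Sigma Omega.
Hypothesis nor : inner_unit_normal Sigma Omega N.
Hypothesis iso : isometry unit_sphere Sigma Phi.

Let f := Phi \o radial.
Let g := N \o f.

Hypothesis curvature_ge1 : forall x e, dot x x = 1 -> orthonormal_frame e ->
  e ord0 = x -> 1 <= sff f x (g x) (e (lift ord0 ord0)) (e (lift ord0 ord0)).

Let rf : round_immersion f. Proof. exact: round_immersion_extension iso. Qed.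
Let sf : smooth_on punct f. Proof. by case: rf. Qed.
Let sg : smooth_on punct g.
Proof. exact: smooth_normal_extension hyp enc nor iso. Qed.
Let unit_punct (x : V) : dot x x = 1 -> punct x.
Proof. by move=> x1; rewrite /punct/= -dot_gt0 x1. Qed.

Definition frame2 (u v : V) : 'I_2 -> V := fun i => nth 0 [:: u; v] i.

Lemma frame2_orthonormal (a b : V) : dot a a = 1 -> dot b b = 1 -> dot a b = 0 ->
  orthonormal_frame (frame2 a b).
Proof.
move=> a1 b1 ab [[|[|i]] hi] [[|[|j]] hj] //=;
 by rewrite /frame2/= ?a1 ?b1 ?ab// dotC.
Qed.

Let curvature_unit x a : dot x x = 1 -> dot x a = 0 -> dot a a = 1 ->
  1 <= sff f x (g x) a a.
Proof. by move=> x1 xa a1; exact: (curvature_ge1 x1 (frame2_orthonormal x1 a1 xa)). Qed.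

Let sff_pos x a : dot x x = 1 -> dot x a = 0 -> a != 0 -> 0 < sff f x (g x) a a.
Proof.
move=> x1 xa a0; have r0 : 0 < enorm a by rewrite enorm_gt0.
have -> : a = enorm a *: radial a by rewrite scalerA divff ?scale1r// gt_eqF.
rewrite (sffZ rf _ x1) (sffC rf _ x1) (sffZ rf _ x1) !mulr_gt0//.
apply: lt_le_trans ltr01 _; apply: curvature_unit => //; last exact: dot_radial.
by rewrite /radial dotZr xa mulr0.
Qed.

Let dot2 (u v : V) : dot u v = u 0 0 * v 0 0 + u 0 1 * v 0 1.
Proof.
rewrite dotE !big_ord_recl big_ord0 addr0.
by congr (_ + u 0 _ * v 0 _); apply/val_inj.
Qed.

Section AlongCircle.
Variables a b : V.
Hypotheses (a1 : dot a a = 1) (b1 : dot b b = 1) (ab : dot a b = 0).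

Let z (t : R) : V := cos t *: a + sin t *: b.
Let z' (t : R) : V := - sin t *: a + cos t *: b.

Let z_unit t : dot (z t) (z t) = 1.
Proof.
rewrite /z !(dotDl, dotDr, dotZl, dotZr) (dotC b a) a1 b1 ab.
by rewrite -[RHS](cos2Dsin2 t); ring.
Qed.

Let z'_unit t : dot (z' t) (z' t) = 1.
Proof.
rewrite /z' !(dotDl, dotDr, dotZl, dotZr) (dotC b a) a1 b1 ab.
by rewrite -[RHS](cos2Dsin2 t); ring.
Qed.

Let zz' t : dot (z t) (z' t) = 0.
Proof.
rewrite /z /z' !(dotDl, dotDr, dotZl, dotZr) (dotC b a) a1 b1 ab; ring.
Qed.

Let Dz t : is_derive t (1 : R) z (z' t).
Proof.
exact: (is_deriveD (is_derive_scale a (is_derive_cos t)) (is_derive_scale b (is_derive_sin t))).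
Qed.

Let z0 t : punct (z t). Proof. exact: unit_punct. Qed.

Let dz t : differentiable z t.
Proof. by apply/derivable1_diffP; case: (Dz t). Qed.

Let nu (t : R) := g (z t).
Let velocity (t : R) := - sin t *: pd a g (z t) + cos t *: pd b g (z t).

Let velocityE t : velocity t = pd (z' t) g (z t).
Proof.
have dg := smooth_on_differentiable sg (z0 t).
rewrite /velocity /z' pd.unlock derive_linear//; congr (_ + _).
by rewrite -[cos t *: b]addr0 derive_linear// derive0 addr0.
Qed.

Let Dnu t : is_derive t (1 : R) nu (velocity t).
Proof.
have dg := smooth_on_differentiable sg (z0 t).
have dgz : differentiable (g \o z) t by exact: differentiable_comp.
apply: DeriveDef; first exact: diff_derivable.
rewrite (derive_comp _ (dz t) dg) velocityE pd.unlock.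
by congr ('D_ _ g _); case: (Dz t).
Qed.

(** The determinant of [nu] and its derivative, that is, the angular velocity of the unit vector
    [nu]. *)
Let omega t := velocity t 0 1 * nu t 0 0 - velocity t 0 0 * nu t 0 1.

Let nu_unit t : dot (nu t) (nu t) = 1.
Proof. exact: (normal_unit nor (extension_in iso (z0 t))). Qed.

Let velocity_perp t : dot (velocity t) (nu t) = 0.
Proof. by rewrite velocityE; exact: (pd_normal_perp hyp enc nor iso _ (z0 t)). Qed.

(** The velocity is orthogonal to the unit vector [nu], so by Lagrange's identity the squared
    determinant is its squared norm, and its only component is the curvature. *)
Let omega_sqr t : omega t ^+ 2 = sff f (z t) (g (z t)) (z' t) (z' t) ^+ 2.
Proof.
have nf v := normal_extension nor iso v (z0 t).
have := dot_adapted rf (z_unit t) (nu_unit t) nf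
  (frame2_orthonormal (z_unit t) (z'_unit t) (zz' t)) (erefl _)
  (velocity t) (velocity t).
rewrite velocity_perp mul0r add0r big_ord_recl big_ord0 addr0 /frame2/= velocityE.
rewrite (weingarten hyp enc nor iso _ _ (z0 t)) -/f -/g -velocityE mulrNN -expr2 => <-.
have := nu_unit t; have := velocity_perp t; rewrite /omega !dot2.
move: (velocity t 0 0) (velocity t 0 1) (nu t 0 0) (nu t 0 1) => p q r s E1 E2.
transitivity ((p * p + q * q) * (r * r + s * s) - (p * r + q * s) ^+ 2); first by ring.
by rewrite E1 E2 expr0n /= subr0 mulr1.
Qed.

Let omega_ge1 t : 1 <= omega t ^+ 2.
Proof. by rewrite omega_sqr exprn_ege1// curvature_unit. Qed.

Let continuous_omega : continuous omega.
Proof.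
have cg i : continuous (fun t => nu t 0 i).
  move=> t; apply: differentiable_continuous.
  apply: (coord_differentiable (F := g \o z)); apply: differentiable_comp => //.
  exact: smooth_on_differentiable sg (z0 t).
have cv i : continuous (fun t => velocity t 0 i).
  have -> : (fun t => velocity t 0 i) =
      (fun t => - sin t * pd a g (z t) 0 i + cos t * pd b g (z t) 0 i).
    by apply/funext => t; rewrite /velocity !mxE.
  have cp v : continuous (fun t => pd v g (z t) 0 i).
    move=> t; apply: differentiable_continuous.
    apply: (coord_differentiable (F := pd v g \o z)); apply: differentiable_comp => //.
    exact: smooth_on_differentiable (smooth_pd v sg) (z0 t).
  move=> t; apply: cvgD; apply: cvgM; try exact: cp.
    by apply: cvgN; exact: continuous_sin.
  exact: continuous_cos.
move=> t; apply: cvgB; apply: cvgM; (exact: cg || exact: cv).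
Qed.

Let coord_equations t : is_derive t (1 : R) (fun t => nu t 0 0) (- (omega t * nu t 0 1)) /\
  is_derive t (1 : R) (fun t => nu t 0 1) (omega t * nu t 0 0).
Proof.
have := nu_unit t; have := velocity_perp t; rewrite !dot2 => E1 E2.
split.
  apply: (@is_derive_eq _ _ _ _ _ _ _ _ (is_derive_coord 0 0 (Dnu t))).
  rewrite /omega; move: E1 E2.
  move: (velocity t 0 0) (velocity t 0 1) (nu t 0 0) (nu t 0 1) => p q r s E1 E2.
  transitivity (p * (r * r + s * s) - r * (p * r + q * s)).
    by rewrite E1 E2 mulr1 mulr0 subr0.
  by ring.
apply: (@is_derive_eq _ _ _ _ _ _ _ _ (is_derive_coord 0 1 (Dnu t))).
rewrite /omega; move: E1 E2.
move: (velocity t 0 0) (velocity t 0 1) (nu t 0 0) (nu t 0 1) => p q r s E1 E2.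
transitivity (q * (r * r + s * s) - s * (p * r + q * s)).
  by rewrite E1 E2 mulr1 mulr0 subr0.
by ring.
Qed.

(** Injectivity of the Gauss map and of the isometry brings an equality of normals back to the
    circle, where no point is repeated before time [pi *+ 2]. *)
Let no_return t : 0 < t < pi *+ 2 -> ~ (nu t 0 0 = nu 0 0 0 /\ nu t 0 1 = nu 0 0 1).
Proof.
move=> /andP[t0 tT] [E0 E1].
have nuE : N (f (z t)) = N (f (z 0)).
  apply/rowP => i; have [->|->] : i = 0 \/ i = 1.
    by case: i => [[|[|i]] hi] //; [left|right]; apply/val_inj.
  - exact: E0.
  - exact: E1.
have fE := gauss_map_injective hyp enc nor iso sff_pos
  (extension_in iso (z0 t)) (extension_in iso (z0 0)) nuE.
have [[_ inj _] _ _ _] := iso.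
have zE : z t = z 0.
  rewrite -[LHS]radial_id; last exact/unit_sphereE.
  rewrite -[RHS]radial_id; last exact/unit_sphereE.
  by apply: inj fE; apply/mem_set; exact: radial_sphere (z0 _).
have cos1 : cos t = 1.
  have := congr1 (dot a) zE.
  by rewrite /z !(dotDr, dotZr) a1 ab cos0 !mulr1 !mulr0 !addr0.
have sin_0 : sin t = 0.
  have := congr1 (dot b) zE.
  by rewrite /z !(dotDr, dotZr) (dotC b a) b1 ab sin0 !mulr1 !mulr0 !add0r.
have [tp|tp|tp] := ltgtP t pi.
- by have := @sin_gt0_pi R t; rewrite t0 tp sin_0 ltxx => /(_ isT).
- have := @sin_gt0_pi R (t - pi); rewrite subr_gt0 tp ltrBlDr -mulr2n tT => /(_ isT).
  by rewrite sinB sin_0 sinpi mul0r mulr0 subr0 ltxx.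
- by move: cos1; rewrite tp cospi => E; lra.
Qed.

(** [unit_turning_speed] only concerns times strictly inside the period; a circle starting at the
    antipode reaches a given point at the time [pi]. *)
Lemma curvature_halfway : sff f (z pi) (g (z pi)) (z' pi) (z' pi) = 1.
Proof.
have pi0 := pi_gt0 R.
have h := unit_turning_speed continuous_omega omega_ge1
  (fun t => (coord_equations t).1) (fun t => (coord_equations t).2) no_return.
have : omega pi ^+ 2 = 1.
  by apply: h; rewrite pi0 mulr2n ltrDl.
rewrite omega_sqr => /eqP; rewrite sqrf_eq1 => /orP[/eqP//|/eqP E].
by have := curvature_unit (z_unit pi) (zz' pi) (z'_unit pi); rewrite E; lra.
Qed.

End AlongCircle.

Lemma plane_curve_curvature x b : dot x x = 1 -> dot b b = 1 -> dot x b = 0 ->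
  sff f x (g x) b b = 1.
Proof.
move=> x1 b1 xb.
have a1 : dot (- x) (- x) = 1 by rewrite dotNl dotNr opprK.
have ab : dot (- x) b = 0 by rewrite dotNl xb oppr0.
have := curvature_halfway a1 b1 ab.
rewrite cospi sinpi !scale0r addr0 oppr0 scale0r add0r !scaleN1r opprK.
by rewrite -scaleN1r (sffZ rf _ x1) (sffC rf _ x1) (sffZ rf _ x1) !mulN1r opprK.
Qed.

End PlaneCurve.

(** * The sphere theorem *)

Theorem corollary6 (R : realType) (n : nat) (n_gt0 : (0 < n)%N)
    (Sigma Omega : set 'rV[R]_n.+1) (N : 'rV[R]_n.+1 -> 'rV[R]_n.+1) :
  hypersurface Sigma ->
  encloses Sigma Omega ->
  inner_unit_normal Sigma Omega N ->
  isometric_isospin_sphere Sigma N ->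
  (forall p, Sigma p -> 1 <= mean_curvature Sigma N p) ->
  exists c : 'rV[R]_n.+1,
    Omega = round_disc c 1 /\ Sigma = round_sphere c 1.
Proof.
move=> hyp enc nor [Phi [iso _]] H1.
pose f := Phi \o radial; pose g := N \o f.
have rf : round_immersion f by exact: round_immersion_extension iso.
have trace x e : dot x x = 1 -> orthonormal_frame e -> e ord0 = x ->
    n%:R <= \sum_(i < n) sff f x (g x) (e (lift ord0 i)) (e (lift ord0 i)).
  move=> x1 oe e0; have x0 : punct x by rewrite /punct/= -dot_gt0 x1.
  have Hx := H1 _ (extension_in iso x0).
  rewrite -(mean_curvature_trace hyp enc nor iso x1 oe e0 n_gt0 Hx).
  by rewrite ler_peMr.
have n1 x : dot x x = 1 -> dot (g x) (g x) = 1.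
  by move=> x1; apply: (normal_unit nor); apply: (extension_in iso);
    rewrite /punct/= -dot_gt0 x1.
have nf x v : dot x x = 1 -> dot (pd v f x) (g x) = 0.
  by move=> x1; apply: (normal_extension nor iso); rewrite /punct/= -dot_gt0 x1.
apply: (umbilic_round hyp enc nor iso n_gt0) => x x1.
have [e [oe e0]] := exists_frame x1; exists e; split=> //.
case: n n_gt0 => [//|[|[|n']]] n_gt0 in Sigma Omega N hyp enc nor Phi iso H1 f g rf
  trace n1 nf x x1 e oe e0 *.
- move=> i j; rewrite !ord1 eqxx.
  apply: (plane_curve_curvature hyp enc nor iso) => //.
  + by move=> y b y1 ob b0; have := trace y b y1 ob b0; rewrite big_ord_recl big_ord0 addr0.
  + by rewrite -e0 oe.
- exact: (round_immersion_sff2 rf n1 nf trace x1 oe e0).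
- apply: (sff_id_of_trace rf x1 (n1 x x1) (fun v => nf x v x1) oe e0) => //.
  exact: trace.
Qed.
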